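(* The lowest homogeneity component of the curvature $\kappa$ of a normal $|2|$-graded Cartan connection is both $\partial^*$-closed and $\partial$-closed; it is therefore a section of the second cohomology bundle $H^2(gr(T),gr(\mathcal A))$.
   Context: **Parabolic pair.** $G$ is a semisimple Lie group whose Lie algebra is $|2|$-graded: $\mathfrak g=\bigoplus_{i=-2}^2\mathfrak g_i$ with $[\mathfrak g_i,\mathfrak g_j]\subset\mathfrak g_{i+j}$, $\mathfrak g_0$ contains no simple summand of $\mathfrak g$, and $\mathfrak g_1$ generates $\mathfrak g^1:=\mathfrak g_1\oplus\mathfrak g_2$. $\mathfrak g^i=\bigoplus_{j\ge i}\mathfrak g_j$, $\mathfrak p=\mathfrak g^0$, $\mathfrak g_-=\mathfrak g_{-2}\oplus\mathfrak g_{-1}\cong(\mathfrak g^1)^*$ (Killing form). $P$ and $G_0$ are the subgroups of $G$ preserving the filtration $(\mathfrak g^i)$, respectively the grading. **Cartan connection.** $\mathcal P\to M$ is a principal $P$-bundle over a manifold $M$ with $\dim M=\dim\mathfrak g_-$. A $|2|$-graded Cartan connection is a $P$-equivariant $\mathfrak g$-valued one-form $\omega$ on $\mathcal P$ with $\omega(\xi_A)=A$ for $A\in\mathfrak p$ and each $\omega_u:T_u\mathcal P\to\mathfrak g$ an isomorphism. $\mathcal A=\mathcal P\times_P\mathfrak g$ is the adjoint bundle, $\mathcal A^i=\mathcal P\times_P\mathfrak g^i$, and $\omega$ induces the soldering form $T\cong\mathcal A/\mathcal A^0$ ($T$ the tangent bundle of $M$), hence a filtration of $T$; $gr(T)$ and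 $gr(\mathcal A)$ are the associated graded bundles. The curvature is $\kappa\in\Gamma(\wedge^2T^*\otimes\mathcal A)$, and its lowest homogeneity component is a well-defined section of the corresponding homogeneous part of $\wedge^2gr(T)^*\otimes gr(\mathcal A)$. **Operators.** On $C_j=\wedge^j\mathfrak g^1\otimes\mathfrak g=\mathrm{Hom}(\wedge^j\mathfrak g_-,\mathfrak g)$, with the homogeneity grading, $\partial:C_j\to C_{j+1}$ is the Lie algebra cohomology differential of $\mathfrak g_-$ with values in $\mathfrak g$ and $\partial^*:C_j\to C_{j-1}$ is the Kostant codifferential, adjoint to $\partial$ for a definite metric; on $C_2$, $(\partial^*\psi)(x)=\sum_l[z^l,\psi(x,z_l)]-\frac12\sum_l\psi([z^l,x]_-,z_l)$ for dual bases $(z_l)$, $(z^l)$ of $\mathfrak g_-$, $\mathfrak g^1$, where $y_-$ is the $\mathfrak g_-$-component of $y$. Both preserve homogeneity and are $G_0$-equivariant, so induce operators on $\wedge^jgr(T)^*\otimes gr(\mathcal A)$; $\partial^*$ is $P$-equivariant, so is defined on $\wedge^jT^*\otimes\mathcal A$. $H^2(gr(T),gr(\mathcal A))$ is the bundle with fibre $H^2(\mathfrak g^1,\mathfrak g)=\ker\partial^*_2/\mathrm{im}\,\partial^*_3\cong\ker(\partial\partial^*+\partial^*\partial)$, i.e. the bundle $\mathcal P\times_PH^2(\mathfrak g^1,\mathfrak g)$. $\omega$ is normal if $\partial^*\kappa=0$. *)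

(* Defs.v *)
From HB Require Import structures.
From mathcomp Require Import all_boot all_order all_algebra.
From mathcomp Require Import all_classical all_reals all_analysis.
Set Implicit Arguments.
Unset Strict Implicit.
Unset Printing Implicit Defensive.
Import Order.TTheory GRing.Theory Num.Theory.
Import numFieldNormedType.Exports.
Local Open Scope classical_set_scope.
Local Open Scope ring_scope.

Definition iterD (R : realType) (E F : normedModType R) (vs : seq E)
    (f : E -> F) : E -> F :=
  foldr (fun v g => fun x => 'D_v g x) f vs.

(* f is C^oo on a neighbourhood of x.  Used for finite-dimensional E and F
   only, where this means that all iterated partial derivatives exist and are
   continuous. *)
Definition smooth_near (R : realType) (E F : normedModType R) (f : E -> F)
    (x : E) : Prop :=
  \forall y \near x, forall vs : seq E,
    {for y, continuous (iterD vs f)} /\ forall v, derivable (iterD vs f) y v.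

(* The atlas is indexed by the points: chart a is a chart around a, defined on
   the open set chart_dom a, with inverse chart_inv a defined on the open set
   chart a @` chart_dom a.  Outside of these sets the values are junk. *)
Record manifold (R : realType) (n : nat) := Manifold {
  mpoint :> topologicalType;
  chart_dom : mpoint -> set mpoint;
  chart : mpoint -> mpoint -> 'rV[R]_n;
  chart_inv : mpoint -> 'rV[R]_n -> mpoint;
  mf_hausdorff : hausdorff_space mpoint;
  mf_second_countable : @second_countable mpoint;
  mf_dom_open : forall a, open (chart_dom a);
  mf_dom_center : forall a, chart_dom a a;
  mf_img_open : forall a, open (chart a @` chart_dom a);
  mf_chartK : forall a x, chart_dom a x -> chart_inv a (chart a x) = x;
  mf_chart_cts : forall a x, chart_dom a x -> {for x, continuous (chart a)};
  mf_inv_cts : forall a x, chart_dom a x ->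
    {for chart a x, continuous (chart_inv a)};
  mf_transition : forall a b x, chart_dom a x -> chart_dom b x ->
    smooth_near (fun t => chart b (chart_inv a t)) (chart a x)
}.

(* The tangent space of N at x is 'rV[R]_n, a vector being given by its
   components with respect to the chart centred at x.  Accordingly, a vector
   field on N is a function N -> 'rV[R]_n whose value at x is expressed in the
   chart centred at x. *)

Section Manifolds.
Variable R : realType.

Definition smooth_at (n : nat) (N : manifold R n) (q : nat)
    (f : N -> 'rV[R]_q) (x : N) : Prop :=
  smooth_near (fun t => f (chart_inv x t)) (chart x x).

(* smoothness on N1 x N2, with the product charts *)
Definition smooth_at2 (n1 n2 : nat) (N1 : manifold R n1) (N2 : manifold R n2)
    (q : nat) (f : N1 -> N2 -> 'rV[R]_q) (x : N1) (y : N2) : Prop :=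
  smooth_near (fun t : 'rV[R]_n1 * 'rV[R]_n2 =>
                 f (chart_inv x t.1) (chart_inv y t.2))
              (chart x x, chart y y).

Definition smooth_map (n1 n2 : nat) (N1 : manifold R n1) (N2 : manifold R n2)
    (F : N1 -> N2) (x : N1) : Prop :=
  {for x, continuous F} /\ smooth_at (fun y => chart (F x) (F y)) x.

Definition smooth_map2 (n1 n2 n3 : nat) (N1 : manifold R n1)
    (N2 : manifold R n2) (N3 : manifold R n3) (F : N1 -> N2 -> N3)
    (x : N1) (y : N2) : Prop :=
  {for (x, y), continuous (fun z : N1 * N2 => F z.1 z.2)} /\
  smooth_at2 (fun x' y' => chart (F x y) (F x' y')) x y.

Definition dirder (n : nat) (N : manifold R n) (q : nat) (f : N -> 'rV[R]_q)
    (x : N) (v : 'rV[R]_n) : 'rV[R]_q :=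
  'D_v (fun t => f (chart_inv x t)) (chart x x).

(* tangent map T_x N1 -> T_(F x) N2 *)
Definition tmap (n1 n2 : nat) (N1 : manifold R n1) (N2 : manifold R n2)
    (F : N1 -> N2) (x : N1) (v : 'rV[R]_n1) : 'rV[R]_n2 :=
  dirder (fun y => chart (F x) (F y)) x v.

(* smoothness near x of a vector field: its components in the fixed chart
   centred at x are smooth *)
Definition smooth_field (n : nat) (N : manifold R n) (V : N -> 'rV[R]_n)
    (x : N) : Prop :=
  smooth_at (fun y => dirder (chart x) y (V y)) x.

(* V (W f) - W (V f), applied to the coordinate functions at x *)
Definition field_bracket (n : nat) (N : manifold R n) (V W : N -> 'rV[R]_n)
    (x : N) : 'rV[R]_n :=
  dirder (fun y => dirder (chart x) y (W y)) x (V x) -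
  dirder (fun y => dirder (chart x) y (V y)) x (W x).

Definition smooth_form (n : nat) (N : manifold R n) (q : nat)
    (om : N -> 'Hom('rV[R]_n, 'rV[R]_q)) : Prop :=
  forall (x : N) (V : N -> 'rV[R]_n), smooth_field V x ->
    smooth_at (fun y => om y (V y)) x.

Definition ext_der (n : nat) (N : manifold R n) (q : nat)
    (om : N -> 'Hom('rV[R]_n, 'rV[R]_q)) (V W : N -> 'rV[R]_n) (x : N) :
    'rV[R]_q :=
  dirder (fun y => om y (W y)) x (V x) - dirder (fun y => om y (V y)) x (W x)
  - om x (field_bracket V W x).

End Manifolds.

Record lie_group (R : realType) (n : nat) := LieGroup {
  lg_manifold :> manifold R n;
  lg_mul : lg_manifold -> lg_manifold -> lg_manifold;
  lg_inv : lg_manifold -> lg_manifold;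
  lg_one : lg_manifold;
  lg_mulA : forall x y z, lg_mul x (lg_mul y z) = lg_mul (lg_mul x y) z;
  lg_mul1 : forall x, lg_mul lg_one x = x;
  lg_mulV : forall x, lg_mul (lg_inv x) x = lg_one;
  lg_mul_smooth : forall x y, smooth_map2 lg_mul x y;
  lg_inv_smooth : forall x, smooth_map lg_inv x
}.

Section LieAlgebra.
Variables (R : realType) (n : nat) (G : lie_group R n).
Local Notation g := 'rV[R]_n.

(* The Lie algebra of G is its tangent space g at the unit, with the bracket
   of left-invariant vector fields. *)
Definition left_field (A : g) (x : G) : g :=
  tmap (fun y => lg_mul x y) (lg_one G) A.

Definition lie (A B : g) : g :=
  field_bracket (left_field A) (left_field B) (lg_one G).

Definition Ad (x : G) (A : g) : g :=
  tmap (fun y => lg_mul (lg_mul x y) (lg_inv x)) (lg_one G) A.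

Definition killing (A B : g) : R := \tr (lin1_mx (fun X => lie A (lie B X))).

Definition lie_span (U W : {vspace g}) : {vspace g} :=
  <<[seq lie x y | x <- vbasis U, y <- vbasis W]>>%VS.

Definition ideal (I : {vspace g}) : Prop := (lie_span fullv I <= I)%VS.

Definition subalgebra (U : {vspace g}) : Prop := (lie_span U U <= U)%VS.

Definition solvable_ideal (I : {vspace g}) : Prop :=
  ideal I /\ exists k, iter k (fun U => lie_span U U) I = 0%VS.

Definition semisimple : Prop := forall I, solvable_ideal I -> I = 0%VS.

Definition simple_summand (I : {vspace g}) : Prop :=
  [/\ ideal I, lie_span I I <> 0%VS &
    forall J : {vspace g}, (J <= I)%VS -> (lie_span I J <= J)%VS ->
      J = 0%VS \/ J = I].

End LieAlgebra.

Section Grading.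
Variables (R : realType) (n : nat) (G : lie_group R n).
Local Notation g := 'rV[R]_n.
Variable gr : int -> {vspace g}.

(* g^i *)
Definition filt (i : int) : {vspace g} :=
  (\sum_(j < 5 | (i <= j%:Z - 2)%R) gr (j%:Z - 2))%VS.

Definition gneg : {vspace g} := (gr (- 2) + gr (- 1))%VS.

Record two_grading : Prop := TwoGrading {
  tg_range : forall i : int, 2 < `|i| -> gr i = 0%VS;
  tg_full : (\sum_(j < 5) gr (j%:Z - 2))%VS = fullv;
  tg_direct : directv (\sum_(j < 5) gr (j%:Z - 2))%VS;
  tg_lie : forall i j, (lie_span G (gr i) (gr j) <= gr (i + j))%VS;
  tg_no_simple : forall I, simple_summand G I -> ~~ (I <= gr 0)%VS;
  tg_gen_sub : subalgebra G (filt 1);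
  tg_gen : forall U, subalgebra G U -> (gr 1 <= U)%VS -> (filt 1 <= U)%VS
}.

Definition grpart (k : int) (x : g) : g :=
  \sum_(i < 5 | i%:Z - 2 == k)
    sumv_pi_for (erefl (\sum_(j < 5) gr (j%:Z - 2))%VS) i x.

Definition toneg (x : g) : subvs_of gneg :=
  vsproj gneg (grpart (- 2) x + grpart (- 1) x).

(* The closed subgroup of G preserving the filtration, as an embedded Lie
   subgroup with Lie algebra p = g^0 *)
Record filtration_subgroup (m : nat) := FiltrationSubgroup {
  fs_group :> lie_group R m;
  fs_incl : fs_group -> G;
  fs_mul : forall p q, fs_incl (lg_mul p q) = lg_mul (fs_incl p) (fs_incl q);
  fs_inj : injective fs_incl;
  fs_range : forall x : G,
    (exists p, fs_incl p = x) <->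
    (forall (i : int) (A : g), A \in filt i -> Ad x A \in filt i);
  fs_smooth : forall p, smooth_map fs_incl p;
  fs_immersion : injective (tmap fs_incl (lg_one fs_group));
  fs_topology : forall U : set fs_group, open U ->
    exists2 V : set G, open V & U = fs_incl @^-1` V;
  fs_lie : forall A : g,
    (exists B, tmap fs_incl (lg_one fs_group) B = A) <-> A \in filt 0
}.

(* The action on gr(g) induced by Ad p, where gr_i(g) = g^i / g^{i+1} is
   identified with g_i; and its restriction to g_- = gr(g/p). *)
Definition grAd (x : G) (A : g) : g :=
  \sum_(i < 5) grpart (i%:Z - 2) (Ad x (grpart (i%:Z - 2) A)).

Definition grAd_neg (x : G) (v : subvs_of gneg) : subvs_of gneg :=
  toneg (grAd x (vsval v)).

(* C_j = Hom(/\^j g_-, g) is the set of alternating multilinear maps. *)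

Local Notation gm := (subvs_of gneg).
Local Notation "[| x , y |]" := (lie G x y).

Definition cochain2 (psi : gm -> gm -> g) : Prop :=
  [/\ forall x, linear (psi x), forall y, linear (psi ^~ y) &
      forall x, psi x x = 0].

Definition cochain3 (chi : gm -> gm -> gm -> g) : Prop :=
  [/\ forall x y, linear (chi x y), forall x z, linear (fun y => chi x y z),
      forall y z, linear (fun x => chi x y z), forall x z, chi x x z = 0 &
      forall x y, chi x y y = 0].

(* Chevalley-Eilenberg differentials of g_- with values in g; toneg only
   transports the bracket of two elements of g_- back to the subspace type. *)
Definition diff1 (phi : gm -> g) (x y : gm) : g :=
  [| vsval x, phi y |] - [| vsval y, phi x |]
  - phi (toneg [| vsval x, vsval y |]).

Definition diff2 (psi : gm -> gm -> g) (x y z : gm) : g :=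
  [| vsval x, psi y z |] - [| vsval y, psi x z |] + [| vsval z, psi x y |]
  - psi (toneg [| vsval x, vsval y |]) z
  + psi (toneg [| vsval x, vsval z |]) y
  - psi (toneg [| vsval y, vsval z |]) x.

(* zl and zu are the bases (z_l) and (z^l). *)
Record dual_bases (r : nat) (zl : r.-tuple gm) (zu : r.-tuple g) : Prop :=
  DualBases {
  db_neg : basis_of fullv zl;
  db_pos : basis_of (filt 1) zu;
  db_dual : forall i j : 'I_r,
    killing G (vsval (tnth zl i)) (tnth zu j) = (i == j)%:R
}.

(* The codifferential on C_j is
     (d* psi)(x_2, .., x_j) = - \sum_l [z^l, psi(z_l, x_2, .., x_j)]
       + 1/2 \sum_l \sum_i psi(z_l, x_2, .., [z^l, x_i]_-, .., x_j),
   here for j = 2 (after moving z_l to the last argument) and j = 3. *)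
Section Codifferential.
Variables (r : nat) (zl : r.-tuple gm) (zu : r.-tuple g).
Local Notation z_ l := (tnth zl l).
Local Notation z' l := (tnth zu l).

Definition codiff2 (psi : gm -> gm -> g) (x : gm) : g :=
  \sum_(l < r) [| z' l, psi x (z_ l) |]
  - 2^-1 *: \sum_(l < r) psi (toneg [| z' l, vsval x |]) (z_ l).

Definition codiff3 (chi : gm -> gm -> gm -> g) (x y : gm) : g :=
  - (\sum_(l < r) [| z' l, chi (z_ l) x y |])
  + 2^-1 *: \sum_(l < r) (chi (z_ l) (toneg [| z' l, vsval x |]) y
                          + chi (z_ l) x (toneg [| z' l, vsval y |])).

Definition laplacian (psi : gm -> gm -> g) (x y : gm) : g :=
  diff1 (codiff2 psi) x y + codiff3 (diff2 psi) x y.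

Definition cocycle (psi : gm -> gm -> g) : Prop :=
  cochain2 psi /\ forall x, codiff2 psi x = 0.

(* H^2(g^1, g) = ker d*_2 / im d*_3, a class being a coset of im d*_3 *)
Definition coh_class (psi : gm -> gm -> g) : set (gm -> gm -> g) :=
  [set phi | exists2 chi, cochain3 chi &
     forall x y, phi x y = psi x y + codiff3 chi x y].

Definition H2 : set (set (gm -> gm -> g)) := coh_class @` cocycle.

End Codifferential.

(* the action on Hom(/\^2 gr(g/p), gr(g)) induced by Ad x *)
Definition act2 (x : G) (psi : gm -> gm -> g) : gm -> gm -> g :=
  fun v w => grAd x (psi (grAd_neg (lg_inv x) v) (grAd_neg (lg_inv x) w)).

Definition hcomp (k : int) (psi : gm -> gm -> g) : gm -> gm -> g :=
  fun x y => \sum_(i <- [:: - 2; - 1] : seq int)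
    \sum_(j <- [:: - 2; - 1] : seq int)
      grpart (i + j + k)
        (psi (toneg (grpart i (vsval x))) (toneg (grpart j (vsval y)))).

Definition lowest_homogeneity (T : Type) (K : T -> gm -> gm -> g) (l : int) :
    Prop :=
  (forall (k : int) u x y, k < l -> hcomp k (K u) x y = 0) /\
  exists u x y, hcomp l (K u) x y <> 0.

End Grading.

(* pb_triv: around every point of the base there is a P-equivariant
   diffeomorphism u |-> (pi u, tau u) of pi^{-1}(U) onto U x P, with
   inverse s. *)
Record principal_bundle (R : realType) (m d k : nat) (P : lie_group R m)
    (M : manifold R d) := PrincipalBundle {
  pb_total :> manifold R k;
  pb_proj : pb_total -> M;
  pb_act : pb_total -> P -> pb_total;
  pb_proj_smooth : forall u, smooth_map pb_proj u;
  pb_act_smooth : forall u p, smooth_map2 pb_act u p;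
  pb_act1 : forall u, pb_act u (lg_one P) = u;
  pb_actM : forall u p q, pb_act u (lg_mul p q) = pb_act (pb_act u p) q;
  pb_proj_act : forall u p, pb_proj (pb_act u p) = pb_proj u;
  pb_triv : forall x : M, exists (U : set M) (tau : pb_total -> P)
      (s : M -> P -> pb_total),
    [/\ open U /\ U x,
        forall u, U (pb_proj u) ->
          smooth_map tau u /\ s (pb_proj u) (tau u) = u,
        forall u p, U (pb_proj u) -> tau (pb_act u p) = lg_mul (tau u) p &
        forall y p, U y ->
          [/\ smooth_map2 s y p, pb_proj (s y p) = y & tau (s y p) = p]]
}.

Section Cartan.
Variables (R : realType) (n : nat) (G : lie_group R n).
Variables (gr : int -> {vspace 'rV[R]_n}) (m : nat).
Variables (P : filtration_subgroup G gr m) (d k : nat) (M : manifold R d).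
Variable Q : principal_bundle k P M.
Local Notation g := 'rV[R]_n.
Local Notation gm := (subvs_of (gneg gr)).

(* An element of p is tmap (fs_incl P) 1 A for a unique A in the tangent space
   of P at the unit; the fundamental field is then u |-> d/dt (u exp(tA)). *)
Record cartan_connection (om : Q -> 'Hom('rV[R]_k, g)) : Prop :=
  CartanConnection {
  cc_smooth : smooth_form om;
  cc_iso : forall u, bijective (om u);
  cc_equivariant : forall (u : Q) (p : P) (v : 'rV[R]_k),
    om (pb_act u p) (tmap (fun w => pb_act w p) u v) =
    Ad (fs_incl (lg_inv p)) (om u v);
  cc_fundamental : forall (u : Q) (A : 'rV[R]_m),
    om u (tmap (pb_act u) (lg_one P) A) = tmap (fs_incl (f := P)) (lg_one P) A
}.

Variable om : Q -> 'Hom('rV[R]_k, g).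

(* d om + 1/2 [om, om] *)
Definition curvature (V W : Q -> 'rV[R]_k) (u : Q) : g :=
  ext_der om V W u + lie G (om u (V u)) (om u (W u)).

(* Sections of /\^2 T^* (x) A are P-equivariant functions
   Q -> Hom(/\^2 (g/p), g), and g/p = g_-: the curvature as a function on Q. *)
Definition curvature_fun (u : Q) (x y : gm) : g :=
  curvature (fun v => (om v)^-1%VF (vsval x))
            (fun v => (om v)^-1%VF (vsval y)) u.

(* sections of the bundle Q x_P H^2(g^1, g), as equivariant functions on Q;
   a smooth function to the quotient is one with local smooth lifts *)
Definition H2_section (r : nat) (zl : r.-tuple gm) (zu : r.-tuple g)
    (sigma : Q -> set (gm -> gm -> g)) : Prop :=
  [/\ forall u, H2 G zl zu (sigma u),
      forall (u : Q) (p : P),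
        sigma (pb_act u p) = act2 (fs_incl (lg_inv p)) @` sigma u &
      forall u : Q, exists psi : Q -> gm -> gm -> g,
        (\forall v \near u, cocycle G zl zu (psi v) /\
                            sigma v = coh_class G zl zu (psi v)) /\
        forall x y, smooth_at (fun v => psi v x y) u].

End Cartan.

(* Main.v *)
Require Import Defs.
From HB Require Import structures.
From mathcomp Require Import all_boot all_order all_algebra.
From mathcomp Require Import all_classical all_reals all_analysis.
From mathcomp Require Import ring zify.
Set Implicit Arguments.
Unset Strict Implicit.
Unset Printing Implicit Defensive.
Import Order.TTheory GRing.Theory Num.Theory.
Import numFieldNormedType.Exports.
Local Open Scope classical_set_scope.
Local Open Scope ring_scope.

(** Why the theorem holds.

For [X] in [g] let [X~~] be the vector field on the total space on which the
connection form [om] takes the constant value [X], and put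
[K u X Y = [X, Y] - om u [X~~, Y~~]].  The restriction of [K] to [g_-] is the
curvature function, because the terms [X~~ (om Y~~)] of the exterior derivative
vanish.  Let [kappa_l] be the component of lowest homogeneity [l].

_The component is coclosed._  The Killing form pairs [g_i] with [g_(-i)] only,
so the dual bases may be treated as if they were homogeneous, and the
codifferential of a homogeneous component of the curvature is the component of the
same homogeneity of its codifferential ([codiff2_hcomp]), which is zero by normality.

_The component is closed._  The Jacobi identity for the fields [X~~], [Y~~],
[Z~~] minus the Jacobi identity in [g] is the Bianchi identity ([bianchi]): the
cyclic sum of
   [K([X, Y], Z) + [K(X, Y), Z] - K(K(X, Y), Z) - Z~~ K(X, Y)]
is zero.  For [X], [Y], [Z] homogeneous of degrees [i], [j], [k < 0], take the
part of degree [i + j + k + l].  The first two terms give, up to sign, the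
differential of [kappa_l].  The derivative term is the derivative of the
component of homogeneity [k + l < l] of [K(X, Y)], which is zero.  The quadratic
term has homogeneity at least [2 l], hence contributes nothing if [l > 0], and
if [l <= 0] the degree [i + j + k + l] is at most [-3], where [g] is zero
([kap_kap]).  This is [hcomp_closed].  It needs [K] to depend on [g / p] only:
[K(X, Y)] in the quadratic term need not lie in [g_-].

_K is horizontal and equivariant._  A right translation by [p] maps [X~~] to the
field of [Ad(p^-1) X], so it preserves brackets of such fields
([full_curv_equivariant]).  Differentiating this at [p = 1], where the derivative
of [Ad] is the bracket ([dirder_Ad]), gives [[X~~, Y~~] = [X, Y]~~] for [X] in
[p], that is [K(X, Y) = 0] ([full_curv_horizontal]).

_The component is a section._  An element of [P] preserves the filtration, and
the map that it induces on the associated graded space is an automorphism of the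
graded Lie algebra ([graded_map_br]); modulo terms of higher homogeneity,
equivariance of [K] becomes equivariance of [kappa_l] under this automorphism
([hcomp_equivariant]).  An automorphism preserves the Killing form, hence commutes
with the codifferential on three-cochains ([codiff3_act3]) and acts on the cosets
of its image.  Smoothness of the section is smoothness of [K], which comes from
smoothness of the inverse of [om] (Cramer).  Finally a closed and coclosed cochain
is killed by the Laplacian.

The calculus behind this is done with smoothness in the sense that all iterated
directional derivatives exist and are continuous.  On finite-dimensional spaces it
implies differentiability ([C1_differentiable]), the chain rule
([smooth_near_comp]) and the symmetry of second derivatives ([derive_comm]), from
which the Jacobi identity for vector fields and its naturality are computed in
charts ([field_jacobi], [tmap_bracket]). *)

(* [iterD] also names a lemma on iterated functions. *)
Local Notation iterD := Defs.iterD.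

(** * Functions with a proof of linearity *)
Section LinearFunctions.
Context {R : realType} {U V : lmodType R} {f : U -> V}.
Hypothesis fP : linear f.

(** Brackets and curvatures are linear in one argument under hypotheses, so that their partial
applications carry no canonical structure of a linear map. *)
Definition lin_of : {linear U -> V} := HB.pack f (GRing.isLinear.Build R U V *:%R f fP).

Lemma linP0 : f 0 = 0. Proof. exact: (linear0 lin_of). Qed.
Lemma linPD u v : f (u + v) = f u + f v. Proof. exact: (linearD lin_of). Qed.
Lemma linPN u : f (- u) = - f u. Proof. exact: (linearN lin_of). Qed.
Lemma linPB u v : f (u - v) = f u - f v. Proof. exact: (linearB lin_of). Qed.
Lemma linPZ a u : f (a *: u) = a *: f u. Proof. exact: (linearZ_LR lin_of). Qed.

Lemma linP_sum (I : Type) (r : seq I) (P : pred I) (F : I -> U) :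
  f (\sum_(i <- r | P i) F i) = \sum_(i <- r | P i) f (F i).
Proof. exact: (linear_sum lin_of). Qed.

End LinearFunctions.

(** * Continuous partial derivatives imply differentiability *)
Section FiniteCoordinates.
Context {R : realType}.

(** A basis with continuous coordinates.  It is a class on the normed space, so that
products of coordinate spaces are covered without choosing an isomorphism with a
space of row vectors. *)
Class fin_coord (E : normedModType R) : Prop := fin_coordP :
  exists (N : nat) (e : 'I_N -> E) (c : 'I_N -> {linear E -> R}),
    (forall i, continuous (c i)) /\ forall v, v = \sum_(i < N) c i v *: e i.

Lemma is_derive_line (E F : normedModType R) (f : E -> F) x v (t : R) :
  derivable f (x + t *: v) v ->
  is_derive t 1 (fun s => f (x + s *: v)) ('D_v f (x + t *: v)).
Proof.
have E1 : (fun h : R => h^-1 *: (f (x + (h *: (1:R) + t) *: v) - f (x + t *: v))) =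
   (fun h : R => h^-1 *: (f (h *: v + (x + t *: v)) - f (x + t *: v))).
  apply/funext => h; congr (_ *: (f _ - _)).
  by rewrite [h *: 1]mulr1 scalerDl addrCA.
move=> df; apply: DeriveDef.
  by move: df; rewrite /derivable /= E1.
by rewrite /derive /= E1.
Qed.

Lemma MVT_line (E : normedModType R) (f : E -> R) x v (a : R) :
  (forall t, `|t| <= `|a| -> derivable f (x + t *: v) v) ->
  exists2 t, `|t| <= `|a| & f (x + a *: v) - f x = a * 'D_v f (x + t *: v).
Proof.
move=> df; pose p (s : R) := f (x + s *: v).
have dp (t : R) : `|t| <= `|a| -> is_derive t 1 p ('D_v f (x + t *: v)).
  by move=> ta; apply: is_derive_line; exact: df.
have cp (b c : R) : (forall t, t \in `[b, c] -> `|t| <= `|a|) ->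
    {within `[b, c], continuous p}.
  move=> H; apply: derivable_within_continuous => t /H ta.
  by have [] := dp _ ta.
have p0 : f x = p 0 by rewrite /p scale0r addr0.
have [a0|a0] := leP 0 a.
  have H t : t \in `[0, a] -> `|t| <= `|a|.
    by rewrite in_itv /= => /andP[t0 ta]; rewrite !ger0_norm.
  have [|c cab] := @MVT_segment R p (fun t => 'D_v f (x + t *: v)) 0 a a0 _ (cp _ _ H).
    by move=> t /subset_itv_oo_cc /H /dp.
  by rewrite subr0 p0 mulrC => e; exists c => //; exact: H.
have H t : t \in `[a, 0] -> `|t| <= `|a|.
  by rewrite in_itv /= => /andP[ta t0]; rewrite !ler0_norm ?lerN2 // ltW.
have [|c cab] := @MVT_segment R p (fun t => 'D_v f (x + t *: v)) a 0 (ltW a0) _ (cp _ _ H).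
  by move=> t /subset_itv_oo_cc /H /dp.
rewrite sub0r p0 mulrN mulrC => e; exists c; first exact: H.
by rewrite -[LHS]opprB e opprK.
Qed.

(** Moving from [x] to [x + h] one coordinate at a time, each step changes [f] by a
partial derivative at an intermediate point (mean value theorem), which is close to
the partial derivative at [x]. *)
Lemma C1_differentiable (E : normedModType R) {fE : fin_coord E} (f : E -> R) x :
  (\forall y \near x, forall v, derivable f y v) ->
  (forall v, {for x, continuous ('D_v f)}) -> differentiable f x.
Proof.
move=> df cf; case: fE => N [e [c [cc dec]]].
pose L (h : E) : R := \sum_(i < N) c i h * 'D_(e i) f x.
have Llin : linear L.
  move=> a u v; rewrite /L scaler_sumr -big_split /=; apply: eq_bigr => i _.
  by rewrite linearP mulrDl -mulrA.
pose LL : {linear E -> R} := lin_of Llin.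
have Lc : continuous LL.
  move=> y; rewrite /LL /= /L; apply: cvg_big => [|i _]; first exact: add_continuous.
  by apply: cvgMr_tmp; exact: cc.
suff H : f \o shift x = cst (f x) + LL +o_ 0 id.
  have := diff_unique Lc H => dE; apply/diff_locallyP.
  by rewrite dE.
apply/eqaddoP => _/posnumP[eps].
have /choice[k kP] : forall i, exists k, 0 < k /\ forall v, `|c i v| <= k * `|v|.
  by move=> i; have [k k0 kP] := linear_lipschitz (cc i); exists k.
pose K := \sum_(i < N) k i.
have K0 : 0 <= K by apply: sumr_ge0 => i _; apply: ltW; case: (kP i).
pose M := \sum_(i < N) k i * `|e i|.
have M0 : 0 <= M by apply: sumr_ge0 => i _; apply: mulr_ge0 => //; apply: ltW; case: (kP i).
pose d := eps%:num / (K + 1).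
have d0 : 0 < d by rewrite divr_gt0 // ltr_wpDl.
have : \forall y \near x, (forall v, derivable f y v) /\
     forall i : 'I_N, `|'D_(e i) f y - 'D_(e i) f x| <= d.
  apply: filterI => //; apply: filter_forall => i.
  have /cvgrPdist_le/(_ d d0) := cf (e i).
  by apply: filterS => y; rewrite distrC.
move=> /nbhs_ballP[r r0 rP].
near=> h.
have hr : (M + 1) * `|h| < r.
  rewrite -ltr_pdivlMl ?ltr_wpDl //; near: h.
  apply: (cvgr0_norm_lt (id : E -> E)); first exact: cvg_id.
  by rewrite mulr_gt0 // invr_gt0 ltr_wpDl.
(* the corners of the broken line from [x] to [x + h] *)
pose s (j : nat) := \sum_(i < N | (i < j)%N) c i h *: e i.
have sN : s N = h.
  by rewrite [RHS](dec h) /s; apply: eq_bigl => i; rewrite ltn_ord.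
have s0 : s 0 = 0 by rewrite /s big_pred0.
have sS (i : 'I_N) : s i.+1 = s i + c i h *: e i.
  rewrite /s (bigD1 i) //= addrC; congr (_ + _); apply: eq_bigl => j.
  by rewrite ltnS ltn_neqAle andbC.
have sbnd (i : 'I_N) t : `|t| <= `|c i h| -> ball x r (x + s i + t *: e i).
  move=> tc; rewrite -ball_normE /= -addrA opprD addNKr normrN.
  apply: le_lt_trans hr; apply: (@le_trans _ _ (M * `|h|)); last first.
    by rewrite ler_wpM2r // lerDl.
  rewrite /M mulr_suml; apply: (@le_trans _ _ (\sum_(j < N | (j < i.+1)%N) k j * `|e j| * `|h|)).
    rewrite [leRHS](bigD1 i) //= addrC; apply: le_trans (ler_normD _ _) _.
    apply: lerD.
      rewrite normrZ mulrAC ler_wpM2r //; apply: le_trans tc _.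
      by case: (kP i).
    rewrite /s (eq_bigl (fun j : 'I_N => (j < i)%N)); last first.
      by move=> j; rewrite ltnS [in RHS]ltn_neqAle andbC.
    apply: le_trans (ler_norm_sum _ _ _) _; apply: ler_sum => j _.
    by rewrite normrZ mulrAC ler_wpM2r //; case: (kP j).
  rewrite big_mkcond /=; apply: ler_sum => j _; case: ifP => // _.
  by rewrite !mulr_ge0 //; apply: ltW; case: (kP j).
have step (i : 'I_N) : `|f (x + s i.+1) - f (x + s i) - c i h * 'D_(e i) f x| <= d * (k i * `|h|).
  rewrite sS addrA.
  have [|t tc ->] := @MVT_line _ f (x + s i) (e i) (c i h).
    by move=> t /sbnd /rP[].
  rewrite -mulrBr normrM mulrC; apply: ler_pM => //.
    by have [_] := rP _ (sbnd _ _ tc).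
  by case: (kP i).
have -> : (f \o shift x - (cst (f x) + LL)) h =
   \sum_(i < N) (f (x + s i.+1) - f (x + s i) - c i h * 'D_(e i) f x).
  rewrite big_split /= sumrN.
  rewrite (_ : \sum_(i < N) _ = \sum_(0 <= i < N) (f (x + s i.+1) - f (x + s i))); last first.
    by rewrite big_mkord.
  rewrite telescope_sumr // sN s0 addr0.
  by rewrite -[LHS]/(f (h + x) - (f x + L h)) opprD addrA [h + x]addrC.
apply: le_trans (ler_norm_sum _ _ _) _.
apply: (@le_trans _ _ (\sum_(i < N) d * (k i * `|h|))); first by apply: ler_sum => i _; exact: step.
rewrite -mulr_sumr -mulr_suml -/K mulrA ler_wpM2r // /d mulrAC ler_pdivrMr ?ltr_wpDl //.
by rewrite ler_wpM2l // lerDl.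
Unshelve. all: by end_near. Qed.

End FiniteCoordinates.

(** * Functions with all iterated directional derivatives *)
Section SmoothOn.
Context {R : realType}.
Implicit Types E F G : normedModType R.

(** [smooth_near f x] says that [f] is smooth on some open set containing [x]; the open
set is made explicit in order to compose and to induct on the order of derivatives. *)
Definition smooth_on E F (A : set E) (f : E -> F) : Prop :=
  forall y, A y -> forall vs : seq E,
    {for y, continuous (iterD vs f)} /\ forall v, derivable (iterD vs f) y v.

Lemma smooth_nearE E F (f : E -> F) x :
  smooth_near f x <-> exists A, [/\ open A, A x & smooth_on A f].
Proof.
rewrite /smooth_near; split.
  rewrite -nbhs_nearE nbhsE => -[A [oA Ax] AP].
  by exists A; split.
move=> [A [oA Ax AP]]; have := open_nbhs_nbhs (conj oA Ax).
by apply: filterS => y /AP.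
Qed.

Lemma open_near E (A : set E) (P : set E) y : open A -> A y ->
  (forall z, A z -> P z) -> \forall z \near y, P z.
Proof. by move=> oA Ay AP; apply: filterS AP _; exact: open_nbhs_nbhs. Qed.

Lemma eq_iterD E F (A : set E) (f g : E -> F) vs : open A ->
  (forall y, A y -> f y = g y) -> forall y, A y -> iterD vs f y = iterD vs g y.
Proof.
move=> oA fg; elim: vs => //= v vs IH y Ay.
by apply: near_eq_derive; exact: (open_near oA Ay).
Qed.

Lemma eq_continuous_at (T : topologicalType) (U : topologicalType) (f g : T -> U) x :
  (\near x, f x = g x) -> {for x, continuous f} -> {for x, continuous g}.
Proof.
move=> fg cf; rewrite /prop_for /continuous_at -(nbhs_singleton fg).
by apply: cvg_trans cf; apply: near_eq_cvg.
Qed.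

Lemma eq_smooth_on E F (A : set E) (f g : E -> F) : open A ->
  (forall y, A y -> f y = g y) -> smooth_on A f -> smooth_on A g.
Proof.
move=> oA fg sf y Ay vs; have [cf df] := sf y Ay vs.
have fgn : \near y, iterD vs f y = iterD vs g y.
  by apply: (open_near oA Ay) => z; exact: eq_iterD.
split; first exact: eq_continuous_at cf.
by move=> v; apply: near_eq_derivable (df v).
Qed.

Lemma is_derive_linear E F G (L : {linear F -> G}) (f : E -> F) x v :
  continuous L -> derivable f x v -> is_derive x v (L \o f) (L ('D_v f x)).
Proof.
move=> cL df.
have E1 : (fun h : R => h^-1 *: (L (f (h *: v + x)) - L (f x))) =
   (fun h : R => L (h^-1 *: (f (h *: v + x) - f x))).
  by apply/funext => h; rewrite -linearB -linearZ.
have H : (fun h : R => h^-1 *: (L (f (h *: v + x)) - L (f x))) @ 0^' --> L ('D_v f x).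
  by rewrite E1; apply: continuous_cvg; [exact: cL|exact: df].
apply: DeriveDef; first by apply/cvg_ex; exists (L ('D_v f x)).
apply: cvg_lim; first exact: norm_hausdorff.
exact: H.
Qed.

Lemma smooth_on_linear E F G (L : {linear F -> G}) (A : set E) (f : E -> F) :
  open A -> continuous L -> smooth_on A f -> smooth_on A (L \o f).
Proof.
move=> oA cL sf.
have H vs : forall y, A y -> iterD vs (L \o f) y = L (iterD vs f y).
  elim: vs => //= v vs IH y Ay.
  rewrite (@near_eq_derive _ _ _ _ (L \o iterD vs f)); last first.
    exact: (open_near oA Ay).
  have [_ df] := sf y Ay vs.
  by have := is_derive_linear cL (df v) => dL; rewrite derive_val.
move=> y Ay vs; have [cf df] := sf y Ay vs.
have Hn : \near y, (L \o iterD vs f) y = iterD vs (L \o f) y.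
  by apply: (open_near oA Ay) => z; move/H => ->.
split.
  apply: eq_continuous_at Hn _.
  by apply: continuous_comp; [exact: cf|exact: cL].
move=> v; apply: near_eq_derivable Hn _.
by have [] := is_derive_linear cL (df v).
Qed.

Lemma smooth_onD E F (A : set E) (f g : E -> F) :
  open A -> smooth_on A f -> smooth_on A g -> smooth_on A (fun x => f x + g x).
Proof.
move=> oA sf sg.
have H vs : forall y, A y -> iterD vs (fun x => f x + g x) y = iterD vs f y + iterD vs g y.
  elim: vs => //= v vs IH y Ay.
  rewrite (@near_eq_derive _ _ _ _ (iterD vs f + iterD vs g)); last first.
    exact: (open_near oA Ay).
  have [_ df] := sf y Ay vs; have [_ dg] := sg y Ay vs.
  by rewrite deriveD.
move=> y Ay vs; have [cf df] := sf y Ay vs; have [cg dg] := sg y Ay vs.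
have Hn : \near y, (iterD vs f + iterD vs g) y = iterD vs (fun x => f x + g x) y.
  by apply: (open_near oA Ay) => z; move/H => ->.
split; first by apply: eq_continuous_at Hn _; exact: continuousD.
by move=> v; apply: near_eq_derivable Hn _; exact: derivableD.
Qed.

Lemma iterD_cst E F (a : F) vs : iterD vs (fun=> a : F) = (fun=> if vs is [::] then a else 0) :> (E -> F).
Proof.
elim: vs => //= v vs ->; apply/funext => x.
exact: derive_cst.
Qed.

Lemma smooth_on_cst E F (A : set E) (a : F) : smooth_on A (fun=> a).
Proof.
move=> y _ vs; rewrite iterD_cst; split; first exact: cst_continuous.
by move=> v; exact: derivable_cst.
Qed.

Lemma smooth_on_sum E F (A : set E) (I : Type) (r : seq I) (P : pred I) (f : I -> E -> F) :
  open A -> (forall i, P i -> smooth_on A (f i)) -> smooth_on A (fun x => \sum_(i <- r | P i) f i x).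
Proof.
move=> oA sf; elim: r => [|i r IH].
  by apply: eq_smooth_on (smooth_on_cst 0) => // y _; rewrite big_nil.
case Pi : (P i).
  by apply: eq_smooth_on (smooth_onD oA (sf i Pi) IH) => // y _; rewrite big_cons Pi.
by apply: eq_smooth_on IH => // y _; rewrite big_cons Pi.
Qed.

Lemma smooth_onS E F (A B : set E) (f : E -> F) : A `<=` B -> smooth_on B f -> smooth_on A f.
Proof. by move=> AB sf y /AB/sf. Qed.

Lemma smooth_on_der E F (A : set E) (f : E -> F) v : smooth_on A f -> smooth_on A ('D_v f).
Proof.
move=> sf y Ay vs; have := sf y Ay (rcons vs v).
by rewrite /Defs.iterD foldr_rcons.
Qed.

End SmoothOn.

(** * Scalar functions of class C^k *)
Section Ck.
Context {R : realType} {E : normedModType R}.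

(** For smooth functions the chain rule leads to products and compositions that involve
derivatives of different orders; counting the order makes these closed under an
induction, which the definition with lists of directions does not permit. *)
Fixpoint Ck (k : nat) (A : set E) (f : E -> R) : Prop :=
  if k is k'.+1 then
    (forall x, A x -> differentiable f x) /\ forall v, Ck k' A ('D_v f)
  else forall x, A x -> {for x, continuous f}.

Lemma Ck_continuous k A f x : Ck k A f -> A x -> {for x, continuous f}.
Proof.
case: k => [|k] /=; first exact.
by move=> [df _] Ax; apply: differentiable_continuous; exact: df.
Qed.

Lemma CkS k A f : Ck k.+1 A f -> Ck k A f.
Proof.
elim: k f => [|k IH] f.
  by move=> /Ck_continuous cf x /cf.
by move=> [df Df]; split => // v; apply: IH.
Qed.

Lemma near_eq_differentiable (F G : normedModType R) (f g : F -> G) x :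
  (\near x, f x = g x) -> differentiable f x -> differentiable g x.
Proof.
move=> fg df; have fgx := nbhs_singleton fg.
have H : g \o shift x = cst (g x) + 'd f x +o_ 0 id.
  apply/eqaddoP => _/posnumP[e].
  have /eqaddoP/(_ e%:num) : f \o shift x = cst (f x) + 'd f x +o_ 0 id.
    exact: diff_locally.
  move=> /(_ (gt0 e)); apply: filterS2.
    2: by move: fg; rewrite (near_shift 0 x) subr0; apply.
  by move=> h; rewrite /= !fctE /= fgx => ->.
have := diff_unique (diff_continuous df) H => dE.
by apply/diff_locallyP; rewrite dE; split; [exact: diff_continuous|].
Qed.

Lemma eq_Ck k A f g : open A -> (forall x, A x -> f x = g x) -> Ck k A f -> Ck k A g.
Proof.
move=> oA; elim: k f g => [|k IH] f g fg /=.
  move=> cf x Ax; apply: eq_continuous_at (cf x Ax).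
  exact: (open_near oA Ax).
move=> [df Df]; split.
  move=> x Ax; apply: near_eq_differentiable (df x Ax).
  exact: (open_near oA Ax).
move=> v; apply: IH (Df v) => x Ax; apply: near_eq_derive.
exact: (open_near oA Ax).
Qed.

Lemma Ck_cst k A (a : R) : Ck k A (fun=> a).
Proof.
elim: k a => [|k IH] a /=; first by move=> x _; exact: cst_continuous.
split=> [x _|v]; first exact: differentiable_cst.
have -> : 'D_v (fun=> a) = (fun=> 0 : R) :> (E -> R) by apply/funext => x; exact: derive_cst.
exact: IH.
Qed.

Lemma CkD k A f g : open A -> Ck k A f -> Ck k A g -> Ck k A (fun x => f x + g x).
Proof.
move=> oA; elim: k f g => [|k IH] f g /=.
  by move=> cf cg x Ax; apply: continuousD; [exact: cf|exact: cg].
move=> [df Df] [dg Dg]; split => [x Ax|v].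
  by apply: differentiableD; [exact: df|exact: dg].
apply: eq_Ck (IH _ _ (Df v) (Dg v)) => // x Ax /=.
by rewrite [RHS]deriveD //; apply: diff_derivable; [exact: df|exact: dg].
Qed.

Lemma CkM k A f g : open A -> Ck k A f -> Ck k A g -> Ck k A (fun x => f x * g x).
Proof.
move=> oA; elim: k f g => [|k IH] f g.
  by move=> cf cg x Ax; apply: continuousM; [exact: cf|exact: cg].
move=> Cf Cg; have [[df Df] [dg Dg]] := (Cf, Cg); split => [x Ax|v].
  by apply: differentiableM; [exact: df|exact: dg].
have := CkD oA (IH _ _ (CkS Cf) (Dg v)) (IH _ _ (CkS Cg) (Df v)).
apply: eq_Ck => // x Ax /=.
by rewrite [RHS]deriveM //; apply: diff_derivable; [exact: df|exact: dg].
Qed.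

Lemma Ck_sum k A (I : Type) (r : seq I) (f : I -> E -> R) : open A ->
  (forall i, Ck k A (f i)) -> Ck k A (fun x => \sum_(i <- r) f i x).
Proof.
move=> oA Cf; elim: r => [|i r IH].
  by apply: eq_Ck (Ck_cst _ _ 0) => // x _; rewrite big_nil.
by apply: eq_Ck (CkD oA (Cf i) IH) => // x _; rewrite big_cons.
Qed.

Lemma CkV k A f : open A -> (forall x, A x -> f x != 0) -> Ck k A f ->
  Ck k A (fun x => (f x)^-1).
Proof.
move=> oA f0; elim: k => [|k IH] Cf.
  by move=> x Ax; apply: continuousV; [exact: f0|exact: Cf].
have [df Df] := Cf; split => [x Ax|v].
  by apply: differentiableV; [exact: df|exact: f0].
have CV := IH (CkS Cf).
have := CkM oA (Ck_cst k A (- 1)) (CkM oA (CkM oA CV CV) (Df v)).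
apply: eq_Ck => // x Ax /=.
rewrite [RHS]deriveV ?f0 //; last by apply: diff_derivable; exact: df.
rewrite mulN1r scaleNr -expr2 exprVn; congr (- _).
Qed.

Lemma Ck_subset k (A B : set E) f : A `<=` B -> Ck k B f -> Ck k A f.
Proof.
move=> AB; elim: k f => [|k IH] f /=; first by move=> cf x /AB/cf.
by move=> [df Df]; split => [x /AB/df//|v]; exact: IH.
Qed.

End Ck.

Lemma differentiable_coords (R : realType) (E F : normedModType R) N (e : 'I_N -> F)
   (c : 'I_N -> {linear F -> R}) (f : E -> F) x :
  (forall v, v = \sum_(i < N) c i v *: e i) ->
  (forall i, differentiable (c i \o f) x) -> differentiable f x.
Proof.
move=> dec df.
have -> : f = \sum_(i < N) (fun y => c i (f y) *: e i).
  by apply/funext => y; rewrite fct_sumE [LHS]dec.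
by apply: differentiable_sum => i; apply: differentiableZl; exact: df.
Qed.

(** The chain rule writes a derivative of [g \o f] as a sum of products of derivatives of
the coordinates of [f] with compositions of [f] with the derivatives of [g], which are
of class [k] by induction. *)
Lemma Ck_comp (R : realType) (E F : normedModType R) N (e : 'I_N -> F)
   (c : 'I_N -> {linear F -> R}) (A : set E) (B : set F) k (f : E -> F) (g : F -> R) :
  (forall v, v = \sum_(i < N) c i v *: e i) -> (forall i, continuous (c i)) ->
  open A -> open B -> (forall x, A x -> B (f x)) ->
  (forall i, Ck k A (c i \o f)) -> Ck k B g -> Ck k A (g \o f).
Proof.
move=> dec cc oA oB AB; elim: k g => [|k IH] g.
  move=> Cf Cg x Ax; apply: continuous_comp; last by apply: Cg; exact: AB.
  have -> : f = (fun y => \sum_(i < N) c i (f y) *: e i).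
    by apply/funext => y; rewrite [LHS]dec.
  apply: cvg_big => [|i _]; first exact: add_continuous.
  by apply: cvgZr_tmp; exact: Cf.
move=> Cf [dg Dg].
have df x : A x -> differentiable f x.
  by move=> Ax; apply: (differentiable_coords dec) => i; have [d _] := Cf i; exact: d.
split => [x Ax|v].
  by apply: differentiable_comp; [exact: df|apply: dg; exact: AB].
have := @Ck_sum R E k A 'I_N (index_enum _) (fun i x => 'D_v (c i \o f) x * ('D_(e i) g) (f x)) oA.
have Cfk i : Ck k A (c i \o f) by apply: CkS.
move=> H; have {}H := H (fun i => CkM oA (proj2 (Cf i) v) (IH _ Cfk (Dg (e i)))).
apply: eq_Ck H => // x Ax /=.
have fx := df x Ax; have gx := dg _ (AB x Ax).
rewrite [RHS]deriveE; last exact: differentiable_comp.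
rewrite diff_comp //= [X in 'd g _ X]dec linear_sum; apply: eq_bigr => i _.
rewrite linearZ /= -deriveE //; congr (_ * _); last exact: deriveE.
by have := is_derive_linear (cc i) (diff_derivable fx (v := v)) => D; rewrite derive_val deriveE.
Qed.

(** * Coordinates on row vectors and on products *)
Section FinCoordInstances.
Context {R : realType}.

Lemma entry_linear n (i : 'I_n) : linear (fun v : 'rV[R]_n => v 0 i : R).
Proof. by move=> a u v; rewrite !mxE. Qed.

Definition entry n i : {linear 'rV[R]_n -> R} := lin_of (@entry_linear n i).

Lemma entry_continuous n i : continuous (entry i : 'rV[R]_n -> R).
Proof. exact: coord_continuous. Qed.

#[global] Instance fin_coord_rV n : fin_coord ('rV[R]_n : normedModType R).
Proof.
exists n, (delta_mx 0), (@entry n); split => [i|v]; first exact: entry_continuous.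
exact: row_sum_delta.
Qed.

#[global] Instance fin_coord_prod (E F : normedModType R) {fE : fin_coord E} {fF : fin_coord F} :
  fin_coord ((E * F)%type : normedModType R).
Proof.
case: fE => N [e [c [cc dec]]]; case: fF => M [d [b [cb deb]]].
have lin1 i : linear (fun v : E * F => c i v.1) by move=> a u v; rewrite linearP.
have lin2 i : linear (fun v : E * F => b i v.2) by move=> a u v; rewrite linearP.
pose c1 i : {linear (E * F)%type -> R} := lin_of (lin1 i).
pose c2 i : {linear (E * F)%type -> R} := lin_of (lin2 i).
exists (N + M)%N, (fun i => match fintype.split i with inl i => (e i, 0) | inr j => (0, d j) end),
  (fun i => match fintype.split i with inl i => c1 i | inr j => c2 j end); split.
  move=> i; case: (fintype.split i) => [j|j] x; rewrite /c1 /c2 /=.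
    by apply: continuous_comp; [exact: cvg_fst|exact: cc].
  by apply: continuous_comp; [exact: cvg_snd|exact: cb].
move=> [u v]; rewrite big_split_ord /=.
under eq_bigr => i _ do rewrite (unsplitK (inl i)).
under [X in _ = _ + X]eq_bigr => i _ do rewrite (unsplitK (inr i)).
rewrite /c1 /c2 /= {1}(dec u) {1}(deb v).
rewrite -[LHS]/(\sum_(i < N) c i u *: e i, \sum_(i < M) b i v *: d i).
have E1 (r : seq 'I_N) : \sum_(i <- r) c i u *: (e i, 0 : F) = (\sum_(i <- r) c i u *: e i, 0).
  elim: r => [|i r IH]; first by rewrite !big_nil.
  by rewrite !big_cons IH; congr (_, _); rewrite /= scaler0 addr0.
have E2 (r : seq 'I_M) : \sum_(i <- r) b i v *: (0 : E, d i) = (0, \sum_(i <- r) b i v *: d i).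
  elim: r => [|i r IH]; first by rewrite !big_nil.
  by rewrite !big_cons IH; congr (_, _); rewrite /= scaler0 addr0.
by rewrite E1 E2; congr (_, _); rewrite /= ?addr0 ?add0r.
Qed.

End FinCoordInstances.

(** * Closure properties of smooth functions *)
Section SmoothCalculus.
Context {R : realType}.
Implicit Types E F G : normedModType R.

Lemma smooth_on_Ck E {fE : fin_coord E} (A : set E) (f : E -> R) : open A ->
  smooth_on A f <-> forall k, Ck k A f.
Proof.
move=> oA; split => [sf k|Cf].
  elim: k f sf => [|k IH] f sf /=.
    by move=> x Ax; have [] := sf x Ax [::].
  split => [x Ax|v]; last by apply: IH; exact: smooth_on_der.
  apply: C1_differentiable.
    by apply: (open_near oA Ax) => y Ay; have [] := sf y Ay [::].
  by move=> v; have [] := sf x Ax [:: v].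
move=> y Ay vs; elim/last_ind: vs f Cf => [|vs v IH] f Cf.
  split; first exact: (Cf 0%N y Ay).
  by move=> v; apply: diff_derivable; have [df _] := Cf 1%N; exact: df.
rewrite /Defs.iterD foldr_rcons; apply: IH => k.
by have [_] := Cf k.+1; exact.
Qed.

(** Given a name so that it can carry the structure of a linear map. *)
Definition scale_linear E (e : E) : R -> E := fun a => a *: e.
Lemma scale_linear_is_linear E (e : E) : linear (scale_linear e).
Proof. by move=> a u v; rewrite /scale_linear scalerDl scalerA. Qed.
HB.instance Definition _ E (e : E) :=
  GRing.isLinear.Build R R E *:%R (scale_linear e) (scale_linear_is_linear e).

Lemma smooth_on_coords E F N (e : 'I_N -> F) (c : 'I_N -> {linear F -> R}) (A : set E) (f : E -> F) :
  (forall i, continuous (c i)) -> (forall v, v = \sum_(i < N) c i v *: e i) -> open A ->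
  smooth_on A f <-> forall i, smooth_on A (c i \o f).
Proof.
move=> cc dec oA; split => [sf i|sf]; first exact: smooth_on_linear.
have := @smooth_on_sum _ _ _ A 'I_N (index_enum _) xpredT (fun i => scale_linear (e i) \o (c i \o f)) oA.
move=> H; refine (eq_smooth_on oA _ (H _)).
  by move=> y _; rewrite [RHS]dec; apply: eq_bigr.
move=> i _; apply: smooth_on_linear => // x.
exact: cvgZr_tmp.
Qed.

Lemma smooth_on_differentiable E {fE : fin_coord E} F {fF : fin_coord F} (A : set E) (f : E -> F) x :
  open A -> A x -> smooth_on A f -> differentiable f x.
Proof.
move=> oA Ax; case: fF => N [e [c [cc dec]]] /(smooth_on_coords f cc dec oA) sf.
apply: (differentiable_coords dec) => i.
have /(smooth_on_Ck _ oA)/(_ 1%N)[df _] := sf i.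
exact: df.
Qed.

Lemma smooth_on_comp E {fE : fin_coord E} F {fF : fin_coord F} G {fG : fin_coord G}
    (A : set E) (B : set F) (f : E -> F) (g : F -> G) :
  open A -> open B -> (forall x, A x -> B (f x)) -> smooth_on A f -> smooth_on B g ->
  smooth_on A (g \o f).
Proof.
move=> oA oB AB sf sg.
case: fG => N [e [c [cc dec]]].
apply/(smooth_on_coords _ cc dec oA) => i; apply/(smooth_on_Ck _ oA) => k.
have /(smooth_on_Ck _ oB)/(_ k) := proj1 (smooth_on_coords _ cc dec oB) sg i.
case: (fF) => M [d [b [cb deb]]].
move=> Cg; apply: (Ck_comp deb cb oA oB AB) Cg => j.
exact: (proj1 (smooth_on_Ck _ oA) (proj1 (smooth_on_coords _ cb deb oA) sf j)).
Qed.

Lemma near_smooth_near E F (f : E -> F) x : smooth_near f x -> \forall y \near x, smooth_near f y.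
Proof.
move=> /smooth_nearE[A [oA Ax sf]].
by apply: (open_near oA Ax) => y Ay; apply/smooth_nearE; exists A.
Qed.

Lemma eq_smooth_near E F (f g : E -> F) x :
  (\forall y \near x, f y = g y) -> smooth_near f x -> smooth_near g x.
Proof.
rewrite -nbhs_nearE nbhsE => -[B [oB Bx] fg] /smooth_nearE[A [oA Ax sf]].
apply/smooth_nearE; exists (A `&` B); split => //; first exact: openI.
apply: (@eq_smooth_on _ _ _ _ f); first exact: openI.
  by move=> y [_ /fg].
by apply: smooth_onS sf => y [].
Qed.

Lemma smooth_near_common E F G (f : E -> F) (g : E -> G) x : smooth_near f x -> smooth_near g x ->
  exists A, [/\ open A, A x, smooth_on A f & smooth_on A g].
Proof.
move=> /smooth_nearE[A [oA Ax sf]] /smooth_nearE[B [oB Bx sg]].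
exists (A `&` B); split => //; first exact: openI.
  by apply: smooth_onS sf => y [].
by apply: smooth_onS sg => y [].
Qed.

Lemma smooth_near_linear E F G (L : {linear F -> G}) (f : E -> F) x :
  continuous L -> smooth_near f x -> smooth_near (fun y => L (f y)) x.
Proof.
move=> cL /smooth_nearE[A [oA Ax sf]]; apply/smooth_nearE; exists A; split => //.
exact: smooth_on_linear.
Qed.

Lemma smooth_near_cst E F (a : F) (x : E) : smooth_near (fun=> a) x.
Proof.
by apply/smooth_nearE; exists setT; split => //; [exact: openT|exact: smooth_on_cst].
Qed.

Lemma smooth_nearD E F (f g : E -> F) x :
  smooth_near f x -> smooth_near g x -> smooth_near (fun y => f y + g y) x.
Proof.
move=> sf sg; have [A [oA Ax {}sf {}sg]] := smooth_near_common sf sg.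
by apply/smooth_nearE; exists A; split => //; exact: smooth_onD.
Qed.

Lemma smooth_near_sum E F (I : Type) (r : seq I) (P : pred I) (f : I -> E -> F) x :
  (forall i, P i -> smooth_near (f i) x) -> smooth_near (fun y => \sum_(i <- r | P i) f i y) x.
Proof.
move=> sf; elim: r => [|i r IH].
  apply: eq_smooth_near (smooth_near_cst 0 x).
  by near=> y; rewrite big_nil.
case Pi : (P i).
  apply: eq_smooth_near (smooth_nearD (sf i Pi) IH).
  by near=> y; rewrite big_cons Pi.
by apply: eq_smooth_near IH; near=> y; rewrite big_cons Pi.
Unshelve. all: by end_near. Qed.

Lemma smooth_near_der E F (f : E -> F) x v : smooth_near f x -> smooth_near ('D_v f) x.
Proof.
move=> /smooth_nearE[A [oA Ax sf]]; apply/smooth_nearE; exists A; split => //.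
exact: smooth_on_der.
Qed.

Lemma smooth_near_differentiable E {fE : fin_coord E} F {fF : fin_coord F} (f : E -> F) x :
  smooth_near f x -> differentiable f x.
Proof. by move=> /smooth_nearE[A [oA Ax sf]]; exact: smooth_on_differentiable sf. Qed.

Lemma smooth_near_continuous E F (f : E -> F) x : smooth_near f x -> {for x, continuous f}.
Proof. by move=> /smooth_nearE[A [oA Ax sf]]; have [] := sf x Ax [::]. Qed.

Lemma smooth_near_derivable E F (f : E -> F) x v : smooth_near f x -> derivable f x v.
Proof. by move=> /smooth_nearE[A [oA Ax sf]]; have [] := sf x Ax [::]. Qed.

Lemma smooth_near_comp E {fE : fin_coord E} F {fF : fin_coord F} G {fG : fin_coord G}
    (f : E -> F) (g : F -> G) x :
  smooth_near f x -> smooth_near g (f x) -> smooth_near (fun y => g (f y)) x.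
Proof.
move=> /smooth_nearE[A [oA Ax sf]] /smooth_nearE[B [oB Bfx sg]].
have oAB : open (A `&` f @^-1` B).
  rewrite openE => y [Ay Bfy]; rewrite /interior; apply: filterI; first exact: open_nbhs_nbhs.
  have [cf _] := sf y Ay [::]; apply: cf; exact: open_nbhs_nbhs.
apply/smooth_nearE; exists (A `&` f @^-1` B); split => //.
apply: (smooth_on_comp oAB oB) sg; first by move=> y [].
by apply: smooth_onS sf => y [].
Qed.

Lemma smooth_near_id E (x : E) : smooth_near id x.
Proof.
apply/smooth_nearE; exists setT; split => //; first exact: openT.
move=> y _ vs.
have H : forall vs, exists a, (iterD vs id =1 (fun=> a) :> (E -> E)) \/ iterD vs id =1 (id : E -> E).
  elim => [|v ws [a H]]; first by exists 0; right.
  have [/funext e1|/funext e1] := H.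
    by exists 0; left => z /=; rewrite e1 derive_cst.
  by exists v; left => z /=; rewrite e1 derive_id.
have [a [/funext ->|/funext ->]] := H vs.
  by split; [exact: cst_continuous|move=> v; exact: derivable_cst].
by split; [exact: cvg_id|move=> v; exact: derivable_id].
Qed.

End SmoothCalculus.

(** * Symmetry of second derivatives and variable directions *)
Section DirectionalDerivatives.
Context {R : realType}.
Implicit Types E F G : normedModType R.

Lemma derive_dirP E F (f : E -> F) x (a : R) u v : differentiable f x ->
  'D_(a *: u + v) f x = a *: 'D_u f x + 'D_v f x.
Proof. by move=> df; rewrite !deriveE // linearP. Qed.

Lemma derive_dirD E F (f : E -> F) x u v : differentiable f x ->
  'D_(u + v) f x = 'D_u f x + 'D_v f x.
Proof. by move=> df; rewrite !deriveE // linearD. Qed.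

Lemma derive_dirB E F (f : E -> F) x u v : differentiable f x ->
  'D_(u - v) f x = 'D_u f x - 'D_v f x.
Proof. by move=> df; rewrite !deriveE // linearB. Qed.

Lemma derive_comp E F G (f : E -> F) (g : F -> G) x v :
  differentiable f x -> differentiable g (f x) ->
  'D_v (fun y => g (f y)) x = 'D_('D_v f x) g (f x).
Proof.
move=> df dg; rewrite (deriveE _ df) (deriveE _ dg) deriveE; last exact: differentiable_comp.
by rewrite (diff_comp df dg).
Qed.

Lemma derive_linear E F G (L : {linear F -> G}) (f : E -> F) x v :
  continuous L -> derivable f x v -> 'D_v (fun y => L (f y)) x = L ('D_v f x).
Proof. by move=> cL df; have := is_derive_linear cL df => H; rewrite derive_val. Qed.

Lemma is_derive_shiftr E F (f : E -> F) x c v : derivable f (x + c) v ->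
  is_derive x v (fun y => f (y + c)) ('D_v f (x + c)).
Proof.
have E1 : (fun h : R => h^-1 *: (f (h *: v + x + c) - f (x + c))) =
   (fun h : R => h^-1 *: (f (h *: v + (x + c)) - f (x + c))).
  by apply/funext => h; rewrite addrA.
move=> df; apply: DeriveDef; first by move: df; rewrite /derivable /= E1.
by rewrite /derive /= E1.
Qed.

(** The mean value theorem along [v] for [y |-> f (y + s *: w) - f y], then along [w] for
the derivative of [f] in the direction [v]. *)
Lemma second_difference E (A : set E) (f : E -> R) x v w (s : R) :
  smooth_on A f ->
  (forall t t', `|t| <= `|s| -> `|t'| <= `|s| -> A (x + t *: v + t' *: w)) ->
  exists t t', [/\ `|t| <= `|s|, `|t'| <= `|s| &
    f (x + s *: v + s *: w) - f (x + s *: v) - (f (x + s *: w) - f x) =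
    s * (s * 'D_w ('D_v f) (x + t *: v + t' *: w))].
Proof.
move=> sf HA; pose p y := f (y + s *: w) - f y.
have HA0 t : `|t| <= `|s| -> A (x + t *: v).
  by move=> ts; have := HA t 0 ts; rewrite scale0r addr0; apply; rewrite normr0.
have HAs t : `|t| <= `|s| -> A (x + t *: v + s *: w) by move=> ts; exact: HA.
have dp t : `|t| <= `|s| ->
    is_derive (x + t *: v) v p ('D_v f (x + t *: v + s *: w) - 'D_v f (x + t *: v)).
  move=> ts; apply: is_deriveB.
    by apply: is_derive_shiftr; have [_] := sf _ (HAs t ts) [::]; apply.
  by apply: derivableP; have [_] := sf _ (HA0 t ts) [::]; apply.
have [|t ts] := @MVT_line _ _ p x v s.
  by move=> t /dp[].
have := dp t ts => dpt; rewrite derive_val.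
rewrite {1 2}/p => ->.
have [|t' ts' ->] := @MVT_line _ _ ('D_v f) (x + t *: v) w s.
  by move=> t' ts'; have [_] := sf _ (HA t t' ts ts') [:: v]; apply.
by exists t, t'; split.
Qed.

(** Schwarz: the second difference is symmetric in [v] and [w], so both mixed derivatives
take equal values at two points arbitrarily close to [x]. *)
Lemma derive_comm_scalar E (f : E -> R) x v w : smooth_near f x ->
  'D_v ('D_w f) x = 'D_w ('D_v f) x.
Proof.
move=> /smooth_nearE[A [oA Ax sf]].
have [c1 _] := sf x Ax [:: v; w]; have [c2 _] := sf x Ax [:: w; v].
apply/eqP; rewrite -subr_eq0 -normr_eq0; apply/eqP/le_anti/andP; split => //.
apply/ler_addgt0Pr => e e0; rewrite add0r.
have e2 : 0 < e / 2 by rewrite divr_gt0.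
have near_all : \forall y \near x, [/\ A y,
    `|'D_v ('D_w f) x - 'D_v ('D_w f) y| <= e / 2 & `|'D_w ('D_v f) x - 'D_w ('D_v f) y| <= e / 2].
  have H0 : nbhs x A by exact: open_nbhs_nbhs.
  have cc1 : {for x, continuous ('D_v ('D_w f))} := c1.
  have cc2 : {for x, continuous ('D_w ('D_v f))} := c2.
  have H1 : nbhs x (fun y => `|'D_v ('D_w f) x - 'D_v ('D_w f) y| <= e / 2).
    by move/cvgrPdist_le: cc1 => /(_ _ e2).
  have H2 : nbhs x (fun y => `|'D_w ('D_v f) x - 'D_w ('D_v f) y| <= e / 2).
    by move/cvgrPdist_le: cc2 => /(_ _ e2).
  by apply: filterS3 H0 H1 H2 => y.
have [r /= r0 rP] := (nbhs_ballP _ _).1 near_all.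
(* small enough for the parallelogram spanned by [s *: v] and [s *: w] to stay in the
   ball of radius [r] *)
pose s := r / (`|v| + `|w| + 1).
have d0 : 0 < `|v| + `|w| + 1 by rewrite ltr_wpDl // addr_ge0.
have s0 : 0 < s by rewrite divr_gt0.
have inb t t' : `|t| <= `|s| -> `|t'| <= `|s| -> ball x r (x + t *: v + t' *: w).
  move=> ts ts'; rewrite -ball_normE /= -addrA opprD addNKr normrN.
  apply: le_lt_trans (ler_normD _ _) _; rewrite !normrZ.
  apply: (@le_lt_trans _ _ (s * (`|v| + `|w|))).
    by rewrite mulrDr lerD // ler_wpM2r // -[leRHS]gtr0_norm.
  by rewrite /s mulrAC ltr_pdivrMr // ltr_pM2l // ltrDl.
have [|t [t' [ts ts' E1]]] := @second_difference E A f x v w s sf.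
  by move=> t t' ts ts'; have [] := rP _ (inb t t' ts ts').
have [|u [u' [us us' E2]]] := @second_difference E A f x w v s sf.
  by move=> u u' us us'; rewrite addrAC; have [] := rP _ (inb u' u us' us).
have EE : 'D_w ('D_v f) (x + t *: v + t' *: w) = 'D_v ('D_w f) (x + u *: w + u' *: v).
  apply: (mulfI (lt0r_neq0 s0)).
  apply: (mulfI (lt0r_neq0 s0)); refine (etrans (esym E1) _); refine (etrans _ E2); clear E1 E2.
  rewrite [x + s *: w + s *: v]addrAC.
  move: (f (x + s *: v + s *: w)) (f (x + s *: v)) (f (x + s *: w)) (f x).
  by move=> a b c d; ring.
have [_ _ H1] := rP _ (inb t t' ts ts').
have [_ H2 _] := rP _ (inb u' u us' us); rewrite addrAC in H2.
move: H1 H2; rewrite -EE.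
move: ('D_w ('D_v f) (x + t *: v + t' *: w)) ('D_v ('D_w f) x) ('D_w ('D_v f) x).
move=> q a b H1 H2; rewrite (_ : a - b = (a - q) - (b - q)); last by ring.
by apply: le_trans (ler_normB _ _) _; rewrite (splitr e) lerD.
Qed.

Lemma eq_coords F N (e : 'I_N -> F) (c : 'I_N -> {linear F -> R}) (u v : F) :
  (forall v, v = \sum_(i < N) c i v *: e i) -> (forall i, c i u = c i v) -> u = v.
Proof. by move=> dec uv; rewrite (dec u) (dec v); apply: eq_bigr => i _; rewrite uv. Qed.

Lemma derive_comm E F {fF : fin_coord F} (f : E -> F) x v w : smooth_near f x ->
  'D_v ('D_w f) x = 'D_w ('D_v f) x.
Proof.
move=> sf; case: fF => N [e [c [cc dec]]].
apply: (eq_coords dec) => i.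
have H u z : smooth_near f z -> c i ('D_u f z) = 'D_u (fun y => c i (f y)) z.
  by move=> sz; rewrite derive_linear //; exact: smooth_near_derivable.
have H2 u u' : c i ('D_u ('D_u' f) x) = 'D_u ('D_u' (fun y => c i (f y))) x.
  rewrite -derive_linear //; last by apply: smooth_near_derivable; exact: smooth_near_der.
  apply: near_eq_derive; have := near_smooth_near sf; apply: filterS => y; exact: H.
rewrite !H2; apply: derive_comm_scalar.
exact: smooth_near_linear.
Qed.

Lemma smooth_near_coords E F N (e : 'I_N -> F) (c : 'I_N -> {linear F -> R}) (f : E -> F) x :
  (forall v, v = \sum_(i < N) c i v *: e i) ->
  (forall i, smooth_near (fun y => c i (f y)) x) -> smooth_near f x.
Proof.
move=> dec sf.
have := @smooth_near_sum R E F 'I_N (index_enum _) xpredT (fun i y => scale_linear (e i) (c i (f y))) x.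
move=> H; refine (eq_smooth_near _ (H _)).
  by near=> y; rewrite [RHS]dec.
by move=> i _; apply: smooth_near_linear => // z; exact: cvgZr_tmp.
Unshelve. all: by end_near. Qed.

Lemma smooth_nearM E {fE : fin_coord E} (f g : E -> R) x :
  smooth_near f x -> smooth_near g x -> smooth_near (fun y => f y * g y) x.
Proof.
move=> sf sg; have [A [oA Ax {}sf {}sg]] := smooth_near_common sf sg.
apply/smooth_nearE; exists A; split; [exact: oA|exact: Ax|]; apply/(smooth_on_Ck _ oA) => k.
by apply: CkM => //; exact: (proj1 (smooth_on_Ck _ oA)).
Qed.

Lemma smooth_nearV E {fE : fin_coord E} (f : E -> R) x :
  f x != 0 -> smooth_near f x -> smooth_near (fun y => (f y)^-1) x.
Proof.
move=> fx0 /smooth_nearE[A [oA Ax sf]].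
have oAB : open (A `&` [set y | f y != 0]).
  rewrite openE => y [Ay fy0]; rewrite /interior; apply: filterI; first exact: open_nbhs_nbhs.
  have [cf _] := sf y Ay [::].
  exact: (cvgr_neq0 _ cf).
apply/smooth_nearE; exists (A `&` [set y | f y != 0]); split; [exact: oAB|by split|].
apply/(smooth_on_Ck _ oAB) => k; apply: CkV => //; first by move=> y [].
by apply: Ck_subset ((smooth_on_Ck _ oA).1 sf k) => y [].
Qed.

Lemma smooth_near_prod E {fE : fin_coord E} (I : Type) (r : seq I) (f : I -> E -> R) x :
  (forall i, smooth_near (f i) x) -> smooth_near (fun y => \prod_(i <- r) f i y) x.
Proof.
move=> sf; elim: r => [|i r IH].
  by refine (eq_smooth_near _ (smooth_near_cst (1 : R) x)); near=> y; rewrite big_nil.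
by refine (eq_smooth_near _ (smooth_nearM (sf i) IH)); near=> y; rewrite big_cons.
Unshelve. all: by end_near. Qed.

Lemma smooth_nearZ E {fE : fin_coord E} F {fF : fin_coord F} (a : E -> R) (f : E -> F) x :
  smooth_near a x -> smooth_near f x -> smooth_near (fun y => a y *: f y) x.
Proof.
move=> sa sf; case: fF => N [e [c [cc dec]]].
apply: (smooth_near_coords dec) => i.
refine (eq_smooth_near _ (smooth_nearM sa (smooth_near_linear (cc i) sf))).
by near=> y; rewrite linearZ.
Unshelve. all: by end_near. Qed.

Lemma deriveZ_fun E {fE : fin_coord E} F {fF : fin_coord F} (a : E -> R) (f : E -> F) x u :
  smooth_near a x -> smooth_near f x ->
  'D_u (fun y => a y *: f y) x = a x *: 'D_u f x + 'D_u a x *: f x.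
Proof.
move=> sa sf; case: (fF) => N [e [c [cc dec]]].
apply: (eq_coords dec) => i.
rewrite -derive_linear //; last by apply: smooth_near_derivable; exact: smooth_nearZ.
have -> : (fun y => c i (a y *: f y)) = a * (fun y => c i (f y)).
  by apply/funext => y; rewrite linearZ.
rewrite deriveM; [|exact: smooth_near_derivable|by apply: smooth_near_derivable; exact: smooth_near_linear].
rewrite derive_linear //; last exact: smooth_near_derivable.
by rewrite linearD !linearZ /=; congr (_ + _); rewrite [RHS]mulrC.
Qed.

Lemma smooth_near_pair E F G (f : E -> F) (g : E -> G) x :
  smooth_near f x -> smooth_near g x -> smooth_near (fun y => (f y, g y)) x.
Proof.
have l1 : linear (fun v : F => (v, 0 : G)).
  by move=> a u v; congr (_, _); rewrite /= scaler0 addr0.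
have l2 : linear (fun v : G => (0 : F, v)).
  by move=> a u v; congr (_, _); rewrite /= scaler0 addr0.
pose L1 : {linear F -> (F * G)%type} := lin_of l1.
pose L2 : {linear G -> (F * G)%type} := lin_of l2.
move=> sf sg.
have c1 : continuous L1 by move=> y; apply: cvg_pair; [exact: cvg_id|exact: cvg_cst].
have c2 : continuous L2 by move=> y; apply: cvg_pair; [exact: cvg_cst|exact: cvg_id].
refine (eq_smooth_near _ (smooth_nearD (smooth_near_linear c1 sf) (smooth_near_linear c2 sg))).
by near=> y; congr (_, _); rewrite /= ?addr0 ?add0r.
Unshelve. all: by end_near. Qed.

Lemma derive_dir_coords E N (e : 'I_N -> E) (c : 'I_N -> {linear E -> R}) F
   (f : E -> F) x v :
  (forall v, v = \sum_(i < N) c i v *: e i) ->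
  differentiable f x -> 'D_v f x = \sum_(i < N) c i v *: 'D_(e i) f x.
Proof.
move=> dec df; rewrite deriveE // {1}(dec v) linear_sum; apply: eq_bigr => i _.
by rewrite linearZ /= -deriveE.
Qed.

Lemma smooth_near_dir E {fE : fin_coord E} F {fF : fin_coord F} (f : E -> F) (v : E -> E) x :
  smooth_near f x -> smooth_near v x -> smooth_near (fun y => 'D_(v y) f y) x.
Proof.
move=> sf sv; case: (fE) => N [e [c [cc dec]]].
have := @smooth_near_sum R E F 'I_N (index_enum _) xpredT (fun i y => c i (v y) *: 'D_(e i) f y) x.
move=> H; refine (eq_smooth_near _ (H _)).
  have := near_smooth_near sf; apply: filterS => y sfy.
  by rewrite (derive_dir_coords _ dec) //; exact: smooth_near_differentiable.
move=> i _; apply: smooth_nearZ; last exact: smooth_near_der.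
exact: smooth_near_linear.
Qed.

(** Leibniz rule for the pairing of a differential with a vector field. *)
Lemma derive_dir E {fE : fin_coord E} F {fF : fin_coord F} (f : E -> F) (v : E -> E) x u :
  smooth_near f x -> smooth_near v x ->
  'D_u (fun y => 'D_(v y) f y) x = 'D_u ('D_(v x) f) x + 'D_('D_u v x) f x.
Proof.
move=> sf sv; case: (fE) => N [e [c [cc dec]]].
have H (w : E -> E) : smooth_near w x ->
   'D_u (fun y => 'D_(w y) f y) x = \sum_(i < N) (c i (w x) *: 'D_u ('D_(e i) f) x
      + c i ('D_u w x) *: 'D_(e i) f x).
  move=> sw; transitivity ('D_u (\sum_(i < N) (fun y => c i (w y) *: 'D_(e i) f y)) x).
    apply: near_eq_derive; have := near_smooth_near sf; apply: filterS => y sfy.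
    by rewrite fct_sumE (derive_dir_coords _ dec) //; exact: smooth_near_differentiable.
  have sci i : smooth_near (fun y => c i (w y)) x by exact: smooth_near_linear.
  have sDi i : smooth_near ('D_(e i) f) x by exact: smooth_near_der.
  rewrite derive_sum; last by move=> i; apply: smooth_near_derivable; exact: smooth_nearZ.
  apply: eq_bigr => i _; rewrite deriveZ_fun // derive_linear //.
  exact: smooth_near_derivable.
rewrite H // (H (fun=> v x)); last exact: smooth_near_cst.
rewrite big_split /= [X in _ = X + _]big_split /=; rewrite -addrA; congr (_ + _).
rewrite derive_cst -(derive_dir_coords _ dec); last exact: smooth_near_differentiable.
rewrite (_ : \sum_(i < N) _ = 0) ?add0r // big1 // => i _.
by rewrite linear0 scale0r.
Qed.

End DirectionalDerivatives.

(** * The bracket of vector fields on a vector space *)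
Section EuclideanBracket.
#[local] Opaque derive.
Context {R : realType}.
Implicit Types E F : normedModType R.

Definition coord_bracket E (v w : E -> E) (p : E) : E := 'D_(v p) w p - 'D_(w p) v p.

Lemma smooth_near_coord_bracket E {fE : fin_coord E} (v w : E -> E) p :
  smooth_near v p -> smooth_near w p -> smooth_near (coord_bracket v w) p.
Proof.
move=> sv sw.
have s1 : smooth_near (fun y => 'D_(v y) w y) p by exact: smooth_near_dir.
have s2 : smooth_near (fun y => 'D_(w y) v y) p by exact: smooth_near_dir.
have cN : continuous (-%R : {linear E -> E}) by move=> y; exact: opp_continuous.
exact: smooth_nearD s1 (smooth_near_linear cN s2).
Qed.

(** Differentiate [d phi (v) = v' o phi] along [w] and antisymmetrize: the second derivatives
of [phi] cancel by symmetry. *)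
Lemma coord_bracket_related E {fE : fin_coord E} F {fF : fin_coord F} (phi : E -> F)
    (v w : E -> E) (v' w' : F -> F) p :
  smooth_near phi p -> smooth_near v p -> smooth_near w p ->
  smooth_near v' (phi p) -> smooth_near w' (phi p) ->
  (\forall t \near p, 'D_(v t) phi t = v' (phi t)) ->
  (\forall t \near p, 'D_(w t) phi t = w' (phi t)) ->
  'D_(coord_bracket v w p) phi p = coord_bracket v' w' (phi p).
Proof.
move=> sphi sv sw sv' sw' vv' ww'.
have dphi : differentiable phi p by exact: smooth_near_differentiable.
have H (a b : E -> E) (a' b' : F -> F) : smooth_near a p -> smooth_near b p ->
    smooth_near b' (phi p) ->
    (\forall t \near p, 'D_(a t) phi t = a' (phi t)) ->
    (\forall t \near p, 'D_(b t) phi t = b' (phi t)) ->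
    'D_('D_(a p) b p) phi p = 'D_(a' (phi p)) b' (phi p) - 'D_(a p) ('D_(b p) phi) p.
  move=> sa sb sb' aa' bb'.
  have E1 : 'D_(a p) (fun y => 'D_(b y) phi y) p = 'D_(a p) ('D_(b p) phi) p + 'D_('D_(a p) b p) phi p.
    exact: derive_dir.
  have E2 : 'D_(a p) (fun y => 'D_(b y) phi y) p = 'D_(a p) (fun y => b' (phi y)) p.
    exact: near_eq_derive.
  rewrite derive_comp // in E2; last exact: smooth_near_differentiable.
  rewrite (nbhs_singleton aa') in E2.
  by rewrite -E2 E1 addrC addKr.
rewrite /coord_bracket (derive_dirB _ _ dphi) (H v w v' w') // (H w v w' v') //.
by rewrite (derive_comm (w p) (v p) sphi) opprB addrA subrK.
Qed.

Lemma derive_coord_bracket E {fE : fin_coord E} (v w : E -> E) p u :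
  smooth_near v p -> smooth_near w p ->
  'D_u (coord_bracket v w) p = 'D_u ('D_(v p) w) p + 'D_('D_u v p) w p
                     - ('D_u ('D_(w p) v) p + 'D_('D_u w p) v p).
Proof.
move=> sv sw.
have s1 : smooth_near (fun y => 'D_(v y) w y) p by exact: smooth_near_dir.
have s2 : smooth_near (fun y => 'D_(w y) v y) p by exact: smooth_near_dir.
rewrite -derive_dir // -derive_dir //.
rewrite -(deriveB (f := fun y => 'D_(v y) w y) (g := fun y => 'D_(w y) v y)) //; exact: smooth_near_derivable.
Qed.

(** Each first-order term occurs twice with opposite signs, and the second-order terms cancel
by the symmetry of second derivatives. *)
Lemma coord_bracket_jacobi E {fE : fin_coord E} (u v w : E -> E) p :
  smooth_near u p -> smooth_near v p -> smooth_near w p ->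
  coord_bracket (coord_bracket u v) w p + coord_bracket (coord_bracket v w) u p + coord_bracket (coord_bracket w u) v p = 0.
Proof.
move=> su sv sw.
have H (a b c : E -> E) : smooth_near a p -> smooth_near b p -> smooth_near c p ->
   coord_bracket (coord_bracket a b) c p = 'D_('D_(a p) b p) c p - 'D_('D_(b p) a p) c p
     - ('D_(c p) ('D_(a p) b) p + 'D_('D_(c p) a p) b p
                     - ('D_(c p) ('D_(b p) a) p + 'D_('D_(c p) b p) a p)).
  move=> sa sb sc; rewrite -derive_coord_bracket // -derive_dirB //.
  exact: smooth_near_differentiable.
rewrite !H // (derive_comm (w p) (u p) sv) (derive_comm (v p) (w p) su) (derive_comm (u p) (v p) sw).
move: ('D_('D_(u p) v p) w p) ('D_('D_(v p) u p) w p) ('D_(u p) ('D_(w p) v) p)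
  ('D_('D_(w p) u p) v p) ('D_(w p) ('D_(v p) u) p) ('D_('D_(w p) v p) u p)
  ('D_('D_(v p) w p) u p) ('D_(v p) ('D_(u p) w) p) ('D_('D_(u p) w p) v p).
move=> a b c d e f g h i.
(* an identity between abstract vectors, checked on coordinates *)
case: fE => N [b0 [co [_ dec]]]; apply: (eq_coords dec) => j.
by rewrite !(linearD, linearB, linearN) /= linear0; ring.
Qed.
End EuclideanBracket.

(** * Vector fields on a manifold in charts *)
Section Charts.
#[local] Opaque derive.
Context {R : realType} {n : nat}.
Variable N : manifold R n.
Implicit Types (a b x y : N).

Lemma near_chart_inv a x : chart_dom a x ->
  \forall t \near chart a x, chart_dom a (chart_inv a t) /\ chart a (chart_inv a t) = t.
Proof.
move=> ax; have := open_nbhs_nbhs (conj (@mf_img_open _ _ _ a) (imageP (chart a) ax)).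
by apply: filterS => t [y ay <-]; rewrite (mf_chartK ay).
Qed.

Lemma chart_inv_cvg a x : chart_dom a x -> chart_inv a @ chart a x --> x.
Proof. by move=> ax; rewrite -{2}(mf_chartK ax); exact: mf_inv_cts. Qed.

Lemma near_dom a x : chart_dom a x -> \forall y \near x, chart_dom a y.
Proof. by move=> ax; apply: open_nbhs_nbhs; split => //; exact: mf_dom_open. Qed.

Lemma near_to_chart a x (P : N -> Prop) : chart_dom a x ->
  (\forall y \near x, P y) -> \forall t \near chart a x, P (chart_inv a t).
Proof. by move=> ax; exact: chart_inv_cvg. Qed.

Lemma near_transition a b x : chart_dom a x -> chart_dom b x ->
  \forall t \near chart a x,
    chart_inv b (chart b (chart_inv a t)) = chart_inv a t.
Proof.
move=> ax bx; apply: (near_to_chart (P := fun y => chart_inv b (chart b y) = y)) => //.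
by apply: filterS (near_dom bx) => y; exact: mf_chartK.
Qed.

Lemma transition_cvg a b x : chart_dom a x -> chart_dom b x ->
  chart b (chart_inv a t) @[t --> chart a x] --> chart b x.
Proof.
move=> ax bx; apply: (@cvg_comp _ _ _ (chart_inv a) (chart b) _ (nbhs x)).
  exact: chart_inv_cvg.
exact: mf_chart_cts.
Qed.

Lemma near_via_transition a b x (P : 'rV[R]_n -> Prop) : chart_dom a x -> chart_dom b x ->
  (\forall s \near chart b x, P s) -> \forall t \near chart a x, P (chart b (chart_inv a t)).
Proof. by move=> ax bx; exact: transition_cvg. Qed.

(** Smoothness may be tested in any chart around the point, because transition maps are
smooth. *)
Lemma smooth_near_chart (F : normedModType R) {fF : fin_coord F} (f : N -> F) a b x :
  chart_dom a x -> chart_dom b x ->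
  smooth_near (fun t => f (chart_inv a t)) (chart a x) ->
  smooth_near (fun t => f (chart_inv b t)) (chart b x).
Proof.
move=> ax bx sf.
have st := mf_transition bx ax.
have sf' : smooth_near (fun t => f (chart_inv a t)) (chart a (chart_inv b (chart b x))).
  by rewrite mf_chartK.
have H : smooth_near (fun t => f (chart_inv a (chart a (chart_inv b t)))) (chart b x).
  exact: smooth_near_comp st sf'.
refine (eq_smooth_near _ H).
by have := near_transition bx ax; apply: filterS => t ->.
Qed.

Lemma smooth_at_chart q (f : N -> 'rV[R]_q) a x : chart_dom a x ->
  smooth_at f x -> smooth_near (fun t => f (chart_inv a t)) (chart a x).
Proof. by move=> ax; apply: smooth_near_chart => //; exact: mf_dom_center. Qed.

Lemma smooth_at_from_chart q (f : N -> 'rV[R]_q) a x : chart_dom a x ->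
  smooth_near (fun t => f (chart_inv a t)) (chart a x) -> smooth_at f x.
Proof. by move=> ax; apply: smooth_near_chart => //; exact: mf_dom_center. Qed.

Lemma smooth_at_transition a x : chart_dom a x -> smooth_at (chart a) x.
Proof. by move=> ax; apply: mf_transition => //; exact: mf_dom_center. Qed.

Lemma near_smooth_at q (f : N -> 'rV[R]_q) x : smooth_at f x ->
  \forall y \near x, smooth_at f y.
Proof.
move=> sf; have cx := mf_dom_center x.
have H : \forall y \near x, smooth_near (fun t => f (chart_inv x t)) (chart x y).
  exact: (mf_chart_cts cx (near_smooth_near sf)).
by apply: filterS2 H (near_dom cx) => y sy xy; exact: smooth_at_from_chart sy.
Qed.

(** Tangent vectors at [x] are written in the chart centred at [x]; [dirder (chart a) x]
converts them to the chart [a]. *)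
Lemma dirder_chart q (f : N -> 'rV[R]_q) a x v : chart_dom a x -> smooth_at f x ->
  dirder f x v = 'D_(dirder (chart a) x v) (fun t => f (chart_inv a t)) (chart a x).
Proof.
move=> ax sf; have cx := mf_dom_center x.
have st := mf_transition cx ax.
have E : dirder f x v = 'D_v (fun t => f (chart_inv a (chart a (chart_inv x t)))) (chart x x).
  apply: near_eq_derive; have := near_transition cx ax; apply: filterS => t -> //.
rewrite E (derive_comp (g := fun t => f (chart_inv a t))).
- by rewrite mf_chartK.
- exact: smooth_near_differentiable st.
- by rewrite mf_chartK //; apply: smooth_near_differentiable; exact: smooth_at_chart.
Qed.

Lemma dirder_chart_center x v : dirder (chart x) x v = v.
Proof.
rewrite /dirder (near_eq_derive (g := id)) ?derive_id //.
by have := near_chart_inv (mf_dom_center x); apply: filterS => t [].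
Qed.

Lemma dirderP q (f : N -> 'rV[R]_q) x : smooth_at f x -> linear (dirder f x).
Proof.
by move=> sf c u v; rewrite /dirder derive_dirP //; exact: smooth_near_differentiable sf.
Qed.

Lemma dirder_chart_inj a x : chart_dom a x -> injective (dirder (chart a) x).
Proof.
move=> ax u v uv; rewrite -(dirder_chart_center x u) -(dirder_chart_center x v).
have sx := smooth_at_transition (mf_dom_center x).
by rewrite (dirder_chart _ ax sx) (dirder_chart v ax sx) uv.
Qed.

(** A field is given at each point in the chart centred at that point, so that its values at
different points are not comparable.  This is its expression in one fixed chart. *)
Definition chart_field a (V : N -> 'rV[R]_n) (t : 'rV[R]_n) : 'rV[R]_n :=
  dirder (chart a) (chart_inv a t) (V (chart_inv a t)).

Lemma chart_fieldE a x (V : N -> 'rV[R]_n) : chart_dom a x ->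
  chart_field a V (chart a x) = dirder (chart a) x (V x).
Proof. by move=> ax; rewrite /chart_field mf_chartK. Qed.

Lemma chart_field_center x (V : N -> 'rV[R]_n) : chart_field x V (chart x x) = V x.
Proof. by rewrite chart_fieldE ?dirder_chart_center //; exact: mf_dom_center. Qed.

(** The transition map relates the expressions of a field in two charts.  With
[coord_bracket_related] this makes the bracket independent of the chart. *)
Lemma chart_field_transition a b x (V : N -> 'rV[R]_n) : chart_dom a x -> chart_dom b x ->
  \forall t \near chart a x,
   'D_(chart_field a V t) (fun s => chart b (chart_inv a s)) t =
   chart_field b V (chart b (chart_inv a t)).
Proof.
move=> ax bx.
have H : \forall y \near x, 'D_(dirder (chart a) y (V y)) (fun s => chart b (chart_inv a s)) (chart a y)
     = chart_field b V (chart b y).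
  apply: filterS2 (near_dom ax) (near_dom bx) => y ay by_.
  rewrite chart_fieldE // (dirder_chart (f := chart b) _ ay) //.
  exact: smooth_at_transition.
have H2 := near_to_chart ax H.
have H3 := near_chart_inv ax.
apply: filterS2 H2 H3 => t + [at_ tE].
by rewrite {2}/chart_field -/(chart_field a V t) tE.
Qed.

Lemma smooth_chart_field a b x (V : N -> 'rV[R]_n) : chart_dom a x -> chart_dom b x ->
  smooth_near (chart_field a V) (chart a x) -> smooth_near (chart_field b V) (chart b x).
Proof.
move=> ax bx sV; have st := mf_transition ax bx; have st' := mf_transition bx ax.
have s1 : smooth_near (fun t => 'D_(chart_field a V t) (fun s => chart b (chart_inv a s)) t)
   (chart a (chart_inv b (chart b x))).
  by rewrite (mf_chartK bx); apply: smooth_near_dir; [exact: st|exact: sV].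
have tE := chart_field_transition V ax bx.
refine (eq_smooth_near _ (smooth_near_comp st' s1)).
have H1 := near_via_transition bx ax tE.
apply: filterS3 H1 (near_transition bx ax) (near_chart_inv bx) => t /= -> E1 [_ E2].
by rewrite E1 E2.
Qed.

Lemma smooth_field_chart a x (V : N -> 'rV[R]_n) : chart_dom a x ->
  smooth_field V x -> smooth_near (chart_field a V) (chart a x).
Proof. exact: smooth_chart_field (mf_dom_center x). Qed.

Lemma smooth_field_from_chart a x (V : N -> 'rV[R]_n) : chart_dom a x ->
  smooth_near (chart_field a V) (chart a x) -> smooth_field V x.
Proof. by move=> ax; exact: smooth_chart_field ax (mf_dom_center x). Qed.

Lemma field_bracketE x (V W : N -> 'rV[R]_n) :
  field_bracket V W x = coord_bracket (chart_field x V) (chart_field x W) (chart x x).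
Proof. by rewrite /coord_bracket !chart_field_center. Qed.

(** [field_bracket] is defined at each point by the chart centred there; iterating it, as the
Jacobi identity does, requires its values around a point in one fixed chart. *)
Lemma field_bracket_chart a x (V W : N -> 'rV[R]_n) : chart_dom a x ->
  smooth_field V x -> smooth_field W x ->
  dirder (chart a) x (field_bracket V W x) = coord_bracket (chart_field a V) (chart_field a W) (chart a x).
Proof.
move=> ax sV sW; have cx := mf_dom_center x.
have E : chart a (chart_inv x (chart x x)) = chart a x by rewrite (mf_chartK cx).
have K := @coord_bracket_related R _ _ _ _ (fun s => chart a (chart_inv x s))
  (chart_field x V) (chart_field x W) (chart_field a V) (chart_field a W) (chart x x).
rewrite E in K; rewrite field_bracketE; apply: K.
- exact: mf_transition.
- exact: sV.
- exact: sW.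
- exact: smooth_field_chart.
- exact: smooth_field_chart.
- exact: chart_field_transition.
- exact: chart_field_transition.
Qed.

Lemma near_smooth_field x (V : N -> 'rV[R]_n) : smooth_field V x ->
  \forall y \near x, smooth_field V y.
Proof.
move=> sV; have cx := mf_dom_center x.
apply: filterS2 (near_smooth_at sV) (near_dom cx) => y sy xy.
apply: (smooth_field_from_chart xy).
exact: (smooth_at_chart xy sy).
Qed.

Lemma eq_coord_bracket (v v' w w' : 'rV[R]_n -> 'rV[R]_n) p :
  (\forall t \near p, v t = v' t) -> (\forall t \near p, w t = w' t) ->
  coord_bracket v w p = coord_bracket v' w' p.
Proof.
move=> vv ww; rewrite /coord_bracket (nbhs_singleton vv) (nbhs_singleton ww).
by rewrite (near_eq_derive _ vv) (near_eq_derive _ ww).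
Qed.

Lemma chart_field_bracket x (V W : N -> 'rV[R]_n) : smooth_field V x -> smooth_field W x ->
  \forall t \near chart x x,
    chart_field x (field_bracket V W) t = coord_bracket (chart_field x V) (chart_field x W) t.
Proof.
move=> sV sW; have cx := mf_dom_center x.
have H : \forall y \near x, chart_field x (field_bracket V W) (chart x y)
    = coord_bracket (chart_field x V) (chart_field x W) (chart x y).
  apply: filterS3 (near_smooth_field sV) (near_smooth_field sW) (near_dom cx) => y sVy sWy xy.
  by rewrite (chart_fieldE _ xy) (field_bracket_chart xy sVy sWy).
have H2 := near_to_chart cx H.
by apply: filterS2 H2 (near_chart_inv cx) => t + [_ tE]; rewrite tE.
Qed.

Lemma smooth_field_bracket x (V W : N -> 'rV[R]_n) :
  smooth_field V x -> smooth_field W x -> smooth_field (field_bracket V W) x.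
Proof.
move=> sV sW.
have s : smooth_near (coord_bracket (chart_field x V) (chart_field x W)) (chart x x).
  by apply: smooth_near_coord_bracket; [exact: sV|exact: sW].
refine (eq_smooth_near _ s).
by apply: filterS (chart_field_bracket sV sW) => t /esym.
Qed.

(* From here on, comparing two brackets must not unfold them to derivatives. *)
#[local] Opaque field_bracket coord_bracket chart_field.

Lemma field_jacobi x (U V W : N -> 'rV[R]_n) :
  smooth_field U x -> smooth_field V x -> smooth_field W x ->
  field_bracket (field_bracket U V) W x + field_bracket (field_bracket V W) U x
    + field_bracket (field_bracket W U) V x = 0.
Proof.
move=> sU sV sW.
have E1 := field_bracketE x (field_bracket U V) W.
have E2 := field_bracketE x (field_bracket V W) U.
have E3 := field_bracketE x (field_bracket W U) V.
refine (etrans (congr2 +%R (congr2 +%R E1 E2) E3) _).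
clear E1 E2 E3.
have H (A B C : N -> 'rV[R]_n) : smooth_field A x -> smooth_field B x ->
    coord_bracket (chart_field x (field_bracket A B)) (chart_field x C) (chart x x) =
    coord_bracket (coord_bracket (chart_field x A) (chart_field x B)) (chart_field x C) (chart x x).
  move=> sA sB; apply: eq_coord_bracket; first exact: chart_field_bracket.
  by near=> t.
refine (etrans (congr2 +%R (congr2 +%R (H U V W sU sV) (H V W U sV sW)) (H W U V sW sU)) _).
exact (coord_bracket_jacobi sU sV sW).
Unshelve. all: by end_near. Qed.

End Charts.

(** * Partial derivatives on a product *)
Section PartialDerivatives.
Context {R : realType}.
Implicit Types E F G : normedModType R.

Lemma derive_partial2 E F G (M : E * F -> G) t s w :
  'D_w (fun s' => M (t, s')) s = 'D_(0, w) M (t, s).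
Proof.
rewrite /derive.
suff -> : (fun h : R => h^-1 *: (((fun s' => M (t, s')) \o shift s) (h *: w) - M (t, s)))
  = (fun h : R => h^-1 *: ((M \o shift (t, s)) (h *: (0, w)) - M (t, s))) by [].
apply/funext => h /=; congr (_ *: (M _ - _)); congr (_, _).
by rewrite /= scaler0 add0r.
Qed.

Lemma derive_partial1 E F G (M : E * F -> G) t s v :
  'D_v (fun t' => M (t', s)) t = 'D_(v, 0) M (t, s).
Proof.
rewrite /derive.
suff -> : (fun h : R => h^-1 *: (((fun t' => M (t', s)) \o shift t) (h *: v) - M (t, s)))
  = (fun h : R => h^-1 *: ((M \o shift (t, s)) (h *: (v, 0)) - M (t, s))) by [].
apply/funext => h /=; congr (_ *: (M _ - _)); congr (_, _).
by rewrite /= scaler0 add0r.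
Qed.

Lemma derive_partial2P E F G (M : E * F -> G) p (a : R) (u v : F) : differentiable M p ->
  'D_(0, a *: u + v) M p = a *: 'D_(0, u) M p + 'D_(0, v) M p.
Proof.
move=> dM; have E1 : (0 : E, a *: u + v) = a *: (0, u) + (0, v).
  by congr (_, _); rewrite /= scaler0 addr0.
by rewrite E1 derive_dirP.
Qed.

Lemma derive_partial1P E F G (M : E * F -> G) p (a : R) (u v : E) : differentiable M p ->
  'D_(a *: u + v, 0) M p = a *: 'D_(u, 0) M p + 'D_(v, 0) M p.
Proof.
move=> dM; have E1 : (a *: u + v, 0 : F) = a *: (u, 0) + (v, 0).
  by congr (_, _); rewrite /= scaler0 addr0.
by rewrite E1 derive_dirP.
Qed.
End PartialDerivatives.

(** * Tangent maps *)
Section SmoothMaps.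
#[local] Opaque derive.
Context {R : realType}.

Section OneMap.
Context {n1 n2 : nat} {N1 : manifold R n1} {N2 : manifold R n2}.
Implicit Types (F : N1 -> N2) (x y : N1).

Lemma near_map_dom F x (P : N2 -> Prop) : {for x, continuous F} ->
  (\forall z \near F x, P z) -> \forall y \near x, P (F y).
Proof. by move=> cF; exact: cF. Qed.

Lemma smooth_at_comp F q (f : N2 -> 'rV[R]_q) x :
  smooth_map F x -> smooth_at f (F x) -> smooth_at (fun y => f (F y)) x.
Proof.
move=> [cF sF] sf; have cx := mf_dom_center x; have cFx := mf_dom_center (F x).
have sf' : smooth_near (fun t => f (chart_inv (F x) t)) (chart (F x) (F (chart_inv x (chart x x)))).
  by rewrite (mf_chartK cx); exact: sf.
refine (eq_smooth_near _ (smooth_near_comp sF sf')).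
apply: (near_to_chart (P := fun y => f (chart_inv (F x) (chart (F x) (F y))) = f (F y))) => //.
apply: (near_map_dom (P := fun z => f (chart_inv (F x) (chart (F x) z)) = f z)) => //.
by apply: filterS (near_dom cFx) => z zF; rewrite (mf_chartK zF).
Qed.

Lemma dirder_tmap F q (f : N2 -> 'rV[R]_q) x v :
  smooth_map F x -> smooth_at f (F x) ->
  dirder f (F x) (tmap F x v) = dirder (fun y => f (F y)) x v.
Proof.
move=> [cF sF] sf; have cx := mf_dom_center x; have cFx := mf_dom_center (F x).
have E1 : dirder (fun y => f (F y)) x v =
    'D_v (fun t => f (chart_inv (F x) (chart (F x) (F (chart_inv x t))))) (chart x x).
  apply: near_eq_derive.
  apply: (near_to_chart (P := fun y => f (F y) = f (chart_inv (F x) (chart (F x) (F y))))) => //.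
  apply: (near_map_dom (P := fun z => f z = f (chart_inv (F x) (chart (F x) z)))) => //.
  by apply: filterS (near_dom cFx) => z zF; rewrite (mf_chartK zF).
have E2 := @derive_comp R _ _ _ (fun t => chart (F x) (F (chart_inv x t)))
  (fun s => f (chart_inv (F x) s)) (chart x x) v.
rewrite E1 E2; first by rewrite (mf_chartK cx).
- exact: smooth_near_differentiable sF.
- by rewrite (mf_chartK cx); exact: smooth_near_differentiable sf.
Qed.

Lemma tmapP F x : smooth_map F x -> linear (tmap F x).
Proof. by move=> [_ sF]; exact: dirderP. Qed.

Lemma tmapB F x u v : smooth_map F x -> tmap F x (u - v) = tmap F x u - tmap F x v.
Proof. by move=> sF; exact: (linPB (tmapP sF)). Qed.

Lemma smooth_map_chart F x b : smooth_map F x -> chart_dom b (F x) ->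
  smooth_at (fun y => chart b (F y)) x.
Proof. by move=> sF bF; apply: smooth_at_comp => //; exact: smooth_at_transition. Qed.

(** In charts this is [coord_bracket_related] for the local expression of [F]. *)
Lemma tmap_bracket F (V W : N1 -> 'rV[R]_n1) (V' W' : N2 -> 'rV[R]_n2) x :
  (forall y, smooth_map F y) ->
  smooth_field V x -> smooth_field W x ->
  smooth_field V' (F x) -> smooth_field W' (F x) ->
  (\forall y \near x, tmap F y (V y) = V' (F y)) ->
  (\forall y \near x, tmap F y (W y) = W' (F y)) ->
  tmap F x (field_bracket V W x) = field_bracket V' W' (F x).
Proof.
move=> sF sV sW sV' sW' hV hW; have [cF sFx] := sF x.
have cx := mf_dom_center x; have cFx := mf_dom_center (F x).
have E : chart (F x) (F (chart_inv x (chart x x))) = chart (F x) (F x) by rewrite (mf_chartK cx).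
have K := @coord_bracket_related R _ _ _ _ (fun t => chart (F x) (F (chart_inv x t)))
  (chart_field x V) (chart_field x W) (chart_field (F x) V') (chart_field (F x) W') (chart x x).
rewrite E in K; rewrite !field_bracketE.
have H U (U' : N2 -> 'rV[R]_n2) : (\forall y \near x, tmap F y (U y) = U' (F y)) ->
  \forall t \near chart x x, 'D_(chart_field x U t) (fun t => chart (F x) (F (chart_inv x t))) t
     = chart_field (F x) U' (chart (F x) (F (chart_inv x t))).
  move=> hU.
  have H1 := near_map_dom cF (near_dom cFx).
  have H2 : \forall y \near x, 'D_(chart_field x U (chart x y)) (fun t => chart (F x) (F (chart_inv x t))) (chart x y)
     = chart_field (F x) U' (chart (F x) (F y)).
    apply: filterS3 hU H1 (near_dom cx) => y hy Fy xy.
    rewrite (chart_fieldE _ xy) (chart_fieldE _ Fy) -hy.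
    rewrite (dirder_tmap _ (sF y) (smooth_at_transition Fy)).
    by rewrite (dirder_chart _ xy (smooth_map_chart (sF y) Fy)).
  have H3 := near_to_chart cx H2.
  by apply: filterS2 H3 (near_chart_inv cx) => t + [_ tE]; rewrite tE.
apply: K.
- exact: sFx.
- exact: sV.
- exact: sW.
- exact: sV'.
- exact: sW'.
- exact: H.
- exact: H.
Qed.

End OneMap.

Lemma smooth_map_comp n1 n2 n3 (N1 : manifold R n1) (N2 : manifold R n2) (N3 : manifold R n3)
    (F : N1 -> N2) (G : N2 -> N3) x :
  smooth_map F x -> smooth_map G (F x) -> smooth_map (fun y => G (F y)) x.
Proof.
move=> sF [cG sG]; split.
  by apply: (@continuous_comp _ _ _ F G) => //; case: sF.
exact: (smooth_at_comp sF sG).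
Qed.

Lemma tmap_comp n1 n2 n3 (N1 : manifold R n1) (N2 : manifold R n2) (N3 : manifold R n3)
    (F : N1 -> N2) (G : N2 -> N3) x v :
  smooth_map F x -> smooth_map G (F x) ->
  tmap (fun y => G (F y)) x v = tmap G (F x) (tmap F x v).
Proof. by move=> sF [_ sG]; rewrite [RHS](dirder_tmap v sF sG). Qed.

Lemma tmap_comp_at n1 n2 n3 (N1 : manifold R n1) (N2 : manifold R n2) (N3 : manifold R n3)
    (F : N1 -> N2) (G : N2 -> N3) x z v : F x = z ->
  smooth_map F x -> smooth_map G z ->
  tmap (fun y => G (F y)) x v = tmap G z (tmap F x v).
Proof. by move=> <-; exact: tmap_comp. Qed.

Lemma tmap_id n (N : manifold R n) (x : N) v : tmap (fun y => y) x v = v.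
Proof. exact: dirder_chart_center. Qed.

Section TwoMaps.
Context {n1 n2 n3 : nat} {N1 : manifold R n1} {N2 : manifold R n2} {N3 : manifold R n3}.
Variables (F : N1 -> N2 -> N3) (x : N1) (y : N2).

(** The expression of a map of two arguments in the product chart at [(x, y)].  The tangent maps
in one argument, at points near [(x, y)], are its partial derivatives
([tmap_local_rep1], [tmap_local_rep2]); this is how families of tangent maps become smooth
functions of the base point. *)
Definition local_rep (p : 'rV[R]_n1 * 'rV[R]_n2) : 'rV[R]_n3 :=
  chart (F x y) (F (chart_inv x p.1) (chart_inv y p.2)).

Hypothesis sF : smooth_map2 F x y.

Lemma smooth_local_rep : smooth_near local_rep (chart x x, chart y y).
Proof. by case: sF. Qed.

Lemma near_local_rep (P : N3 -> Prop) : (\forall z \near F x y, P z) ->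
  \forall p \near (chart x x, chart y y), P (F (chart_inv x p.1) (chart_inv y p.2)).
Proof.
have [cF _] := sF; move=> Pn.
have H : (fun p : 'rV[R]_n1 * 'rV[R]_n2 => (chart_inv x p.1, chart_inv y p.2))
   @ (chart x x, chart y y) --> (x, y).
  apply: cvg_pair.
    apply: (@cvg_comp _ _ _ fst (chart_inv x) _ (nbhs (chart x x))); first exact: cvg_fst.
    exact: chart_inv_cvg (mf_dom_center x).
  apply: (@cvg_comp _ _ _ snd (chart_inv y) _ (nbhs (chart y y))); first exact: cvg_snd.
  exact: chart_inv_cvg (mf_dom_center y).
have K := cvg_comp _ _ H cF; exact: (K P Pn).
Qed.

Lemma tmap_local_rep2 x' w : chart_dom x x' -> chart_dom (F x y) (F x' y) ->
  smooth_map (F x') y ->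
  dirder (chart (F x y)) (F x' y) (tmap (F x') y w) =
  'D_(0, w) local_rep (chart x x', chart y y).
Proof.
move=> xx' cF sF'.
rewrite (dirder_tmap _ sF' (smooth_at_transition cF)) -derive_partial2 /local_rep /dirder /=.
by rewrite (mf_chartK xx').
Qed.

Lemma tmap_local_rep1 y' v : chart_dom y y' -> chart_dom (F x y) (F x y') ->
  smooth_map (F ^~ y') x ->
  dirder (chart (F x y)) (F x y') (tmap (F ^~ y') x v) =
  'D_(v, 0) local_rep (chart x x, chart y y').
Proof.
move=> yy' cF sF'.
rewrite (dirder_tmap _ sF' (smooth_at_transition cF)) -derive_partial1 /local_rep /dirder /=.
by rewrite (mf_chartK yy').
Qed.

Lemma smooth_map2_right : smooth_map (F x) y.
Proof.
have [cF s2] := sF; split.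
  have H : {for y, continuous ((fun z : N1 * N2 => F z.1 z.2) \o (fun y' => (x, y')))}.
    by apply: continuous_comp; [apply: cvg_pair; [exact: cvg_cst|exact: cvg_id]|exact: cF].
  exact: H.
have sp : smooth_near (fun s : 'rV[R]_n2 => (chart x x, s)) (chart y y).
  by apply: smooth_near_pair; [exact: smooth_near_cst|exact: smooth_near_id].
refine (eq_smooth_near _ (smooth_near_comp sp s2)).
by near=> s; rewrite /= (mf_chartK (mf_dom_center x)).
Unshelve. all: by end_near. Qed.

Lemma smooth_map2_left : smooth_map (F ^~ y) x.
Proof.
have [cF s2] := sF; split.
  have H : {for x, continuous ((fun z : N1 * N2 => F z.1 z.2) \o (fun x' => (x', y)))}.
    by apply: continuous_comp; [apply: cvg_pair; [exact: cvg_id|exact: cvg_cst]|exact: cF].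
  exact: H.
have sp : smooth_near (fun s : 'rV[R]_n1 => (s, chart y y)) (chart x x).
  by apply: smooth_near_pair; [exact: smooth_near_id|exact: smooth_near_cst].
refine (eq_smooth_near _ (smooth_near_comp sp s2)).
by near=> s; rewrite /= (mf_chartK (mf_dom_center y)).
Unshelve. all: by end_near. Qed.

End TwoMaps.

End SmoothMaps.

(** * Left-invariant fields and the Lie algebra of a Lie group *)
Section LieGroup.
#[local] Opaque derive.
Context {R : realType} {n : nat}.
Variable G : lie_group R n.
Implicit Types x y z : G.
Local Notation g := 'rV[R]_n.
Local Notation one := (lg_one G).
Local Notation "x * y" := (lg_mul x y).
Local Notation "x ^-1" := (lg_inv x).

Lemma lg_mulVr x : x * x^-1 = one.
Proof.
rewrite -[LHS]lg_mul1 -(lg_mulV (x^-1)) -lg_mulA (lg_mulA (x^-1) x).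
by rewrite (lg_mulV x) lg_mul1.
Qed.

Lemma lg_mul1r x : x * one = x.
Proof. by rewrite -(lg_mulV x) lg_mulA lg_mulVr lg_mul1. Qed.

Lemma lg_inv_unique x y : x * y = one -> y = x^-1.
Proof. by move=> xy; rewrite -(lg_mul1 y) -(lg_mulV x) -lg_mulA xy lg_mul1r. Qed.

Lemma lg_invK x : (x^-1)^-1 = x.
Proof. by apply/esym/lg_inv_unique; exact: lg_mulV. Qed.

Lemma lg_invM x y : (x * y)^-1 = y^-1 * x^-1.
Proof.
apply/esym/lg_inv_unique.
by rewrite -lg_mulA (lg_mulA y) lg_mulVr lg_mul1 lg_mulVr.
Qed.

Lemma smooth_lmul x y : smooth_map (lg_mul x) y.
Proof. exact: smooth_map2_right (lg_mul_smooth x y). Qed.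

Lemma smooth_rmul y x : smooth_map (fun x' => x' * y) x.
Proof. exact: smooth_map2_left (lg_mul_smooth x y). Qed.

Definition lg_conj x y : G := x * y * x^-1.

Lemma smooth_lg_conj x y : smooth_map (lg_conj x) y.
Proof. by apply: (smooth_map_comp (G := fun z => z * x^-1)); [exact: smooth_lmul|exact: smooth_rmul]. Qed.

Lemma lg_conj1 x : lg_conj x one = one.
Proof. by rewrite /lg_conj lg_mul1r lg_mulVr. Qed.

Lemma AdE x A : Ad x A = tmap (lg_conj x) one A.
Proof. by []. Qed.

Lemma Ad_linear x : linear (@Ad R n G x).
Proof. exact: tmapP (smooth_lg_conj x one). Qed.

Lemma AdM x y A : Ad (x * y) A = Ad x (Ad y A).
Proof.
have E : lg_conj (x * y) = (fun z => lg_conj x (lg_conj y z)).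
  by apply/funext => z; rewrite /lg_conj lg_invM !lg_mulA.
rewrite !AdE E; exact: (tmap_comp_at A (lg_conj1 y) (smooth_lg_conj y one) (smooth_lg_conj x one)).
Qed.

Lemma Ad1 A : Ad one A = A.
Proof.
have E : lg_conj one = (fun z => z).
  by apply/funext => z; rewrite /lg_conj lg_mul1 -(lg_inv_unique (lg_mul1 one)) lg_mul1r.
by rewrite AdE E tmap_id.
Qed.

Lemma AdK x A : Ad x (Ad (x^-1) A) = A.
Proof. by rewrite -AdM lg_mulVr Ad1. Qed.

Lemma AdVK x A : Ad (x^-1) (Ad x A) = A.
Proof. by rewrite -AdM lg_mulV Ad1. Qed.

Lemma left_field1 A : left_field A one = A.
Proof.
have E : lg_mul one = (fun z => z) by apply/funext => z; rewrite lg_mul1.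
by rewrite /left_field E tmap_id.
Qed.

Lemma left_field_invariant z y A : tmap (lg_mul z) y (left_field A y) = left_field A (z * y).
Proof.
have E : (fun w => z * (y * w)) = lg_mul (z * y) by apply/funext => w; rewrite lg_mulA.
have := tmap_comp_at A (lg_mul1r y) (smooth_lmul y one) (smooth_lmul z y).
by rewrite E => /esym.
Qed.

(** Conjugation by [x] is an automorphism, so it maps left-invariant fields to left-invariant
fields. *)
Lemma left_field_conj x y A :
  tmap (lg_conj x) y (left_field A y) = left_field (Ad x A) (lg_conj x y).
Proof.
have E : (fun w => lg_conj x (y * w)) = (fun w => lg_mul (lg_conj x y) (lg_conj x w)).
  apply/funext => w; rewrite /lg_conj -!lg_mulA; congr (x * (y * _)).
  by rewrite (lg_mulA (x^-1)) lg_mulV lg_mul1.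
have E1 := tmap_comp_at A (lg_mul1r y) (smooth_lmul y one) (smooth_lg_conj x y).
have E2 := tmap_comp_at A (lg_conj1 x) (smooth_lg_conj x one) (smooth_lmul (lg_conj x y) one).
by rewrite -E E1 in E2.
Qed.

Definition mul_rep x : g * g -> g := local_rep (@lg_mul R n G) x one.

Lemma smooth_mul_rep x : smooth_near (mul_rep x) (chart x x, chart one one).
Proof. exact: smooth_local_rep (lg_mul_smooth x one). Qed.

Lemma left_field_chart x y A : chart_dom x y ->
  dirder (chart x) y (left_field A y) = 'D_(0, A) (mul_rep x) (chart x y, chart one one).
Proof.
move=> xy; have := @tmap_local_rep2 _ _ _ _ _ _ _ (@lg_mul R n G) x one y A xy.
rewrite !lg_mul1r; apply => //; exact: smooth_lmul.
Qed.

Lemma near_chart_left_field x A :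
  \forall t \near chart x x, chart_field x (left_field A) t = 'D_(0, A) (mul_rep x) (t, chart one one).
Proof.
have cx := mf_dom_center x.
have H : \forall y \near x, chart_field x (left_field A) (chart x y)
    = 'D_(0, A) (mul_rep x) (chart x y, chart one one).
  by apply: filterS (near_dom cx) => y xy; rewrite (chart_fieldE _ xy) left_field_chart.
have H2 := near_to_chart cx H.
by apply: filterS2 H2 (near_chart_inv cx) => t + [_ tE]; rewrite tE.
Qed.

Lemma smooth_left_field A x : smooth_field (left_field A) x.
Proof.
have sp : smooth_near (fun t : g => (t, chart one one)) (chart x x).
  by apply: smooth_near_pair; [exact: smooth_near_id|exact: smooth_near_cst].
have sD := smooth_near_der (0, A) (smooth_mul_rep x).
refine (eq_smooth_near _ (smooth_near_comp sp sD)).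
by apply: filterS (near_chart_left_field x A) => t /esym.
Qed.

(** Left translations relate left-invariant fields to themselves, hence also their brackets. *)
Lemma left_field_bracket A B x :
  field_bracket (left_field A) (left_field B) x = left_field (lie G A B) x.
Proof.
have H A' : \forall y \near one, tmap (lg_mul x) y (left_field A' y) = left_field A' (x * y).
  by near=> y; exact: left_field_invariant.
have := tmap_bracket (F := lg_mul x) (x := one) (smooth_lmul x)
  (smooth_left_field A one) (smooth_left_field B one)
  (smooth_left_field A (x * one)) (smooth_left_field B (x * one)) (H A) (H B).
by rewrite lg_mul1r => <-.
Unshelve. all: by end_near. Qed.

(** The inner brackets must be brackets of fields, not only of values at the unit, which is
[left_field_bracket]. *)
Lemma lie_jacobi A B C :
  lie G (lie G A B) C + lie G (lie G B C) A + lie G (lie G C A) B = 0.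
Proof.
have E A' B' : field_bracket (left_field (G := G) A') (left_field B') = left_field (lie G A' B').
  by apply/funext => x; exact: left_field_bracket.
have F A' B' C' : lie G (lie G A' B') C' =
    field_bracket (field_bracket (left_field (G := G) A') (left_field B')) (left_field C') one.
  exact (esym (congr1 (fun V => field_bracket V (left_field C') one) (E A' B'))).
refine (etrans (congr2 +%R (congr2 +%R (F A B C) (F B C A)) (F C A B)) _).
exact: field_jacobi (smooth_left_field A one) (smooth_left_field B one) (smooth_left_field C one).
Qed.

Lemma Ad_lie x A B : Ad x (lie G A B) = lie G (Ad x A) (Ad x B).
Proof.
have H A' : \forall y \near one, tmap (lg_conj x) y (left_field A' y) = left_field (Ad x A') (lg_conj x y).
  by near=> y; exact: left_field_conj.
have := tmap_bracket (F := lg_conj x) (x := one) (smooth_lg_conj x)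
  (smooth_left_field A one) (smooth_left_field B one)
  (smooth_left_field (Ad x A) (lg_conj x one)) (smooth_left_field (Ad x B) (lg_conj x one)) (H A) (H B).
by rewrite lg_conj1.
Unshelve. all: by end_near. Qed.

Local Notation e0 := (chart one one).
Local Notation mul1_rep := (mul_rep one).

(** The bracket as the antisymmetric part of the second-order term of the multiplication. *)
Lemma lieE A B : lie G A B =
  'D_(A, 0) ('D_(0, B) mul1_rep) (e0, e0) - 'D_(B, 0) ('D_(0, A) mul1_rep) (e0, e0).
Proof.
rewrite /lie field_bracketE.
rewrite (eq_coord_bracket (near_chart_left_field one A) (near_chart_left_field one B)).
have E A' : 'D_(0, A') mul1_rep (e0, e0) = A'.
  by rewrite -left_field_chart ?left_field1 ?dirder_chart_center //; exact: mf_dom_center.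
rewrite /coord_bracket !E.
exact (congr2 (fun v w : g => v - w) (derive_partial1 ('D_(0, B) mul1_rep) e0 e0 A)
  (derive_partial1 ('D_(0, A) mul1_rep) e0 e0 B)).
Qed.

Lemma lieC A B : lie G A B = - lie G B A.
Proof. by rewrite !lieE opprB. Qed.

Lemma lie_linear A : linear (lie G A).
Proof.
move=> c B C.
have sM := smooth_mul_rep one.
have dd v : differentiable ('D_v mul1_rep) (e0, e0).
  by apply: smooth_near_differentiable; exact: smooth_near_der.
have H X : lie G A X = 'D_(0, X) ('D_(A, 0) mul1_rep) (e0, e0) - 'D_(X, 0) ('D_(0, A) mul1_rep) (e0, e0).
  refine (etrans (lieE A X) (congr1 (fun w : g => w - _) _)).
  exact (derive_comm (A, 0) (0, X) sM).
rewrite (H (c *: B + C)) (H B) (H C).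
have E1 := derive_partial2P c B C (dd (A, 0)).
have E2 := derive_partial1P c B C (dd (0, A)).
refine (etrans (congr2 (fun u w : g => u - w) E1 E2) _).
have Z (k : R) (a b a' b' : g) : (k *: a + b) - (k *: a' + b') = k *: (a - a') + (b - b').
  by rewrite scalerBr opprD addrACA.
exact: Z.
Qed.

End LieGroup.

(** * The derivative of the adjoint representation *)
Section AdDerivative.
#[local] Opaque derive.
Context {R : realType} {n : nat}.
Variable G : lie_group R n.
Implicit Types x y z : G.
Local Notation g := 'rV[R]_n.
Local Notation one := (lg_one G).
Local Notation "x * y" := (lg_mul x y).
Local Notation "x ^-1" := (lg_inv x).
Local Notation e0 := (chart one one).
Local Notation M := (mul_rep one).
Local Notation inv1 := (chart_inv one).

Lemma lg_inv1 : one^-1 = one.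
Proof. by apply/esym/lg_inv_unique; rewrite lg_mul1. Qed.

Lemma mul_repE (p : g * g) : M p = chart one (inv1 p.1 * inv1 p.2).
Proof. by rewrite /mul_rep /local_rep lg_mul1. Qed.

Let c1 := mf_dom_center one.

Lemma inv1K : inv1 e0 = one. Proof. exact: mf_chartK. Qed.

Lemma mul_rep00 : M (e0, e0) = e0.
Proof. by rewrite mul_repE /= inv1K lg_mul1. Qed.

Definition inv_rep (t : g) : g := chart one ((inv1 t)^-1).

Lemma inv_rep0 : inv_rep e0 = e0.
Proof. by rewrite /inv_rep inv1K lg_inv1. Qed.

Lemma smooth_inv_rep : smooth_near inv_rep e0.
Proof. by have [_] := lg_inv_smooth one; rewrite lg_inv1. Qed.

(** [Ad] is a partial derivative of this function of two variables, hence smooth. *)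
Definition conj_rep (p : g * g) : g := chart one (lg_conj (inv1 p.1) (inv1 p.2)).

Lemma near_inv1_mul : \forall p \near (e0, e0), inv1 (M p) = inv1 p.1 * inv1 p.2.
Proof.
have H : \forall z \near one * one, inv1 (chart one z) = z.
  by rewrite lg_mul1; apply: filterS (near_dom c1) => z; exact: mf_chartK.
have := near_local_rep (lg_mul_smooth one one) H.
by apply: filterS => p; rewrite mul_repE.
Qed.

Lemma near_inv1_inv : \forall t \near e0, inv1 (inv_rep t) = (inv1 t)^-1.
Proof.
have [ci _] := lg_inv_smooth one.
have H : \forall z \near one^-1, inv1 (chart one z) = z.
  by rewrite lg_inv1; apply: filterS (near_dom c1) => z; exact: mf_chartK.
have H2 := near_map_dom ci H.
exact: (near_to_chart c1 H2).
Qed.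

Lemma fst_cvg_near (P : g -> Prop) (t s : g) : (\forall t' \near t, P t') ->
  \forall p \near (t, s), P p.1.
Proof. by move=> Pn; exact: (cvg_fst Pn). Qed.

Lemma smooth_fst (p : (g * g)%type) : smooth_near (fst : g * g -> g) p.
Proof.
have lin : linear (fst : (g * g)%type -> g) by [].
have cL : continuous (lin_of lin) by move=> q; exact: cvg_fst.
exact: (smooth_near_linear cL (smooth_near_id p)).
Qed.

Lemma smooth_snd (p : (g * g)%type) : smooth_near (snd : g * g -> g) p.
Proof.
have lin : linear (snd : (g * g)%type -> g) by [].
have cL : continuous (lin_of lin) by move=> q; exact: cvg_snd.
exact: (smooth_near_linear cL (smooth_near_id p)).
Qed.

(** Near the unit, conjugation is a composition of the local expressions of multiplication and
inversion; the charts cancel only where the intermediate products stay in the domain of the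
chart at the unit. *)
Lemma smooth_conj_rep : smooth_near conj_rep (e0, e0).
Proof.
have sM : smooth_near M (e0, e0) by exact: smooth_mul_rep.
have si : smooth_near (fun p : g * g => inv_rep p.1) (e0, e0).
  have si0 : smooth_near inv_rep (e0, e0).1 by exact: smooth_inv_rep.
  exact (smooth_near_comp (smooth_fst (e0, e0)) si0).
have sp := smooth_near_pair sM si.
have sM' : smooth_near M (M (e0, e0), inv_rep (e0, e0).1).
  by rewrite mul_rep00 inv_rep0.
refine (eq_smooth_near _ (smooth_near_comp sp sM')).
have N1 := near_inv1_mul; have N2 := fst_cvg_near e0 near_inv1_inv.
apply: filterS2 N1 N2 => p E1 E2.
by rewrite (mul_repE (_, _)) [LHS]/= E1 E2.
Qed.

Lemma Ad_rep t B : Ad (inv1 t) B = 'D_(0, B) conj_rep (t, e0).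
Proof.
rewrite AdE -derive_partial2 /tmap /dirder lg_conj1 //.
Qed.

Lemma smooth_Ad_rep B : smooth_near (fun t => Ad (inv1 t) B) e0.
Proof.
have sp : smooth_near (fun t : g => (t, e0)) e0.
  by apply: smooth_near_pair; [exact: smooth_near_id|exact: smooth_near_cst].
have sD := smooth_near_der (0, B) smooth_conj_rep.
refine (eq_smooth_near _ (smooth_near_comp sp sD)).
by near=> t; rewrite -Ad_rep.
Unshelve. all: by end_near. Qed.

(** [x y = (x y x^-1) x]: a left-invariant field is, at [x], a right-invariant one with
[Ad x] applied to its generator. *)
Lemma left_field_right x B : left_field B x = tmap (fun y => y * x) one (Ad x B).
Proof.
have E : lg_mul x = (fun y => lg_conj x y * x).
  by apply/funext => y; rewrite /lg_conj -lg_mulA lg_mulV lg_mul1r.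
have := tmap_comp_at B (lg_conj1 x) (smooth_lg_conj x one) (smooth_rmul x one).
by rewrite -E -AdE.
Qed.

Lemma near_left_right B :
  \forall t \near e0, 'D_(0, B) M (t, e0) = 'D_(Ad (inv1 t) B, 0) M (e0, t).
Proof.
have H : \forall x \near one, 'D_(0, B) M (chart one x, e0) = 'D_(Ad (inv1 (chart one x)) B, 0) M (e0, chart one x).
  apply: filterS (near_dom c1) => x x1.
  rewrite (mf_chartK x1) -(left_field_chart B x1) left_field_right.
  have := @tmap_local_rep1 _ _ _ _ _ _ _ (@lg_mul R n G) one one x (Ad x B) x1.
  rewrite !lg_mul1; apply => //; exact: smooth_rmul.
have H2 := near_to_chart c1 H.
by apply: filterS2 H2 (near_chart_inv c1) => t + [_ tE]; rewrite tE.
Qed.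

Lemma derive_mul_rep1 w : 'D_(w, 0) M (e0, e0) = w.
Proof.
rewrite -derive_partial1 (near_eq_derive (g := id)) ?derive_id //.
by apply: filterS (near_chart_inv c1) => t [_ tE]; rewrite mul_repE /= inv1K lg_mul1r.
Qed.

(** Differentiate the identity of [near_left_right] at the unit in the direction [A].  The left
side gives one of the two mixed derivatives of the multiplication in [lieE], the right side the
other one plus the derivative of [Ad]. *)
Lemma derive_Ad A B : 'D_A (fun t => Ad (inv1 t) B) e0 = lie G A B.
Proof.
pose a t := Ad (inv1 t) B.
have sa : smooth_near a e0 by exact: smooth_Ad_rep.
have a0 : a e0 = B by rewrite /a inv1K Ad1.
have sM : smooth_near M (e0, e0) by exact: smooth_mul_rep.
(* the direction of differentiation as a field on the product, so that [derive_dir] applies *)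
pose v (q : g * g) : g * g := (a q.2, 0).
have sv : smooth_near v (e0, e0).
  apply: smooth_near_pair; last exact: smooth_near_cst.
  have sa' : smooth_near a (e0, e0).2 by exact: sa.
  exact (smooth_near_comp (smooth_snd (e0, e0)) sa').
have l1 : linear (fun v : g => (v, 0 : g)).
  by move=> k u w; congr (_, _); rewrite /= scaler0 addr0.
pose L1 : {linear g -> (g * g)%type} := lin_of l1.
have cL1 : continuous L1.
  move=> y; apply: (@smooth_near_continuous R g (g * g)%type (fun v : g => (v, 0 : g))).
  by apply: smooth_near_pair; [exact: smooth_near_id|exact: smooth_near_cst].
have Dv : 'D_(0, A) v (e0, e0) = ('D_A a e0, 0).
  have D1 : 'D_A (fun s : g => L1 (a s)) e0 = L1 ('D_A a e0).
    by apply: derive_linear => //; exact: smooth_near_derivable.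
  have D2 := derive_partial2 v e0 e0 A.
  exact (etrans (esym D2) D1).
have E1 : 'D_A (fun t => 'D_(0, B) M (t, e0)) e0 = 'D_A (fun t => 'D_(v (e0, t)) M (e0, t)) e0.
  by apply: near_eq_derive; exact: near_left_right.
have E2 : 'D_A (fun t => 'D_(v (e0, t)) M (e0, t)) e0 = 'D_(0, A) (fun q => 'D_(v q) M q) (e0, e0).
  exact: (derive_partial2 (fun q => 'D_(v q) M q)).
have E3 : 'D_(0, A) (fun q => 'D_(v q) M q) (e0, e0) =
   'D_(0, A) ('D_(v (e0, e0)) M) (e0, e0) + 'D_('D_(0, A) v (e0, e0)) M (e0, e0).
  exact (derive_dir (0, A) sM sv).
have v0 : v (e0, e0) = (B, 0) by rewrite -a0.
rewrite Dv v0 (derive_mul_rep1 ('D_A a e0)) in E3.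
have E4 : 'D_A (fun t => 'D_(0, B) M (t, e0)) e0 = 'D_(A, 0) ('D_(0, B) M) (e0, e0).
  exact: (derive_partial1 ('D_(0, B) M)).
have E5 : 'D_(B, 0) ('D_(0, A) M) (e0, e0) = 'D_(0, A) ('D_(B, 0) M) (e0, e0).
  exact (derive_comm (B, 0) (0, A) sM).
have E6 := lieE G A B.
have E7 := etrans (esym E4) (etrans E1 (etrans E2 E3)).
have Z (p q r l s : g) : p = q + r -> l = p - s -> s = q -> r = l.
  by move=> -> -> ->; rewrite addrAC subrr add0r.
exact: (Z _ _ _ _ _ E7 E6 E5).
Qed.

Lemma smooth_at_Ad B : smooth_at (fun x => Ad x B) one.
Proof. exact: smooth_Ad_rep. Qed.

Lemma dirder_Ad A B : dirder (fun x => Ad x B) one A = lie G A B.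
Proof. exact: derive_Ad. Qed.

End AdDerivative.

(** * Smooth solutions of linear systems *)
Section SmoothLinearAlgebra.
#[local] Opaque derive.
Context {R : realType} {E : normedModType R} {fE : fin_coord E}.
Implicit Type p : E.

Lemma smooth_near_entry n (f : E -> 'rV[R]_n) p i :
  smooth_near f p -> smooth_near (fun t => f t 0 i) p.
Proof. exact: (smooth_near_linear (@entry_continuous R n i)). Qed.

Lemma derive_entry n (f : E -> 'rV[R]_n) p i v :
  smooth_near f p -> 'D_v (fun t => f t 0 i) p = 'D_v f p 0 i.
Proof.
move=> sf; exact: (derive_linear (@entry_continuous R n i) (smooth_near_derivable sf)).
Qed.

Lemma smooth_near_rV n (f : E -> 'rV[R]_n) p :
  (forall i, smooth_near (fun t => f t 0 i) p) -> smooth_near f p.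
Proof.
move=> sf.
have := @smooth_near_sum R E 'rV[R]_n 'I_n (index_enum _) xpredT
   (fun i t => scale_linear (delta_mx 0 i) (f t 0 i)) p.
move=> H; refine (eq_smooth_near _ (H _)).
  by near=> y; rewrite [RHS]row_sum_delta.
move=> i _; apply: smooth_near_linear; last exact: sf.
by move=> z; exact: cvgZr_tmp.
Unshelve. all: by end_near. Qed.

Lemma smooth_near_det n (A : E -> 'M[R]_n) p :
  (forall i j, smooth_near (fun t => A t i j) p) -> smooth_near (fun t => \det (A t)) p.
Proof.
move=> sA; rewrite /determinant; apply: smooth_near_sum => s _.
apply: smooth_nearM; first exact: smooth_near_cst.
by apply: smooth_near_prod => i; exact: sA.
Qed.

(** Cramer: the entries of the solution are quotients of polynomials in the entries of the
matrix. *)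
Lemma smooth_near_solve n (A : E -> 'M[R]_n) (w : E -> 'rV[R]_n) (X : 'rV[R]_n) p :
  (forall i j, smooth_near (fun t => A t i j) p) ->
  (\forall t \near p, A t \in unitmx) -> (\forall t \near p, w t *m A t = X) ->
  smooth_near w p.
Proof.
move=> sA uA wA.
have sdet := smooth_near_det sA.
have det0 : \det (A p) != 0.
  by have := nbhs_singleton uA; rewrite unitmxE unitfE.
have sdetV : smooth_near (fun t => (\det (A t))^-1) p by exact: smooth_nearV.
apply: smooth_near_rV => i.
have sadj k : smooth_near (fun t => \adj (A t) k i) p.
  suff H : smooth_near (fun t => (-1) ^+ (i + k) * \det (row' i (col' k (A t)))) p.
    by refine (eq_smooth_near _ H); near=> t; rewrite mxE.
  apply: smooth_nearM; first exact: smooth_near_cst.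
  apply: smooth_near_det => a b; suff H : smooth_near (fun t => A t (lift i a) (lift k b)) p.
    by refine (eq_smooth_near _ H); near=> t; rewrite !mxE.
  exact: sA.
suff H : smooth_near (fun t => \sum_k X 0 k * ((\det (A t))^-1 * \adj (A t) k i)) p.
  refine (eq_smooth_near _ H); apply: filterS2 uA wA => t ut wt.
  rewrite -(mulmxK ut (w t)) wt /invmx ut !mxE; apply: eq_bigr => k _.
  by rewrite !mxE.
apply: smooth_near_sum => k _; apply: smooth_nearM; first exact: smooth_near_cst.
by apply: smooth_nearM; [exact: sdetV|exact: sadj].
Unshelve. all: by end_near. Qed.

End SmoothLinearAlgebra.

(** * Constant fields of a coframe *)
Section Coframe.
#[local] Opaque derive.
Context {R : realType} {k n : nat}.
Variable N : manifold R k.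
Variable om : N -> 'Hom('rV[R]_k, 'rV[R]_n).
Hypothesis om_smooth : smooth_form om.
Hypothesis om_bij : forall u, bijective (om u).
Local Notation g := 'rV[R]_n.
Implicit Types (u v : N) (X Y : g).

(** The field [X~] with [om (X~) = X]. *)
Definition const_field X u : 'rV[R]_k := (om u)^-1%VF X.

Lemma om_const_field u X : om u (const_field X u) = X.
Proof.
apply: limg_lfunVK; have [h _ hK] := om_bij u.
by rewrite -(hK X); apply: memv_img; exact: memvf.
Qed.

Lemma const_field_om u w : const_field (om u w) u = w.
Proof. by apply: lker0_lfunK; apply/lker0P; exact: bij_inj. Qed.

Lemma const_field_linear u : linear (fun X => const_field X u).
Proof. by move=> a X Y; rewrite /const_field linearP. Qed.

(** The dimensions agree only propositionally; the equality is used to see the matrix of the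
coframe in a chart as a square matrix. *)
Lemma coframe_dim (u : N) : k = n.
Proof.
have ker0 : lker (om u) == 0%VS by apply/lker0P; exact: bij_inj.
have full : limg (om u) = fullv.
  apply/eqP; rewrite eqEsubv subvf; apply/subvP => X _.
  by rewrite -(om_const_field u X); apply: memv_img; exact: memvf.
have := limg_ker_dim (om u) fullv.
by rewrite (eqP ker0) capv0 dimv0 add0n full !dimvf /dim /= !mul1n => ->.
Qed.

(** The coordinate field of the chart [c], whose value at [y] has to be converted to the chart
centred at [y].  A smooth form is smooth on smooth fields, and these fields give its matrix. *)
Definition coord_field (c : N) (i : 'I_k) (y : N) : 'rV[R]_k :=
  'D_(delta_mx 0 i) (fun t => chart y (chart_inv c t)) (chart c y).

Lemma coord_fieldE c i y : chart_dom c y ->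
  dirder (chart c) y (coord_field c i y) = delta_mx 0 i.
Proof.
move=> cy; have yy := mf_dom_center y.
have s1 := mf_transition cy yy; have s2 := mf_transition yy cy.
have E : chart y (chart_inv c (chart c y)) = chart y y by rewrite (mf_chartK cy).
have d2 : differentiable (fun t => chart c (chart_inv y t)) (chart y (chart_inv c (chart c y))).
  by rewrite E; exact: (smooth_near_differentiable s2).
have d1 : differentiable (fun t => chart y (chart_inv c t)) (chart c y).
  exact: (smooth_near_differentiable s1).
have K := derive_comp (delta_mx 0 i) d1 d2.
rewrite E in K; rewrite /dirder -/(coord_field c i y) in K *.
rewrite -K (near_eq_derive (g := id)) ?derive_id //.
have H : \forall z \near y, chart c (chart_inv y (chart y z)) = chart c z.
  by apply: filterS (near_dom yy) => z yz; rewrite (mf_chartK yz).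
have H2 := near_to_chart cy H.
by apply: filterS2 H2 (near_chart_inv cy) => t -> [].
Qed.

Lemma smooth_coord_field c i y : chart_dom c y -> smooth_field (coord_field c i) y.
Proof.
move=> cy; apply: (smooth_field_from_chart cy).
have s : smooth_near (fun _ : 'rV[R]_k => delta_mx 0 i : 'rV[R]_k) (chart c y).
  exact: smooth_near_cst.
refine (eq_smooth_near _ s).
have H : \forall z \near y, delta_mx 0 i = dirder (chart c) z (coord_field c i z).
  by apply: filterS (near_dom cy) => z cz; rewrite coord_fieldE.
exact: (near_to_chart cy H).
Qed.

Lemma dirder_coord_sum c y (w : 'rV[R]_k) : chart_dom c y ->
  dirder (chart c) y (\sum_i w 0 i *: coord_field c i y) = w.
Proof.
move=> cy; have lin := dirderP (smooth_at_transition cy).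
rewrite (linP_sum lin) [RHS]row_sum_delta; apply: eq_bigr => i _.
by rewrite (linPZ lin) coord_fieldE.
Qed.

Lemma coord_field_sum c y (w : 'rV[R]_k) : chart_dom c y ->
  w = \sum_i dirder (chart c) y w 0 i *: coord_field c i y.
Proof.
by move=> cy; apply: (dirder_chart_inj cy); rewrite dirder_coord_sum.
Qed.

Definition form_mx c (t : 'rV[R]_k) : 'M[R]_(k, n) :=
  \matrix_(i, j) om (chart_inv c t) (coord_field c i (chart_inv c t)) 0 j.

Lemma form_mxE c y w : chart_dom c y -> om y w = dirder (chart c) y w *m form_mx c (chart c y).
Proof.
move=> cy; rewrite {1}(coord_field_sum w cy) linear_sum mulmx_sum_row; apply: eq_bigr => i _.
rewrite linearZ /=; congr (_ *: _); apply/rowP => j.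
by rewrite !mxE (mf_chartK cy).
Qed.

Lemma smooth_form_mx c y i j : chart_dom c y ->
  smooth_near (fun t => form_mx c t i j) (chart c y).
Proof.
move=> cy; have sE := om_smooth (smooth_coord_field i cy).
have s := smooth_near_entry j (smooth_at_chart cy sE).
by refine (eq_smooth_near _ s); near=> t; rewrite mxE.
Unshelve. all: by end_near. Qed.

(** In a chart, [X~] solves a linear system whose matrix is that of [om]. *)
Lemma smooth_const_field X u : smooth_field (const_field X) u.
Proof.
have cu := mf_dom_center u; apply: (smooth_field_from_chart cu).
have kn := coframe_dim u.
have sA i j := smooth_form_mx i j cu.
have mxE' : \forall t \near chart u u, chart_field u (const_field X) t *m form_mx u t = X.
  have H : \forall y \near u, chart_field u (const_field X) (chart u y) *m form_mx u (chart u y) = X.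
    by apply: filterS (near_dom cu) => y uy; rewrite (chart_fieldE _ uy) -(form_mxE _ uy) om_const_field.
  have H2 := near_to_chart cu H.
  by apply: filterS2 H2 (near_chart_inv cu) => t + [_ tE]; rewrite tE.
have inj : \forall t \near chart u u, forall w : 'rV[R]_k, w *m form_mx u t = 0 -> w = 0.
  have H : \forall y \near u, forall w : 'rV[R]_k, w *m form_mx u (chart u y) = 0 -> w = 0.
    have := near_dom cu; apply: filterS => y uy w w0.
    have vE := dirder_coord_sum w uy; set v := \sum_i _ in vE.
    rewrite -vE -(form_mxE v uy) in w0.
    have v0 : v = 0 by rewrite -(const_field_om y v) w0 /const_field linear0.
    by rewrite -vE v0 (linP0 (dirderP (smooth_at_transition uy))).
  have H2 := near_to_chart cu H.
  by apply: filterS2 H2 (near_chart_inv cu) => t + [_ tE]; rewrite tE.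
move: (chart_field u (const_field X)) (form_mx u) sA mxE' inj => w A.
move: A X; rewrite -kn => A X' sA wA inj.
apply: (smooth_near_solve (A := A) sA _ wA).
apply: filterS inj => t inj; rewrite -row_free_unit -kermx_eq0.
apply/eqP/row_matrixP => i; rewrite row0; apply: inj.
by rewrite -row_mul mulmx_ker row0.
Qed.

End Coframe.

(** * The curvature of a coframe with values in a Lie algebra *)
Section CoframeCurvature.
#[local] Opaque derive.
Context {R : realType} {k n : nat}.
Variable G : lie_group R n.
Variable N : manifold R k.
Variable om : N -> 'Hom('rV[R]_k, 'rV[R]_n).
Hypothesis om_smooth : smooth_form om.
Hypothesis om_bij : forall u, bijective (om u).
Local Notation g := 'rV[R]_n.
Implicit Types (u v : N) (X Y Z : g).
Local Notation "X ~~" := (const_field om X) (at level 2, format "X ~~").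

Lemma chart_const_field_sum u : \forall t \near chart u u, forall X,
  chart_field u X~~ t = \sum_i X 0 i *: chart_field u (const_field om (delta_mx 0 i)) t.
Proof.
have cu := mf_dom_center u.
have H : \forall y \near u, forall X, chart_field u X~~ (chart u y) =
    \sum_i X 0 i *: chart_field u (const_field om (delta_mx 0 i)) (chart u y).
  have := near_dom cu; apply: filterS => y uy X.
  have lin : linear (fun X => dirder (chart u) y (const_field om X y)).
    by move=> a A B; rewrite const_field_linear (dirderP (smooth_at_transition uy)).
  rewrite (chart_fieldE _ uy) {1}(row_sum_delta X) (linP_sum lin).
  by apply: eq_bigr => i _; rewrite (linPZ lin) (chart_fieldE _ uy).
have H2 := near_to_chart cu H.
by apply: filterS2 H2 (near_chart_inv cu) => t + [_ tE]; rewrite tE.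
Qed.

Lemma smooth_chart_const_field X u : smooth_near (chart_field u X~~) (chart u u).
Proof. exact: smooth_const_field. Qed.

Section MovingField.
Context {E : normedModType R} {fE : fin_coord E}.
Variables (u : N) (phi : E -> 'rV[R]_k) (b : E -> g) (s0 : E).
Hypothesis sphi : smooth_near phi s0.
Hypothesis sb : smooth_near b s0.
Hypothesis phi0 : phi s0 = chart u u.

Lemma near_moving : \forall s \near s0, forall X,
  chart_field u X~~ (phi s) = \sum_i X 0 i *: chart_field u (const_field om (delta_mx 0 i)) (phi s).
Proof.
have H := chart_const_field_sum u.
have c := smooth_near_continuous sphi; rewrite /prop_for /continuous_at phi0 in c.
exact: (c _ H).
Qed.

(** Product rule for [s |-> b(s)~ (phi s)], where both the element of the Lie algebra and the
point move. *)
Lemma derive_moving A :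
  'D_A (fun s => chart_field u (b s)~~ (phi s)) s0 =
  'D_('D_A phi s0) (chart_field u (b s0)~~) (chart u u) + const_field om ('D_A b s0) u.
Proof.
(* expand [b s] in a basis, so that only finitely many fixed fields occur *)
pose e i := chart_field u (const_field om (delta_mx 0 i)).
have se i : smooth_near (e i) (phi s0) by rewrite phi0; exact: smooth_chart_const_field.
have sep i : smooth_near (fun s => e i (phi s)) s0 by exact (smooth_near_comp sphi (se i)).
have sbi i := smooth_near_entry i sb.
have s i : smooth_near (fun s => b s 0 i *: e i (phi s)) s0.
  by apply: smooth_nearZ; [exact: sbi|exact: sep].
have E1 : 'D_A (fun s => chart_field u (b s)~~ (phi s)) s0 =
    'D_A (\sum_i (fun s => b s 0 i *: e i (phi s))) s0.
  apply: near_eq_derive; have := near_moving; apply: filterS => t /(_ (b t)) ->.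
  by rewrite fct_sumE.
have E2 : 'D_A (\sum_i (fun s => b s 0 i *: e i (phi s))) s0 =
    \sum_i 'D_A (fun s => b s 0 i *: e i (phi s)) s0.
  have d i : derivable (fun s => b s 0 i *: e i (phi s)) s0 A by exact (smooth_near_derivable (s i)).
  exact (derive_sum d).
have E3 i : 'D_A (fun s => b s 0 i *: e i (phi s)) s0 =
   b s0 0 i *: 'D_('D_A phi s0) (e i) (chart u u) + 'D_A b s0 0 i *: e i (chart u u).
  have D1 : 'D_A (fun s => b s 0 i *: e i (phi s)) s0 =
     b s0 0 i *: 'D_A (fun s => e i (phi s)) s0 + 'D_A (fun s => b s 0 i) s0 *: e i (phi s0).
    exact (deriveZ_fun A (sbi i) (sep i)).
  have D2 : 'D_A (fun s => e i (phi s)) s0 = 'D_('D_A phi s0) (e i) (phi s0).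
    apply: derive_comp; first exact (smooth_near_differentiable sphi).
    exact (smooth_near_differentiable (se i)).
  have D3 : 'D_A (fun s => b s 0 i) s0 = 'D_A b s0 0 i by exact: derive_entry.
  have D4 := congr1 ('D_('D_A phi s0) (e i)) phi0.
  have arith (p q : 'rV[R]_k) (a a' : R) (q' w w' : 'rV[R]_k) :
    p = b s0 0 i *: q + a *: w -> q = q' -> a = a' -> w = w' -> p = b s0 0 i *: q' + a' *: w'.
    by move=> -> -> -> ->.
  exact (arith _ _ _ _ _ _ _ D1 (etrans D2 D4) D3 (congr1 (e i) phi0)).
have E4 : 'D_('D_A phi s0) (chart_field u (b s0)~~) (chart u u) =
    \sum_i b s0 0 i *: 'D_('D_A phi s0) (e i) (chart u u).
  have F1 : 'D_('D_A phi s0) (chart_field u (b s0)~~) (chart u u) =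
      'D_('D_A phi s0) (\sum_i (fun t => scale_linear (e i t) (b s0 0 i))) (chart u u).
    apply: near_eq_derive; have := chart_const_field_sum u; apply: filterS => t /(_ (b s0)) ->.
    by rewrite fct_sumE.
  have se0 i : derivable (e i) (chart u u) ('D_A phi s0).
    by apply: smooth_near_derivable; rewrite -phi0.
  rewrite F1 derive_sum; last first.
    by move=> i; exact: derivableZ (se0 i).
  by apply: eq_bigr => i _; exact: deriveZ (se0 i).
rewrite E1 E2 (eq_bigr _ (fun i _ => E3 i)) big_split /= -E4; congr (_ + _).
have H := nbhs_singleton (chart_const_field_sum u).
by rewrite -(chart_field_center u (const_field om ('D_A b s0))) H.
Qed.

End MovingField.

(** Leibniz rule for the bracket with a combination of constant fields with variable
coefficients. *)
Lemma bracket_moving_field (c : N -> g) Z u : smooth_at c u ->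
  om u (field_bracket (fun v => const_field om (c v) v) Z~~ u) =
  om u (field_bracket (c u)~~ Z~~ u) - dirder c u (Z~~ u).
Proof.
move=> sc; have cu := mf_dom_center u.
have D := @derive_moving 'rV[R]_k (fin_coord_rV k) u id (fun t => c (chart_inv u t)) (chart u u)
  (smooth_near_id _) sc erefl (Z~~ u).
rewrite derive_id (mf_chartK cu) in D.
have D' : 'D_(Z~~ u) (chart_field u (fun v => const_field om (c v) v)) (chart u u) =
   'D_(Z~~ u) (chart_field u (c u)~~) (chart u u) + const_field om (dirder c u (Z~~ u)) u := D.
have arith p q w : om u (p - (q + const_field om w u)) = om u (p - q) - w.
  by rewrite opprD addrA linearB /= (om_const_field om_bij).
have E V : field_bracket V Z~~ u = 'D_(V u) (chart_field u Z~~) (chart u u) -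
    'D_(Z~~ u) (chart_field u V) (chart u u).
  by rewrite field_bracketE /coord_bracket !chart_field_center.
refine (etrans (congr1 (om u) (etrans (E _) (congr1 (fun w => _ - w) D'))) _).
exact (etrans (arith _ _ _) (congr1 (fun w => om u w - _) (esym (E (c u)~~)))).
Qed.

(** The curvature on constant fields, for all [X] and [Y] in the Lie algebra rather than only in
a complement of the vertical directions: the Bianchi identity inserts values of the curvature
into the curvature. *)
Definition full_curv u X Y : g := lie G X Y - om u (field_bracket X~~ Y~~ u).

Lemma om_bracket u X Y : om u (field_bracket X~~ Y~~ u) = lie G X Y - full_curv u X Y.
Proof. by rewrite /full_curv subKr. Qed.

Lemma full_curvC u X Y : full_curv u X Y = - full_curv u Y X.
Proof.
have E : field_bracket X~~ Y~~ u = - field_bracket Y~~ X~~ u.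
  by rewrite /field_bracket; exact (esym (opprB _ _)).
have arith (p p' : g) q q' : p = - p' -> q = - q' -> p - om u q = - (p' - om u q').
  by move=> -> ->; rewrite linearN opprB opprK addrC.
exact: (arith _ _ _ _ (lieC G X Y) E).
Qed.

Lemma full_curv_linear u X : linear (full_curv u X).
Proof.
move=> a Y Z.
have arith (V : lmodType R) (p q p' q' : V) : (a *: p + q) - (a *: p' + q') = a *: (p - p') + (q - q').
  by rewrite scalerBr opprD addrACA.
have H : field_bracket X~~ (const_field om (a *: Y + Z)) u =
    a *: field_bracket X~~ Y~~ u + field_bracket X~~ Z~~ u.
  rewrite !field_bracketE /coord_bracket !chart_field_center const_field_linear.
  have sX : differentiable (chart_field u X~~) (chart u u).
    exact (smooth_near_differentiable (smooth_chart_const_field X u)).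
  have D1 := derive_dirP a (Y~~ u) (Z~~ u) sX.
  have D2 : 'D_(X~~ u) (chart_field u (const_field om (a *: Y + Z))) (chart u u) =
     a *: 'D_(X~~ u) (chart_field u Y~~) (chart u u) + 'D_(X~~ u) (chart_field u Z~~) (chart u u).
    have dY := smooth_near_derivable (v := X~~ u) (smooth_chart_const_field Y u).
    have dZ := smooth_near_derivable (v := X~~ u) (smooth_chart_const_field Z u).
    have E1 : 'D_(X~~ u) (chart_field u (const_field om (a *: Y + Z))) (chart u u) =
        'D_(X~~ u) (a \*: chart_field u Y~~ + chart_field u Z~~) (chart u u).
      apply: near_eq_derive; have := chart_const_field_sum u; apply: filterS => t Ht.
      rewrite -[RHS]/(a *: chart_field u Y~~ t + chart_field u Z~~ t) !Ht scaler_sumr -big_split.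
      by apply: eq_bigr => i _; rewrite !mxE scalerDl scalerA.
    have dZY : derivable (a \*: chart_field u Y~~) (chart u u) (X~~ u) by apply: derivableZ; exact dY.
    refine (etrans E1 (etrans (deriveD dZY dZ) (congr1 (fun w => w + _) _))).
    by apply: deriveZ; exact dY.
  refine (etrans (congr2 (fun p q : 'rV[R]_k => p - q) D2 D1) _).
  exact: arith.
by rewrite /full_curv H linearP /= (lie_linear G X a Y Z); exact: arith.
Qed.

Lemma smooth_full_curv X Y u : smooth_at (fun v => full_curv v X Y) u.
Proof.
have s := om_smooth (smooth_field_bracket (smooth_const_field om_smooth om_bij X u)
  (smooth_const_field om_smooth om_bij Y u)).
have cN : continuous (-%R : {linear g -> g}) by move=> y; exact: opp_continuous.
exact (smooth_nearD (smooth_near_cst (lie G X Y) _) (smooth_near_linear cN s)).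
Qed.

End CoframeCurvature.

(** * Antisymmetric bilinear products *)
Section Bilinear.
Context {R : realType} {n : nat}.
Local Notation g := 'rV[R]_n.
Variable br : g -> g -> g.
Hypothesis br_lin : forall A, linear (br A).
Hypothesis brC : forall A B, br A B = - br B A.
Implicit Types A B C : g.

Lemma brDr A B C : br A (B + C) = br A B + br A C.
Proof. exact: (linPD (br_lin A)). Qed.

Lemma br0r A : br A 0 = 0.
Proof. exact: (linP0 (br_lin A)). Qed.

Lemma brZr (a : R) A B : br A (a *: B) = a *: br A B.
Proof. exact: (linPZ (br_lin A)). Qed.

Lemma brNr A B : br A (- B) = - br A B.
Proof. exact: (linPN (br_lin A)). Qed.

Lemma brBr A B C : br A (B - C) = br A B - br A C.
Proof. exact: (linPB (br_lin A)). Qed.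

Lemma brDl A B C : br (A + B) C = br A C + br B C.
Proof. by rewrite brC brDr opprD -!brC. Qed.

Lemma br0l A : br 0 A = 0.
Proof. by rewrite brC br0r oppr0. Qed.

Lemma brZl (a : R) A B : br (a *: A) B = a *: br A B.
Proof. by rewrite brC brZr -scalerN -brC. Qed.

Lemma brNl A B : br (- A) B = - br A B.
Proof. by rewrite -scaleN1r brZl scaleN1r. Qed.

Lemma brBl A B C : br (A - B) C = br A C - br B C.
Proof. by rewrite brDl brNl. Qed.

Lemma br_suml (I : Type) (r : seq I) (P : pred I) (F : I -> g) B :
  br (\sum_(i <- r | P i) F i) B = \sum_(i <- r | P i) br (F i) B.
Proof. by apply: (big_morph (fun A => br A B)) => [A C|]; [exact: brDl|exact: br0l]. Qed.

Lemma br_sumr (I : Type) (r : seq I) (P : pred I) (F : I -> g) A :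
  br A (\sum_(i <- r | P i) F i) = \sum_(i <- r | P i) br A (F i).
Proof. exact: (linP_sum (br_lin A)). Qed.

End Bilinear.

(** * The Bianchi identity *)
Section Bianchi.
#[local] Opaque derive lie full_curv field_bracket.
Context {R : realType} {k n : nat}.
Variable G : lie_group R n.
Variable N : manifold R k.
Variable om : N -> 'Hom('rV[R]_k, 'rV[R]_n).
Hypothesis om_smooth : smooth_form om.
Hypothesis om_bij : forall u, bijective (om u).
Local Notation g := 'rV[R]_n.
Implicit Types (u v : N) (X Y Z : g).
Local Notation "X ~~" := (const_field om X) (at level 2, format "X ~~").
Local Notation K := (full_curv G om).

Let K_lin u := full_curv_linear G om_smooth om_bij u.
Let KC u := full_curvC G om u.

Lemma bracket_const_field X Y :
  field_bracket X~~ Y~~ = (fun v => const_field om (lie G X Y - K v X Y) v).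
Proof.
by apply/funext => v; rewrite -(om_bracket G om v X Y) (const_field_om om_bij).
Qed.

(** The difference between the double bracket in the Lie algebra and the one of constant
fields. *)
Definition bianchi_term u X Y Z : g :=
  K u (lie G X Y) Z + lie G (K u X Y) Z - K u (K u X Y) Z
  - dirder (fun v => K v X Y) u (Z~~ u).

(** [[X~, Y~]] is the field of the moving element [[X, Y] - K(X, Y)], so the outer bracket is
given by [bracket_moving_field]; the derivative of [K] enters there. *)
Lemma double_bracket u X Y Z :
  om u (field_bracket (field_bracket X~~ Y~~) Z~~ u) =
  lie G (lie G X Y) Z - bianchi_term u X Y Z.
Proof.
have sK := smooth_full_curv G om_smooth om_bij X Y u.
have cN : continuous (-%R : {linear g -> g}) by move=> y; exact: opp_continuous.
have sNK : smooth_near (fun t => - K (chart_inv u t) X Y) (chart u u).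
  exact (smooth_near_linear cN sK).
have sc : smooth_at (fun v => lie G X Y - K v X Y) u.
  exact (smooth_nearD (smooth_near_cst (lie G X Y) _) sNK).
have D : dirder (fun v => lie G X Y - K v X Y) u (Z~~ u) = - dirder (fun v => K v X Y) u (Z~~ u).
  have d1 : derivable (fun _ : 'rV[R]_k => lie G X Y) (chart u u) (Z~~ u) by exact: derivable_cst.
  rewrite /dirder.
  have E1 := deriveB d1 (smooth_near_derivable (v := Z~~ u) sK).
  refine (etrans E1 _).
  by rewrite derive_cst sub0r.
rewrite bracket_const_field (bracket_moving_field om_smooth om_bij _ sc) D opprK.
rewrite (om_bracket G) /bianchi_term.
have E1 := brBl (lie_linear G) (lieC G) (lie G X Y) (K u X Y) Z.
have E2 := brBl (K_lin u) (KC u) (lie G X Y) (K u X Y) Z.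
have arith (p p' a b c d e : g) : p = a - b -> p' = c - d ->
    p - p' + e = a - (c + b - d - e).
  by move=> -> ->; apply/rowP => i; rewrite !mxE; ring.
exact: arith E1 E2.
Qed.

(** The Jacobi identities of vector fields and of the Lie algebra, subtracted. *)
Lemma bianchi u X Y Z :
  bianchi_term u X Y Z + bianchi_term u Y Z X + bianchi_term u Z X Y = 0.
Proof.
have J := field_jacobi (smooth_const_field om_smooth om_bij X u)
  (smooth_const_field om_smooth om_bij Y u) (smooth_const_field om_smooth om_bij Z u).
have E a b c : om u (a + b + c) = om u a + om u b + om u c by rewrite !linearD.
have J2 := etrans (esym (E _ _ _)) (etrans (congr1 (om u) J) (linear0 _)).
have JL := lie_jacobi G X Y Z.
have arith (a b c a' b' c' p q r : g) : a + b + c = 0 -> p + q + r = 0 ->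
    p = a - a' -> q = b - b' -> r = c - c' -> a' + b' + c' = 0.
  move=> abc H pE qE rE; have : a + b + c - (a' + b' + c') = 0.
    by rewrite -H pE qE rE; apply/rowP => i; rewrite !mxE; ring.
  by rewrite abc sub0r => /eqP; rewrite oppr_eq0 => /eqP.
exact: arith JL J2 (double_bracket u X Y Z) (double_bracket u Y Z X) (double_bracket u Z X Y).
Qed.

End Bianchi.

(** * The derivative of the inversion of a Lie group *)
Section InverseDerivative.
#[local] Opaque derive.
Context {R : realType}.
Implicit Types E F H : normedModType R.

Lemma derive_pair E F H (f : E -> F) (h : E -> H) x v :
  differentiable f x -> differentiable h x ->
  'D_v (fun t => (f t, h t)) x = ('D_v f x, 'D_v h x).
Proof.
move=> df dh; rewrite (deriveE _ df) (deriveE _ dh) deriveE; last exact: differentiable_pair.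
by rewrite diff_pair.
Qed.

Lemma derive_partialD E F H (M : E * F -> H) p v w : differentiable M p ->
  'D_(v, w) M p = 'D_(v, 0) M p + 'D_(0, w) M p.
Proof.
move=> dM; rewrite -derive_dirD //.
suff -> : (v, w) = (v, 0) + (0, w) by [].
by congr (_, _); rewrite /= ?addr0 ?add0r.
Qed.

Context {n : nat}.
Variable G : lie_group R n.
Local Notation g := 'rV[R]_n.
Local Notation one := (lg_one G).
Local Notation e0 := (chart one one).

Lemma derive_mul_rep2 (w : g) : 'D_(0, w) (mul_rep one) (e0, e0) = w.
Proof.
rewrite -derive_partial2 (near_eq_derive (g := id)) ?derive_id //.
have := near_chart_inv (mf_dom_center one).
by apply: filterS => t [_ tE]; rewrite mul_repE /= inv1K lg_mul1.
Qed.

(** Differentiate [x x^-1 = 1] at the unit, where both partial derivatives of the multiplication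
are the identity. *)
Lemma tmap_inv1 (A : g) : tmap (@lg_inv R n G) one A = - A.
Proof.
have E0 : tmap (@lg_inv R n G) one A = 'D_A (@inv_rep R n G) e0.
  by rewrite /tmap /dirder lg_inv1.
have si := smooth_inv_rep G.
have sM := smooth_mul_rep one.
have di : differentiable (@inv_rep R n G) e0 by exact (smooth_near_differentiable si).
have dM : differentiable (mul_rep one) (e0, e0) by exact (smooth_near_differentiable sM).
have dM' : differentiable (mul_rep one) (e0, @inv_rep R n G e0) by rewrite inv_rep0.
have dp : differentiable (fun t => (t, @inv_rep R n G t)) e0.
  exact: differentiable_pair.
have E1 : 'D_A (fun t => mul_rep one (t, @inv_rep R n G t)) e0 = 0.
  rewrite (near_eq_derive (g := fun=> e0)) ?derive_cst //.
  have := near_inv1_inv G; apply: filterS => t tE.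
  by rewrite mul_repE /= tE lg_mulVr.
have E2 := derive_comp A dp dM'.
have E3 : 'D_A (fun t => (t, @inv_rep R n G t)) e0 = (A, 'D_A (@inv_rep R n G) e0).
  have did : differentiable (id : g -> g) e0 by [].
  by refine (etrans (derive_pair A did di) _); rewrite derive_id.
rewrite E3 inv_rep0 (derive_partialD _ _ dM) derive_mul_rep1 derive_mul_rep2 E1 in E2.
by rewrite E0; apply/eqP; rewrite -addr_eq0 addrC; apply/eqP/esym.
Qed.

End InverseDerivative.

(** * Equivariance and horizontality of the curvature *)
Section PrincipalConnection.
#[local] Opaque derive.
Context {R : realType} {n : nat}.
Variable G : lie_group R n.
Variables (gr : int -> {vspace 'rV[R]_n}) (m : nat).
Variables (P : filtration_subgroup G gr m) (d k : nat) (M : manifold R d).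
Variable Q : principal_bundle k P M.
Local Notation g := 'rV[R]_n.
Variable om : Q -> 'Hom('rV[R]_k, g).
Hypothesis ccom : cartan_connection om.
Implicit Types (u v : Q) (p : P) (X Y : g).
Local Notation "X ~~" := (const_field om X) (at level 2, format "X ~~").
Local Notation K := (full_curv G om).
Local Notation incl := (fs_incl (f := P)).

Let oms := cc_smooth ccom.
Let omb := cc_iso ccom.

Lemma incl1 : incl (lg_one P) = lg_one G.
Proof.
have H : lg_mul (incl (lg_one P)) (incl (lg_one P)) = incl (lg_one P).
  by rewrite -fs_mul lg_mul1.
by rewrite -(lg_mulV (incl (lg_one P))) -{3}H lg_mulA lg_mulV lg_mul1.
Qed.

Lemma inclV p : incl (lg_inv p) = lg_inv (incl p).
Proof. by apply: lg_inv_unique; rewrite -fs_mul lg_mulVr incl1. Qed.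

Lemma smooth_ract u p : smooth_map (fun w : Q => pb_act w p) u.
Proof. exact: smooth_map2_left (pb_act_smooth u p). Qed.

Lemma smooth_lact u p : smooth_map (pb_act u) p.
Proof. exact: smooth_map2_right (pb_act_smooth u p). Qed.

Lemma tmap_ract u p X : tmap (fun w : Q => pb_act w p) u (X~~ u) =
  const_field om (Ad (incl (lg_inv p)) X) (pb_act u p).
Proof.
rewrite -[LHS](const_field_om omb (pb_act u p)) (cc_equivariant ccom).
by rewrite (om_const_field omb).
Qed.

(** The right translation by [p] relates [X~] to the constant field of [Ad(p^-1) X]. *)
Lemma full_curv_equivariant u p X Y : let q := incl (lg_inv p) in
  K (pb_act u p) (Ad q X) (Ad q Y) = Ad q (K u X Y).
Proof.
move=> q; have H X' : \forall w \near u, tmap (fun w : Q => pb_act w p) w (X'~~ w) =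
    const_field om (Ad q X') (pb_act w p).
  by near=> w; exact: tmap_ract.
have TB := tmap_bracket (F := fun w : Q => pb_act w p) (x := u) (smooth_ract ^~ p)
  (smooth_const_field oms omb X u) (smooth_const_field oms omb Y u)
  (smooth_const_field oms omb (Ad q X) (pb_act u p)) (smooth_const_field oms omb (Ad q Y) (pb_act u p))
  (H X) (H Y).
have E1 := congr1 (om (pb_act u p)) TB.
rewrite (cc_equivariant ccom) -/q in E1.
have E2 := tmapB (lie G X Y) (om u (field_bracket X~~ Y~~ u)) (smooth_lg_conj q (lg_one G)).
have E3 := Ad_lie q X Y.
have arith (a b c a' b' : g) : a' = a -> b = b' -> c = a - b -> a' - b' = c.
  by move=> -> -> ->.
exact: (arith _ _ _ _ _ (esym E3) E1 E2).
Unshelve. all: by end_near. Qed.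

Local Notation e0 := (chart (lg_one P) (lg_one P)).

Definition Ad_inv Y p : g := Ad (incl (lg_inv p)) Y.

Lemma incl_inv1 : incl (lg_inv (lg_one P)) = lg_one G.
Proof. by rewrite lg_inv1 incl1. Qed.

Lemma smooth_incl_inv p : smooth_map (fun p : P => incl (lg_inv p)) p.
Proof. by apply: (smooth_map_comp (G := incl)); [exact: lg_inv_smooth|exact: fs_smooth]. Qed.

Lemma smooth_Ad_inv Y : smooth_at (Ad_inv Y) (lg_one P).
Proof.
have s : smooth_at (fun x => Ad x Y) (incl (lg_inv (lg_one P))).
  by rewrite incl_inv1; exact: smooth_at_Ad.
exact: (smooth_at_comp (smooth_incl_inv (lg_one P)) s).
Qed.

Lemma Ad_inv1 Y : Ad_inv Y (lg_one P) = Y.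
Proof. by rewrite /Ad_inv incl_inv1 Ad1. Qed.

Lemma dirder_Ad_inv Y A :
  dirder (Ad_inv Y) (lg_one P) A = - lie G (tmap incl (lg_one P) A) Y.
Proof.
have s : smooth_at (fun x => Ad x Y) (incl (lg_inv (lg_one P))).
  by rewrite incl_inv1; exact: smooth_at_Ad.
have E1 := dirder_tmap A (smooth_incl_inv (lg_one P)) s.
have E2 := tmap_comp_at A (lg_inv1 P) (lg_inv_smooth (lg_one P)) (fs_smooth (lg_one P)).
rewrite tmap_inv1 in E2.
have E3 : tmap incl (lg_one P) (- A) = - tmap incl (lg_one P) A.
  exact: (linPN (tmapP (fs_smooth (lg_one P)))).
rewrite E2 E3 incl_inv1 dirder_Ad in E1.
by rewrite -[LHS]E1 (brNl (lie_linear G) (lieC G)).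
Qed.

Section Horizontal.
Variables (u : Q) (A : 'rV[R]_m) (Y : g).
Let X := tmap incl (lg_one P) A.
(** The action near [(u, 1)]; its partial derivatives are the fundamental fields and the tangent
maps of right translations. *)
Definition act_rep := local_rep (@pb_act R m d k P M Q) u (lg_one P).
Let t0 := chart u u.
Let cu := mf_dom_center u.
Let c1 := mf_dom_center (lg_one P).

Lemma act_repE q : act_rep q = chart u (pb_act (chart_inv u q.1) (chart_inv (lg_one P) q.2)).
Proof. by rewrite /act_rep /local_rep pb_act1. Qed.

Lemma smooth_act_rep : smooth_near act_rep (t0, e0).
Proof. exact: smooth_local_rep (pb_act_smooth u (lg_one P)). Qed.

Lemma act_rep0 : act_rep (t0, e0) = t0.
Proof. by rewrite act_repE /= (mf_chartK cu) (mf_chartK c1) pb_act1. Qed.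

Lemma fundamental_field v : X~~ v = tmap (pb_act v) (lg_one P) A.
Proof. by rewrite -[RHS](const_field_om omb v) (cc_fundamental ccom). Qed.

Lemma near_chart_fundamental :
  \forall t \near t0, chart_field u X~~ t = 'D_(0, A) act_rep (t, e0).
Proof.
have H : \forall y \near u, chart_field u X~~ (chart u y) = 'D_(0, A) act_rep (chart u y, e0).
  apply: filterS (near_dom cu) => y uy; rewrite (chart_fieldE _ uy) fundamental_field.
  have := @tmap_local_rep2 _ _ _ _ _ _ _ (@pb_act R m d k P M Q) u (lg_one P) y A uy.
  rewrite !pb_act1; apply => //; exact: smooth_lact.
have H2 := near_to_chart cu H.
by apply: filterS2 H2 (near_chart_inv cu) => t + [_ tE]; rewrite tE.
Qed.

(** Equivariance of [om], read in the chart: moving [Y~(u)] by [p] gives the field of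
[Ad(p^-1) Y] at [u p]. *)
Lemma near_ract_rep : \forall s \near e0,
  'D_(Y~~ u, 0) act_rep (t0, s) =
  chart_field u (const_field om (Ad_inv Y (chart_inv (lg_one P) s))) (act_rep (t0, s)).
Proof.
have H0 : \forall p \near lg_one P, chart_dom u (pb_act u p).
  have [ca _] := smooth_lact u (lg_one P).
  by apply: (near_map_dom ca); rewrite pb_act1; exact: near_dom.
have H : \forall p \near lg_one P, 'D_(Y~~ u, 0) act_rep (t0, chart (lg_one P) p) =
  chart_field u (const_field om (Ad_inv Y p)) (act_rep (t0, chart (lg_one P) p)).
  apply: filterS2 (near_dom c1) H0 => p p1 up.
  have := @tmap_local_rep1 _ _ _ _ _ _ _ (@pb_act R m d k P M Q) u (lg_one P) p (Y~~ u) p1.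
  rewrite !pb_act1 => /(_ up (smooth_ract u p)) <-.
  rewrite act_repE /= (mf_chartK cu) (mf_chartK p1) (chart_fieldE _ up).
  by rewrite tmap_ract.
have H2 := near_to_chart c1 H.
by apply: filterS2 H2 (near_chart_inv c1) => s + [_ sE]; rewrite sE.
Qed.

(** Both terms of the bracket are mixed second derivatives of the action.  One comes from the
fundamental field of [X] differentiated along [Y~]; the other from [near_ract_rep]
differentiated at [p = 1], where [derive_moving] produces the additional term
[- [X, Y]]. *)
Lemma bracket_fundamental : field_bracket X~~ Y~~ u = const_field om (lie G X Y) u.
Proof.
have sN := smooth_act_rep.
have sphi : smooth_near (fun s => act_rep (t0, s)) e0.
  have sp : smooth_near (fun s : 'rV[R]_m => (t0, s)) e0.
    by apply: smooth_near_pair; [exact: smooth_near_cst|exact: smooth_near_id].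
  exact (smooth_near_comp sp sN).
have sb : smooth_near (fun s => Ad_inv Y (chart_inv (lg_one P) s)) e0.
  exact: smooth_Ad_inv.
have DM : 'D_A (fun s => chart_field u (const_field om (Ad_inv Y (chart_inv (lg_one P) s))) (act_rep (t0, s))) e0 =
    'D_('D_A (fun s => act_rep (t0, s)) e0) (chart_field u (const_field om (Ad_inv Y (chart_inv (lg_one P) e0)))) t0
     + const_field om ('D_A (fun s => Ad_inv Y (chart_inv (lg_one P) s)) e0) u.
  exact (derive_moving oms omb sphi sb act_rep0 A).
have D1 : 'D_A (fun s => act_rep (t0, s)) e0 = X~~ u.
  rewrite derive_partial2 -(nbhs_singleton near_chart_fundamental).
  exact: chart_field_center.
have D2 : 'D_A (fun s => Ad_inv Y (chart_inv (lg_one P) s)) e0 = - lie G X Y.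
  exact: dirder_Ad_inv.
rewrite D1 D2 (mf_chartK c1) Ad_inv1 in DM.
have D3 : 'D_A (fun s => 'D_(Y~~ u, 0) act_rep (t0, s)) e0 = 'D_(0, A) ('D_(Y~~ u, 0) act_rep) (t0, e0).
  exact: (derive_partial2 ('D_(Y~~ u, 0) act_rep)).
have D4 := near_eq_derive A near_ract_rep.
have D5 : 'D_(Y~~ u) (chart_field u X~~) t0 = 'D_(Y~~ u) (fun t => 'D_(0, A) act_rep (t, e0)) t0.
  exact: near_eq_derive near_chart_fundamental.
have D6 : 'D_(Y~~ u) (fun t => 'D_(0, A) act_rep (t, e0)) t0 = 'D_(Y~~ u, 0) ('D_(0, A) act_rep) (t0, e0).
  exact: (derive_partial1 ('D_(0, A) act_rep)).
have D7 : 'D_(Y~~ u, 0) ('D_(0, A) act_rep) (t0, e0) = 'D_(0, A) ('D_(Y~~ u, 0) act_rep) (t0, e0).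
  exact (derive_comm (Y~~ u, 0) (0, A) sN).
have D8 := etrans D5 (etrans D6 (etrans D7 (etrans (esym D3) (etrans D4 DM)))).
rewrite field_bracketE /coord_bracket !chart_field_center.
have arith (p q : 'rV[R]_k) : q = p + const_field om (- lie G X Y) u -> p - q = const_field om (lie G X Y) u.
  by move=> ->; rewrite opprD addrA subrr sub0r /const_field linearN opprK.
exact: arith D8.
Qed.

Lemma full_curv_fundamental : K u X Y = 0.
Proof. by rewrite /full_curv bracket_fundamental (om_const_field omb) subrr. Qed.

End Horizontal.

Lemma full_curv_horizontal u X Y : X \in filt gr 0 -> K u X Y = 0.
Proof. by move=> /(fs_lie P)[A <-]; exact: full_curv_fundamental. Qed.

End PrincipalConnection.

(** * Gradings and homogeneous components *)

(** The part of [two_grading] that does not mention a bracket; the bracket is a variable in the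
algebra below, where comparing terms must not unfold brackets of vector fields. *)
Record grading (R : realType) (n : nat) (gr : int -> {vspace 'rV[R]_n}) : Prop := Grading {
  gr_range : forall i : int, 2 < `|i| -> gr i = 0%VS;
  gr_full : (\sum_(j < 5) gr (j%:Z - 2))%VS = fullv;
  gr_direct : directv (\sum_(j < 5) gr (j%:Z - 2))%VS
}.

Section Grading.
Context {R : realType} {n : nat}.
Local Notation g := 'rV[R]_n.
Variable gr : int -> {vspace g}.
Implicit Types (X Y : g) (i j k : int).
Local Notation gp := (grpart gr).

Let ip (a : 'I_5) : int := a%:Z - 2.
Local Notation pr a := (sumv_pi_for (erefl (\sum_(j < 5) gr (j%:Z - 2))%VS) a).

Lemma ip_inj : injective ip.
Proof. by move=> a b /addIr[] /ord_inj. Qed.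

Lemma grpart_ip a X : gp (ip a) X = pr a X.
Proof.
by apply: big_pred1 => b; exact: (inj_eq ip_inj b a).
Qed.

Lemma grpart_out k X : 2 < `|k| -> gp k X = 0.
Proof.
move=> k2; rewrite /grpart big1 // => a /eqP ak; move: k2; rewrite -ak.
by case: a {ak} => [[|[|[|[|[|]]]]]].
Qed.

Lemma int_cases k : (exists a, k = ip a) \/ 2 < `|k|.
Proof.
have [k2|] := leP `|k| 2; last by right.
left; have k0 : 0 <= k + 2 by lia.
have k5 : (absz (k + 2)%R < 5)%N by lia.
by exists (Ordinal k5); rewrite /ip /=; lia.
Qed.

Lemma grpart_linear k : linear (gp k).
Proof.
move=> a X Y; rewrite /grpart scaler_sumr -big_split; apply: eq_bigr => b _.
by rewrite linearP.
Qed.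

Lemma grpart0 k : gp k 0 = 0.
Proof. exact: (linP0 (grpart_linear k)). Qed.

Lemma grpartD k X Y : gp k (X + Y) = gp k X + gp k Y.
Proof. exact: (linPD (grpart_linear k)). Qed.

Lemma grpartZ k (a : R) X : gp k (a *: X) = a *: gp k X.
Proof. exact: (linPZ (grpart_linear k)). Qed.

Lemma grpartN k X : gp k (- X) = - gp k X.
Proof. exact: (linPN (grpart_linear k)). Qed.

Lemma grpart_bigsum k (I : Type) (r : seq I) (P : pred I) (F : I -> g) :
  gp k (\sum_(i <- r | P i) F i) = \sum_(i <- r | P i) gp k (F i).
Proof. exact: (linP_sum (grpart_linear k)). Qed.

Lemma mem_grpart k X : gp k X \in gr k.
Proof.
have [[a ->]|k2] := int_cases k; last by rewrite grpart_out // mem0v.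
by rewrite grpart_ip; exact: memv_sum_pi.
Qed.

Hypothesis grd : grading gr.

Lemma grpart_sum X : X = \sum_(a < 5) gp (ip a) X.
Proof.
rewrite (eq_bigr (fun a => pr a X)); last by move=> a _; exact: grpart_ip.
by rewrite sumv_pi_sum // (gr_full grd) memvf.
Qed.

Lemma grpart_gr j k X : X \in gr k -> gp j X = if j == k then X else 0.
Proof.
have [[b ->]|k2] := int_cases k; last first.
  rewrite (gr_range grd) // memv0 => /eqP ->.
  by rewrite grpart0 if_same.
move=> Xb.
have [[a ->]|j2] := int_cases j; last first.
  rewrite grpart_out //; case: eqP => // jb; move: j2; rewrite jb.
  by case: b {Xb jb} => [[|[|[|[|[|]]]]]].
have /directv_sum_independent H := gr_direct grd.
rewrite grpart_ip (inj_eq ip_inj); apply/eqP; rewrite -subr_eq0; apply/eqP.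
apply: (H (fun a => pr a X - (if a == b then X else 0))) => // [c _|].
  by rewrite memvB ?memv_sum_pi //; case: eqP => [->|_] //; exact: mem0v.
rewrite sumrB sumv_pi_sum ?(gr_full grd) ?memvf //.
by rewrite -big_mkcond big_pred1_eq subrr.
Qed.

End Grading.

(** * Graded brackets and the Killing form *)
Section GradedBracket.
Context {R : realType} {n : nat}.
Local Notation g := 'rV[R]_n.
Variable gr : int -> {vspace g}.
Hypothesis grd : grading gr.
Implicit Types (X Y W : g) (i j k a b : int).
Local Notation gp := (grpart gr).
Local Notation gm := (subvs_of (gneg gr)).
Local Notation tn := (toneg gr).

Lemma grpart_grpart j k X : gp j (gp k X) = if j == k then gp k X else 0.
Proof. by apply: grpart_gr => //; exact: mem_grpart. Qed.

Lemma grpart_id k X : gp k (gp k X) = gp k X.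
Proof. by rewrite grpart_grpart eqxx. Qed.

Lemma grpart_ne j k X : j != k -> gp j (gp k X) = 0.
Proof. by rewrite grpart_grpart => /negbTE ->. Qed.

Definition negpart X : g := gp (- 2) X + gp (- 1) X.

Lemma negpart_in X : negpart X \in gneg gr.
Proof. by apply: memv_add; exact: mem_grpart. Qed.

Lemma val_toneg X : vsval (tn X) = negpart X.
Proof. by rewrite /toneg vsprojK //; exact: negpart_in. Qed.

Lemma toneg_val (x : gm) : tn (vsval x) = x.
Proof.
apply: val_inj; rewrite /= val_toneg.
have /memv_addP[X X2 [Y Y1 ->]] := subvsP x.
rewrite /negpart !grpartD (grpart_gr grd _ X2) (grpart_gr grd _ Y1).
by rewrite (grpart_gr grd _ X2) (grpart_gr grd _ Y1) /= addr0 add0r.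
Qed.

Lemma toneg_linear : linear tn.
Proof.
move=> c X Y; rewrite /toneg -linearP; congr (vsproj _ _).
by rewrite !grpart_linear scalerDr addrACA.
Qed.

Lemma toneg0 : tn 0 = 0.
Proof. exact: (linP0 toneg_linear). Qed.

Lemma tonegD X Y : tn (X + Y) = tn X + tn Y.
Proof. exact: (linPD toneg_linear). Qed.

Lemma toneg_out k X : k != - 2 -> k != - 1 -> tn (gp k X) = 0.
Proof.
move=> k2 k1; apply: val_inj; rewrite /= val_toneg /negpart.
by rewrite !grpart_ne 1?eq_sym // addr0.
Qed.

Lemma toneg_negpart X : tn (negpart X) = tn X.
Proof. by rewrite -val_toneg toneg_val. Qed.

Lemma grpart_negpart k X : (k == - 2) || (k == - 1) -> gp k (negpart X) = gp k X.
Proof.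
rewrite /negpart grpartD !grpart_grpart.
by case/orP => /eqP ->; rewrite eqxx /= ?addr0 ?add0r.
Qed.

Lemma val_negpart (x : gm) : negpart (vsval x) = vsval x.
Proof. by rewrite -val_toneg toneg_val. Qed.

Lemma neg_decomp (x : gm) : x = tn (gp (- 2) (vsval x)) + tn (gp (- 1) (vsval x)).
Proof. by rewrite -tonegD -/(negpart _) val_negpart toneg_val. Qed.

Lemma mem_filtP s X : X \in filt gr s <-> forall k, k < s -> gp k X = 0.
Proof.
split.
  move=> /memv_sumP[f fP ->] k ks; rewrite grpart_bigsum big1 // => a sa.
  rewrite (grpart_gr grd _ (fP _ sa)).
  by case: eqP => // ka; move: sa ks; rewrite -ka; lia.
move=> H; rewrite (grpart_sum grd X) (bigID (fun a : 'I_5 => s <= a%:Z - 2)) /=.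
rewrite [X in _ + X]big1 ?addr0; last first.
  by move=> a; rewrite -ltNge => /H.
by apply: memv_sumr => a sa; exact: mem_grpart.
Qed.

Lemma sum_pos X : X \in filt gr 1 -> X = gp 1 X + gp 2 X.
Proof.
move=> /mem_filtP H; rewrite {1}(grpart_sum grd X).
rewrite !big_ord_recl big_ord0 /= addr0.
by rewrite (H (0%:Z - 2)) // (H (1%:Z - 2)) // (H (2%:Z - 2)) // !add0r.
Qed.

Variable br : g -> g -> g.
Hypothesis br_lin : forall A, linear (br A).
Hypothesis brC : forall A B, br A B = - br B A.
Hypothesis br_gr : forall i j X Y, X \in gr i -> Y \in gr j -> br X Y \in gr (i + j).

Lemma grpart_br a b X Y : X \in gr b -> gp a (br X Y) = br X (gp (a - b) Y).
Proof.
move=> Xb; rewrite {1 2}(grpart_sum grd Y) grpart_bigsum !(br_sumr br_lin) grpart_bigsum.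
apply: eq_bigr => c _.
rewrite (grpart_gr grd a (br_gr Xb (mem_grpart gr _ Y))).
rewrite grpart_grpart.
have -> : (a == b + (c%:Z - 2)) = (a - b == c%:Z - 2) by lia.
by case: ifP => // _; rewrite (br0r br_lin).
Qed.

Lemma grpart_br_part a b X Y : gp a (br (gp b X) Y) = br (gp b X) (gp (a - b) Y).
Proof. by apply: grpart_br; exact: mem_grpart. Qed.

Definition killing_form (A B : g) : R := \tr (lin1_mx (fun X => br A (br B X))).

Lemma tr_lin1 (f : g -> g) : \tr (lin1_mx f) = \sum_i f (delta_mx 0 i) 0 i.
Proof. by rewrite /mxtrace; apply: eq_bigr => i _; rewrite mxE. Qed.

Lemma tr_lin1C (f h : g -> g) : linear f -> linear h ->
  \tr (lin1_mx (fun X => f (h X))) = \tr (lin1_mx (fun X => h (f X))).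
Proof.
move=> fl hl.
pose F := lin_of fl; pose H := lin_of hl.
have E (F1 F2 : {linear g -> g}) : lin1_mx (fun X => F1 (F2 X)) = lin1_mx F2 *m lin1_mx F1.
  apply/row_matrixP => i; rewrite !rowE mulmxA [in RHS]mul_rV_lin1 [in RHS]mul_rV_lin1.
  exact: (mul_rV_lin1 (F1 \o F2)).
by rewrite (E F H) (E H F) mxtrace_mulC.
Qed.

Lemma killing_formDl A B C : killing_form (A + B) C = killing_form A C + killing_form B C.
Proof.
rewrite /killing_form !tr_lin1 -big_split; apply: eq_bigr => i _.
by rewrite (brDl br_lin brC) mxE.
Qed.

Lemma killing_formDr A B C : killing_form A (B + C) = killing_form A B + killing_form A C.
Proof.
rewrite /killing_form !tr_lin1 -big_split; apply: eq_bigr => i _.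
by rewrite (brDl br_lin brC) (brDr br_lin) mxE.
Qed.

Lemma killing_formZl (c : R) A B : killing_form (c *: A) B = c * killing_form A B.
Proof.
rewrite /killing_form !tr_lin1 mulr_sumr; apply: eq_bigr => i _.
by rewrite (brZl br_lin brC) mxE.
Qed.

Lemma killing_formZr (c : R) A B : killing_form A (c *: B) = c * killing_form A B.
Proof.
rewrite /killing_form !tr_lin1 mulr_sumr; apply: eq_bigr => i _.
by rewrite (brZl br_lin brC) (brZr br_lin) mxE.
Qed.

Lemma killing_form0l B : killing_form 0 B = 0.
Proof. by rewrite -(scale0r (0 : g)) killing_formZl mul0r. Qed.

Lemma killing_form0r B : killing_form B 0 = 0.
Proof. by rewrite -(scale0r (0 : g)) killing_formZr mul0r. Qed.

Lemma killing_form_suml (I : Type) (r : seq I) (F : I -> g) B :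
  killing_form (\sum_(i <- r) F i) B = \sum_(i <- r) killing_form (F i) B.
Proof. by apply: (big_morph (fun A => killing_form A B)) => [A C|]; [exact: killing_formDl|exact: killing_form0l]. Qed.

Lemma killing_form_sumr (I : Type) (r : seq I) (F : I -> g) A :
  killing_form A (\sum_(i <- r) F i) = \sum_(i <- r) killing_form A (F i).
Proof. by apply: (big_morph (fun B => killing_form A B)) => [B C|]; [exact: killing_formDr|exact: killing_form0r]. Qed.

(** [ad A ad B] shifts degrees by [i + j], which is not zero, so its trace vanishes. *)
Lemma killing_form_graded i j A B : A \in gr i -> B \in gr j -> i + j != 0 -> killing_form A B = 0.
Proof.
move=> Ai Bj ij0; pose f X := br A (br B X).
have fl : linear f by move=> c X Y; rewrite /f !br_lin.
pose f0 := fun a X => gp a (f (gp a X)).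
have f0E a X : f0 a X = 0.
  rewrite /f0 /f.
  have H := br_gr Ai (br_gr Bj (mem_grpart gr a X)).
  rewrite (grpart_gr grd a H).
  by case: eqP => // E; move: ij0; lia.
have E1 : killing_form A B = \sum_(c < 5) \tr (lin1_mx (fun X => f (gp (c%:Z - 2) (gp (c%:Z - 2) X)))).
  rewrite /killing_form tr_lin1 (eq_bigr _ (fun c _ => tr_lin1 _)) exchange_big; apply: eq_bigr => e _.
  rewrite -summxE {1}(grpart_sum grd (delta_mx 0 e)) (br_sumr br_lin) (br_sumr br_lin).
  by congr (fun_of_matrix _ _ _); apply: eq_bigr => c _; rewrite grpart_id.
rewrite E1 big1 // => c _.
(* the trace is the sum of the traces of the diagonal blocks *)
rewrite (tr_lin1C (f := fun X => f (gp (c%:Z - 2) X)) (h := gp (c%:Z - 2))); last 2 first.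
- by move=> a X Y; rewrite grpart_linear fl.
- exact: grpart_linear.
by rewrite tr_lin1 big1 // => e _; rewrite -/(f0 _ _) f0E mxE.
Qed.

(** The projection to degree [j] is adjoint to the projection to degree [- j]. *)
Lemma killing_form_grpart j X Y : killing_form (gp j X) Y = killing_form X (gp (- j) Y).
Proof.
have H (c : 'I_5) : killing_form (gp j X) (gp (c%:Z - 2) Y) = killing_form (gp j X) (gp (c%:Z - 2) (gp (- j) Y)).
  rewrite grpart_grpart; case: eqP => [->//|/eqP cj].
  by rewrite killing_form0r (killing_form_graded (mem_grpart gr j X) (mem_grpart gr _ Y)) //; move: cj; lia.
have H' (c : 'I_5) : killing_form (gp (c%:Z - 2) X) (gp (- j) Y) = killing_form (gp (c%:Z - 2) (gp j X)) (gp (- j) Y).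
  rewrite grpart_grpart; case: eqP => [->//|/eqP cj].
  by rewrite killing_form0l (killing_form_graded (mem_grpart gr _ X) (mem_grpart gr (- j) Y)) //; move: cj; lia.
rewrite {1}(grpart_sum grd Y) killing_form_sumr (eq_bigr _ (fun c _ => H c)) -killing_form_sumr -grpart_sum //.
by rewrite {2}(grpart_sum grd X) killing_form_suml (eq_bigr _ (fun c _ => H' c)) -killing_form_suml -grpart_sum.
Qed.

(** [ad (th A) = th (ad A) th^-1] and the trace is invariant under conjugation. *)
Lemma killing_form_invariant (th th' : g -> g) A B : linear th -> linear th' ->
  cancel th' th -> cancel th th' -> (forall X Y, th (br X Y) = br (th X) (th Y)) ->
  killing_form (th A) (th B) = killing_form A B.
Proof.
move=> thl thl' thK thK' thbr.
have E : (fun X => br (th A) (br (th B) X)) = (fun X => th (br A (br B (th' X)))).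
  by apply/funext => X; rewrite !thbr thK.
rewrite /killing_form E (tr_lin1C (f := th) (h := fun X => br A (br B (th' X)))) //; last first.
  by move=> c X Y; rewrite thl' !br_lin.
by congr (\tr (lin1_mx _)); apply/funext => X; rewrite thK'.
Qed.

End GradedBracket.

(** * The codifferential preserves homogeneity *)
Section Codifferential.
Context {R : realType} {n : nat}.
Local Notation g := 'rV[R]_n.
Variable gr : int -> {vspace g}.
Hypothesis grd : grading gr.
Local Notation gp := (grpart gr).
Local Notation gm := (subvs_of (gneg gr)).
Local Notation tn := (toneg gr).
Variable br : g -> g -> g.
Hypothesis br_lin : forall A, linear (br A).
Hypothesis brC : forall A B, br A B = - br B A.
Hypothesis br_gr : forall i j X Y, X \in gr i -> Y \in gr j -> br X Y \in gr (i + j).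

Variables (r : nat) (zl : r.-tuple gm) (zu : r.-tuple g).
Hypothesis zl_basis : basis_of fullv zl.
Hypothesis zu_basis : basis_of (filt gr 1) zu.
Hypothesis z_dual : forall i j : 'I_r, killing_form br (vsval (tnth zl i)) (tnth zu j) = (i == j)%:R.
Local Notation z_ l := (tnth zl l).
Local Notation z' l := (tnth zu l).
Implicit Types (x y z : gm) (X Y W : g) (i j k a : int).

Lemma zl_expand x : x = \sum_l killing_form br (vsval x) (z' l) *: z_ l.
Proof.
have E := coord_basis zl_basis (memvf x).
have {}E : x = \sum_l coord zl l x *: z_ l.
  by rewrite {1}E; apply: eq_bigr => l _; rewrite (tnth_nth 0).
rewrite [LHS]E; apply: eq_bigr => l _; congr (_ *: _).
have vsE : vsval x = \sum_m coord zl m x *: vsval (z_ m).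
  by rewrite {1}E linear_sum; apply: eq_bigr => m _; exact: linearZ.
rewrite vsE (killing_form_suml br_lin brC) (bigD1 l) //= (killing_formZl br_lin brC) z_dual eqxx mulr1.
rewrite big1 ?addr0 // => m ml.
by rewrite (killing_formZl br_lin brC) z_dual (negbTE ml) mulr0.
Qed.

Lemma zu_expand Y : Y \in filt gr 1 -> Y = \sum_l killing_form br (vsval (z_ l)) Y *: z' l.
Proof.
move=> YF; have E := coord_basis zu_basis YF.
have {}E : Y = \sum_l coord zu l Y *: z' l.
  by rewrite {1}E; apply: eq_bigr => l _; rewrite (tnth_nth 0).
rewrite [LHS]E; apply: eq_bigr => l _; congr (_ *: _).
rewrite [in RHS]E (killing_form_sumr br_lin brC) (bigD1 l) //= (killing_formZr br_lin brC) z_dual eqxx mulr1.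
rewrite big1 ?addr0 // => m ml.
by rewrite (killing_formZr br_lin brC) z_dual eq_sym (negbTE ml) mulr0.
Qed.

Lemma mem_zu l : z' l \in filt gr 1.
Proof. exact: (basis_mem zu_basis (mem_tnth l zu)). Qed.

(** The sum over dual bases represents the identity, so a map on one factor may be replaced by
its adjoint on the other one.  Applied to projections it replaces homogeneous dual bases;
applied to automorphisms it replaces the independence of the codifferential of the dual
bases. *)
Lemma dual_transfer (f : gm -> gm) (f' : g -> g) (b : g -> gm -> g) :
  (forall Y, Y \in filt gr 1 -> f' Y \in filt gr 1) ->
  (forall z Y, Y \in filt gr 1 -> killing_form br (vsval (f z)) Y = killing_form br (vsval z) (f' Y)) ->
  (forall z, linear (b ^~ z)) -> (forall Y, linear (b Y)) ->
  \sum_l b (z' l) (f (z_ l)) = \sum_l b (f' (z' l)) (z_ l).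
Proof.
move=> f'F adj bl1 bl2.
have b2sum Y (F : 'I_r -> gm) (c : 'I_r -> R) :
    b Y (\sum_m c m *: F m) = \sum_m c m *: b Y (F m).
  by rewrite (linP_sum (bl2 Y)); apply: eq_bigr => m _; exact: (linPZ (bl2 Y)).
have b1sum z (F : 'I_r -> g) (c : 'I_r -> R) :
    b (\sum_m c m *: F m) z = \sum_m c m *: b (F m) z.
  by rewrite (linP_sum (bl1 z)); apply: eq_bigr => m _; exact: (linPZ (bl1 z)).
transitivity (\sum_l \sum_m killing_form br (vsval (f (z_ l))) (z' m) *: b (z' l) (z_ m)).
  by apply: eq_bigr => l _; rewrite {1}(zl_expand (f (z_ l))) b2sum.
rewrite exchange_big; apply: eq_bigr => m _.
rewrite {1}(zu_expand (f'F _ (mem_zu m))) b1sum; apply: eq_bigr => l _.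
by rewrite adj // mem_zu.
Qed.

Definition bilin (psi : gm -> gm -> g) : Prop :=
  (forall x, linear (psi x)) /\ (forall y, linear (psi ^~ y)).

(** The formula of [codiff2] for an abstract bracket; so are [diff2_br] and [codiff3_br]
for [diff2] and [codiff3].  For [lie] they are convertible to the originals. *)
Definition codiff2_br (psi : gm -> gm -> g) x : g :=
  \sum_l br (z' l) (psi x (z_ l)) - 2^-1 *: \sum_l psi (tn (br (z' l) (vsval x))) (z_ l).

Local Notation neg2 := ([:: - 2; - 1] : seq int).

Definition neg_part j x : gm := tn (gp j (vsval x)).

Lemma neg_part_linear j : linear (neg_part j).
Proof. by move=> c x y; rewrite /neg_part linearP /= grpart_linear toneg_linear. Qed.

Lemma val_neg_part j x : j \in neg2 -> vsval (neg_part j x) = gp j (vsval x).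
Proof.
rewrite !inE => j2; rewrite /neg_part val_toneg /negpart !(grpart_grpart grd).
by case/orP: j2 => /eqP -> /=; rewrite ?addr0 ?add0r.
Qed.

Lemma neg_part_transfer j (b : g -> gm -> g) : j \in neg2 ->
  (forall z, linear (b ^~ z)) -> (forall Y, linear (b Y)) ->
  \sum_l b (z' l) (neg_part j (z_ l)) = \sum_l b (gp (- j) (z' l)) (z_ l).
Proof.
move=> j2; apply: (dual_transfer (f := neg_part j) (f' := gp (- j))).
  move=> Y /(mem_filtP grd) H.
  apply/(mem_filtP grd) => k k1.
  by rewrite (grpart_grpart grd); case: eqP => // <-; exact: H.
move=> z Y _; rewrite val_neg_part //.
exact: (killing_form_grpart grd br_lin brC br_gr).
Qed.

Lemma neg_part_sum x : x = \sum_(j <- neg2) neg_part j x.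
Proof. by rewrite !big_cons big_nil addr0; exact: (neg_decomp grd). Qed.

Lemma neg_part_toneg j X : j \in neg2 -> neg_part j (tn X) = tn (gp j X).
Proof.
rewrite !inE => j2; rewrite /neg_part val_toneg.
by rewrite (grpart_negpart grd).
Qed.

Lemma grpart_val_out k x : k \notin neg2 -> gp k (vsval x) = 0.
Proof.
rewrite !inE negb_or => /andP[k2 k1].
by rewrite -(val_negpart grd x) /negpart grpartD
  !(grpart_ne grd) // addr0.
Qed.

Lemma zu_sum l : z' l = \sum_(j <- neg2) gp (- j) (z' l).
Proof.
rewrite !big_cons big_nil addr0 opprK opprK addrC.
exact: (sum_pos grd (mem_zu l)).
Qed.

Lemma hcompE L psi x y : hcomp L psi x y =
  \sum_(i <- neg2) \sum_(j <- neg2) gp (i + j + L) (psi (neg_part i x) (neg_part j y)).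
Proof. by []. Qed.

Section BilinearCochain.
Variables (L : int) (psi : gm -> gm -> g).
Hypothesis psi_bi : bilin psi.

Lemma bilin0l y : psi 0 y = 0.
Proof. exact: (linP0 (psi_bi.2 y)). Qed.

Lemma bilin0r x : psi x 0 = 0.
Proof. exact: (linP0 (psi_bi.1 x)). Qed.

Lemma bilinDl x x' y : psi (x + x') y = psi x y + psi x' y.
Proof. exact: (linPD (psi_bi.2 y)). Qed.

Lemma bilinDr x y y' : psi x (y + y') = psi x y + psi x y'.
Proof. exact: (linPD (psi_bi.1 x)). Qed.

Lemma bilin_suml (I : Type) (s : seq I) (F : I -> gm) y :
  psi (\sum_(i <- s) F i) y = \sum_(i <- s) psi (F i) y.
Proof. exact: (linP_sum (psi_bi.2 y)). Qed.

Lemma codiff2_hcomp_term1 x :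
  \sum_l br (z' l) (hcomp L psi x (z_ l)) =
  \sum_(i <- neg2) gp (i + L) (\sum_l br (z' l) (psi (neg_part i x) (z_ l))).
Proof.
transitivity (\sum_(i <- neg2) \sum_(j <- neg2) \sum_l
    br (gp (- j) (z' l)) (gp (i + j + L) (psi (neg_part i x) (z_ l)))).
  transitivity (\sum_(i <- neg2) \sum_(j <- neg2) \sum_l
      br (z' l) (gp (i + j + L) (psi (neg_part i x) (neg_part j (z_ l))))).
    under eq_bigr => l _.
      rewrite hcompE (br_sumr br_lin); under eq_bigr => i _ do rewrite (br_sumr br_lin).
      over.
    by rewrite exchange_big; apply: eq_bigr => i _; rewrite exchange_big.
  apply: eq_bigr => i _; apply: eq_big_seq => j j2.
  apply: (neg_part_transfer (b := fun Y z => br Y (gp (i + j + L) (psi (neg_part i x) z)))) => //.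
    by move=> z c A B; rewrite (brDl br_lin brC) (brZl br_lin brC).
  by move=> Y c A B; rewrite (psi_bi.1 _ c A B) grpart_linear br_lin.
apply: eq_bigr => i _; rewrite exchange_big grpart_bigsum; apply: eq_bigr => l _ /=.
rewrite [in RHS]zu_sum (br_suml br_lin brC) grpart_bigsum; apply: eq_bigr => j _.
rewrite (grpart_br_part grd br_lin br_gr); congr (br _ (gp _ _)).
by rewrite opprK addrAC.
Qed.

(** Both sides are sums over the degrees of the two arguments.  On the left the degree of the
first argument is that of [[z^l, x]_-], on the right it is that of [x]; the terms that occur on
one side only have a degree outside of [{-2, -1}] and vanish. *)
Lemma codiff2_hcomp_term2 x :
  \sum_l hcomp L psi (tn (br (z' l) (vsval x))) (z_ l) =
  \sum_(i <- neg2) gp (i + L) (\sum_l psi (tn (br (z' l) (vsval (neg_part i x)))) (z_ l)).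
Proof.
transitivity (\sum_(a <- neg2) \sum_(j <- neg2) \sum_l
    gp (a + j + L) (psi (tn (br (gp (- j) (z' l)) (gp (a + j) (vsval x)))) (z_ l))).
  transitivity (\sum_(a <- neg2) \sum_(j <- neg2) \sum_l
    gp (a + j + L) (psi (neg_part a (tn (br (z' l) (vsval x)))) (neg_part j (z_ l)))).
    under eq_bigr => l _ do rewrite hcompE.
    by rewrite exchange_big; apply: eq_bigr => i _; rewrite exchange_big.
  apply: eq_big_seq => a a2; apply: eq_big_seq => j j2.
  have := neg_part_transfer (b := fun Y z => gp (a + j + L) (psi (neg_part a (tn (br Y (vsval x)))) z)) j2.
  move=> ->.
  - apply: eq_bigr => l _; rewrite (neg_part_toneg _ a2).
    by rewrite (grpart_br_part grd br_lin br_gr) opprK.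
  - move=> z c A B; rewrite (brDl br_lin brC) (brZl br_lin brC) toneg_linear neg_part_linear.
    by rewrite (psi_bi.2 z c) grpart_linear.
  - by move=> Y c A B; rewrite (psi_bi.1 _ c) grpart_linear.
have out k l (Y := gp k (z' l)) a : a \notin neg2 -> br Y (gp a (vsval x)) = 0.
  by move=> a2; rewrite grpart_val_out // (br0r br_lin).
have out2 b l a : b + a \notin neg2 -> tn (br (gp b (z' l)) (gp a (vsval x))) = 0.
  rewrite !inE negb_or => /andP[k2 k1].
  have H := br_gr (mem_grpart gr b (z' l)) (mem_grpart gr a (vsval x)).
  have E : br (gp b (z' l)) (gp a (vsval x)) = gp (b + a) (br (gp b (z' l)) (gp a (vsval x))).
    by rewrite (grpart_gr grd _ H) eqxx.
  by rewrite E toneg_out.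
(* The only surviving term is [a = j = -1], which is [i = -2] and [j = -1] on the right. *)
pose F a j := \sum_l gp (a + j + L) (psi (tn (br (gp (- j) (z' l)) (gp (a + j) (vsval x)))) (z_ l)).
have F0 a j : a + j \notin neg2 -> F a j = 0.
  by move=> aj; rewrite /F big1 // => l _; rewrite out // toneg0 bilin0l grpart0.
pose H i j := \sum_l gp (i + L) (psi (tn (br (gp (- j) (z' l)) (gp i (vsval x)))) (z_ l)).
have H0 i j : - j + i \notin neg2 -> H i j = 0.
  by move=> ij; rewrite /H big1 // => l _; rewrite out2 // bilin0l grpart0.
transitivity (\sum_(i <- neg2) \sum_(j <- neg2) H i j); last first.
  apply: eq_big_seq => i i2; rewrite /H exchange_big grpart_bigsum; apply: eq_bigr => l _.
  rewrite (val_neg_part _ i2) [in RHS](zu_sum l) (br_suml br_lin brC) -grpart_bigsum; congr gp.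
  rewrite -bilin_suml; congr (psi _ _).
  by apply/esym/(big_morph tn) => [A B|]; [exact: tonegD|exact: toneg0].
rewrite -/(F _ _) !big_cons !big_nil !addr0.
rewrite -/(F (-2) (-2)) -/(F (-2) (-1)) -/(F (-1) (-2)) -/(F (-1) (-1)).
rewrite (F0 (-2) (-2)) // (F0 (-2) (-1)) // (F0 (-1) (-2)) //.
by rewrite (H0 (-2) (-2)) // (H0 (-1) (-2)) // (H0 (-1) (-1)) // !addr0 !add0r.
Qed.

Lemma codiff2_hcomp x :
  codiff2_br (hcomp L psi) x = \sum_(i <- neg2) gp (i + L) (codiff2_br psi (neg_part i x)).
Proof.
rewrite /codiff2_br codiff2_hcomp_term1 codiff2_hcomp_term2 scaler_sumr -sumrB; apply: eq_bigr => i _.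
by rewrite grpartD grpartN grpartZ.
Qed.

Lemma hcomp_bilin : bilin (hcomp L psi).
Proof.
split=> [x c y y'|y c x x']; rewrite !hcompE scaler_sumr -big_split; apply: eq_bigr => i _ /=;
  rewrite scaler_sumr -big_split; apply: eq_bigr => j _ /=.
  by rewrite neg_part_linear psi_bi.1 grpart_linear.
by rewrite neg_part_linear psi_bi.2 grpart_linear.
Qed.

Lemma hcomp_alternating x : (forall y z, psi y z = - psi z y) -> hcomp L psi x x = 0.
Proof.
move=> psiC; have psixx y : psi y y = 0.
  have /eqP := psiC y y; rewrite -addr_eq0 -mulr2n -scaler_nat scaler_eq0.
  by rewrite pnatr_eq0 /= => /eqP.
rewrite hcompE !big_cons !big_nil !addr0 !psixx !grpart0 add0r addr0.
by rewrite (psiC (neg_part (-1) x)) grpartN subrr.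
Qed.

End BilinearCochain.
End Codifferential.

(** * The lowest homogeneous component is closed *)
Section GradedCurvature.
Context {R : realType} {n : nat}.
Local Notation g := 'rV[R]_n.
Variable gr : int -> {vspace g}.
Hypothesis grd : grading gr.
Local Notation gp := (grpart gr).
Local Notation gm := (subvs_of (gneg gr)).
Local Notation tn := (toneg gr).
Local Notation neg2 := ([:: - 2; - 1] : seq int).
Variable br : g -> g -> g.
Hypothesis br_lin : forall A, linear (br A).
Hypothesis brC : forall A B, br A B = - br B A.
Hypothesis br_gr : forall i j X Y, X \in gr i -> Y \in gr j -> br X Y \in gr (i + j).
Implicit Types (x y z : gm) (X Y Z W : g) (i j k a : int).

Definition diff2_br (psi : gm -> gm -> g) x y z : g :=
  br (vsval x) (psi y z) - br (vsval y) (psi x z) + br (vsval z) (psi x y)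
  - psi (tn (br (vsval x) (vsval y))) z
  + psi (tn (br (vsval x) (vsval z))) y
  - psi (tn (br (vsval y) (vsval z))) x.

Section Diff2Additive.
Variable psi : gm -> gm -> g.
Hypothesis psi_bi : bilin psi.

Let al := bilinDl psi_bi.
Let ar := bilinDr psi_bi.

Ltac row_ring := apply/rowP => i0; rewrite !mxE; ring.

Lemma diff2_br_add1 x x' y z : diff2_br psi (x + x') y z = diff2_br psi x y z + diff2_br psi x' y z.
Proof.
rewrite /diff2_br !linearD /= !(brDl br_lin brC) !tonegD // !al !ar !(brDr br_lin).
row_ring.
Qed.

Lemma diff2_br_add2 x y y' z : diff2_br psi x (y + y') z = diff2_br psi x y z + diff2_br psi x y' z.
Proof.
rewrite /diff2_br !linearD /= !(brDl br_lin brC) !(brDr br_lin) !tonegD // !al !ar !(brDr br_lin).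
row_ring.
Qed.

Lemma diff2_br_add3 x y z z' : diff2_br psi x y (z + z') = diff2_br psi x y z + diff2_br psi x y z'.
Proof.
rewrite /diff2_br !linearD /= !(brDl br_lin brC) !(brDr br_lin) !tonegD // !al !ar !(brDr br_lin).
row_ring.
Qed.

Lemma diff2_br_homogeneous :
  (forall i j k x y z, i \in neg2 -> j \in neg2 -> k \in neg2 ->
     diff2_br psi (neg_part i x) (neg_part j y) (neg_part k z) = 0) ->
  forall x y z, diff2_br psi x y z = 0.
Proof.
move=> H x y z.
rewrite (neg_part_sum grd x) (neg_part_sum grd y)
  (neg_part_sum grd z) !big_cons !big_nil !addr0.
by rewrite !(diff2_br_add1, diff2_br_add2, diff2_br_add3) !H // !addr0.
Qed.
End Diff2Additive.

Lemma neg_part_neg_part a i x : i \in neg2 -> neg_part a (neg_part i x) = if a == i then neg_part i x else 0.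
Proof.
move=> i2; rewrite /neg_part (val_neg_part grd _ i2) grpart_grpart //.
by case: eqP => // _; exact: toneg0.
Qed.

Section Curvature.
Variables (kap : g -> g -> g) (L : int).
Hypothesis kap_lin : forall X, linear (kap X).
Hypothesis kapC : forall X Y, kap X Y = - kap Y X.
Hypothesis kap_hor : forall X Y, kap X Y = kap (negpart gr X) Y.
Let psi x y := kap (vsval x) (vsval y).
Hypothesis low : forall k x y, k < L -> hcomp k psi x y = 0.

Lemma restrict_bilin : bilin psi.
Proof.
split=> [x c y y'|y c x x']; rewrite /psi linearP /= ?kap_lin //.
by rewrite (brDl kap_lin kapC) (brZl kap_lin kapC).
Qed.

Lemma kap_horr X Y : kap X Y = kap X (negpart gr Y).
Proof. by rewrite kapC kap_hor -kapC. Qed.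

Lemma hcomp_homogeneous k i j x y : i \in neg2 -> j \in neg2 ->
  hcomp k psi (neg_part i x) (neg_part j y) = gp (i + j + k) (psi (neg_part i x) (neg_part j y)).
Proof.
move=> i2 j2; rewrite hcompE.
have z1 y' : psi 0 y' = 0 by exact: (bilin0l restrict_bilin).
have z2 x' : psi x' 0 = 0 by exact: (bilin0r restrict_bilin).
rewrite !big_cons !big_nil !addr0 !neg_part_neg_part //.
move: i2 j2; rewrite !inE.
by case/orP => /eqP -> /orP[] /eqP -> /=; rewrite ?z1 ?z2 !grpart0 ?addr0 ?add0r.
Qed.

Lemma val_tn_part i X : i \in neg2 -> vsval (tn (gp i X)) = gp i X.
Proof.
rewrite !inE val_toneg /negpart !(grpart_grpart grd).
by case/orP => /eqP -> /=; rewrite ?addr0 ?add0r.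
Qed.

Lemma neg_part_tn_part i X : i \in neg2 -> neg_part i (tn (gp i X)) = tn (gp i X).
Proof. by move=> i2; rewrite /neg_part val_tn_part // grpart_id. Qed.

Lemma kap_low i j k X Y : i \in neg2 -> j \in neg2 -> k < L ->
  gp (i + j + k) (kap (gp i X) (gp j Y)) = 0.
Proof.
move=> i2 j2 kL; have := low (tn (gp i X)) (tn (gp j Y)) kL.
rewrite -(neg_part_tn_part X i2) -(neg_part_tn_part Y j2) hcomp_homogeneous // !neg_part_tn_part //.
by rewrite /psi !val_tn_part.
Qed.

Lemma kap_sum_l X Y : kap X Y = \sum_(a <- neg2) kap (gp a X) Y.
Proof.
by rewrite kap_hor /negpart (brDl kap_lin kapC) !big_cons big_nil addr0.
Qed.

Lemma kap_sum_r X Y : kap X Y = \sum_(a <- neg2) kap X (gp a Y).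
Proof.
by rewrite kap_horr /negpart (brDr kap_lin) !big_cons big_nil addr0.
Qed.

(** The part of degree [a] of [kap X Y] has homogeneity [a - i - j], and the outer [kap] has
homogeneity [i + j + L - a]; if [L > 0] one of the two is less than [L].  If [L <= 0], the
total degree is at most [-3]. *)
Lemma kap_kap i j k X Y Z : i \in neg2 -> j \in neg2 -> k \in neg2 ->
  gp (i + j + k + L) (kap (kap (gp i X) (gp j Y)) (gp k Z)) = 0.
Proof.
move=> i2 j2 k2; have [L0|L1] := leP L 0.
  by apply: grpart_out; move: i2 j2 k2; rewrite !inE; lia.
rewrite kap_sum_l grpart_bigsum big1_seq // => a /andP[_ a2].
have [aL|aL] := ltP (a - i - j) L.
  have := kap_low X Y i2 j2 aL.
  rewrite (_ : i + j + (a - i - j) = a) => [->|]; last by lia.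
  by rewrite (br0l kap_lin kapC) grpart0.
have lt : i + j + L - a < L by move: aL; lia.
have := kap_low (kap (gp i X) (gp j Y)) Z a2 k2 lt.
by rewrite (_ : a + k + (i + j + L - a) = i + j + k + L) //; lia.
Qed.

(* [D X Y Z] stands for the derivative of [kap X Y] along the constant field of [Z]. *)
Variable D : g -> g -> g -> g.
Hypothesis D_low : forall i j k X Y Z, i \in neg2 -> j \in neg2 -> k < L ->
  gp (i + j + k) (D (gp i X) (gp j Y) Z) = 0.
Let T X Y Z := kap (br X Y) Z + br (kap X Y) Z - kap (kap X Y) Z - D X Y Z.
Hypothesis bianchi_id : forall X Y Z, T X Y Z + T Y Z X + T Z X Y = 0.

Lemma hcomp_bracket i j k X Y Z : i \in neg2 -> j \in neg2 -> k \in neg2 ->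
  hcomp L psi (tn (br (gp i X) (gp j Y))) (tn (gp k Z)) =
  gp (i + j + k + L) (kap (br (gp i X) (gp j Y)) (gp k Z)).
Proof.
move=> i2 j2 k2; set W := br _ _.
have Wg : W \in gr (i + j) by exact: br_gr (mem_grpart _ _ _) (mem_grpart _ _ _).
have WE : gp (i + j) W = W by rewrite (grpart_gr grd _ Wg) eqxx.
have [ij2|ij2] := boolP (i + j \in neg2).
  rewrite -WE -(neg_part_tn_part W ij2) -(neg_part_tn_part Z k2) hcomp_homogeneous // !neg_part_tn_part //.
  by rewrite /psi !val_tn_part.
have W0 : W = 0.
  rewrite -WE; apply: grpart_out.
  by move: i2 j2 ij2; rewrite !inE; lia.
rewrite W0 toneg0 (br0l kap_lin kapC) grpart0.
exact: (bilin0l (hcomp_bilin L restrict_bilin)).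
Qed.

(** The part of degree [i + j + k + L] of the Bianchi identity on homogeneous arguments. *)
Lemma hcomp_closed x y z : diff2_br (hcomp L psi) x y z = 0.
Proof.
apply: diff2_br_homogeneous; first exact: (hcomp_bilin L restrict_bilin).
move=> i j k {}x {}y {}z i2 j2 k2.
set X := vsval x; set Y := vsval y; set Z := vsval z.
have vx : vsval (neg_part i x) = gp i X by exact: val_neg_part.
have vy : vsval (neg_part j y) = gp j Y by exact: val_neg_part.
have vz : vsval (neg_part k z) = gp k Z by exact: val_neg_part.
rewrite /diff2_br !hcomp_homogeneous // vx vy vz /psi vx vy vz.
rewrite -[neg_part i x]/(tn (gp i X)) -[neg_part j y]/(tn (gp j Y)) -[neg_part k z]/(tn (gp k Z)).
rewrite !hcomp_bracket //.
set A := gp i X; set B := gp j Y; set C := gp k Z.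
pose s := i + j + k + L.
have e1 : i + k + j + L = s by rewrite /s; lia.
have e2 : j + k + i + L = s by rewrite /s; lia.
have b1 W : br A (gp (j + k + L) W) = gp s (br A W).
  by rewrite (grpart_br_part grd br_lin br_gr); congr (br _ (gp _ _)); rewrite /s; lia.
have b2 W : br B (gp (i + k + L) W) = gp s (br B W).
  by rewrite (grpart_br_part grd br_lin br_gr); congr (br _ (gp _ _)); rewrite /s; lia.
have b3 W : br C (gp (i + j + L) W) = gp s (br C W).
  by rewrite (grpart_br_part grd br_lin br_gr); congr (br _ (gp _ _)); rewrite /s; lia.
rewrite b1 b2 b3 e1 e2 -/s.
have q1 : gp s (kap (kap A B) C) = 0 by exact: kap_kap.
have q2 : gp s (kap (kap B C) A) = 0.
  by rewrite (_ : s = j + k + i + L); [exact: kap_kap|rewrite /s; lia].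
have q3 : gp s (kap (kap C A) B) = 0.
  by rewrite (_ : s = k + i + j + L); [exact: kap_kap|rewrite /s; lia].
(* as [k < 0], the homogeneity [k + L] is less than [L] *)
have d1 : gp s (D A B C) = 0.
  rewrite (_ : s = i + j + (k + L)); [apply: D_low => //|rewrite /s; lia].
  by move: k2; rewrite !inE; lia.
have d2 : gp s (D B C A) = 0.
  rewrite (_ : s = j + k + (i + L)); [apply: D_low => //|rewrite /s; lia].
  by move: i2; rewrite !inE; lia.
have d3 : gp s (D C A B) = 0.
  rewrite (_ : s = k + i + (j + L)); [apply: D_low => //|rewrite /s; lia].
  by move: j2; rewrite !inE; lia.
have TE U V W : gp s (kap (kap U V) W) = 0 -> gp s (D U V W) = 0 ->
    gp s (T U V W) = gp s (kap (br U V) W) + gp s (br (kap U V) W).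
  by move=> q d; rewrite /T !(grpartD, grpartN) q d !subr0.
have := congr1 (gp s) (bianchi_id A B C).
rewrite grpart0 (grpartD gr s (T A B C + T B C A)) (grpartD gr s (T A B C)).
rewrite (TE A B C q1 d1) (TE B C A q2 d2) (TE C A B q3 d3) (brC (kap A B) C) (brC (kap B C) A) (brC (kap C A) B).
rewrite (kapC C A) (brC C A) (brNr br_lin) (brNl kap_lin kapC) !grpartN.
move=> H; rewrite -[LHS]opprK -[RHS]oppr0 -[in RHS]H; congr (- _).
by apply/rowP => i0; rewrite !mxE; ring.
Qed.

End Curvature.
End GradedCurvature.

(** * Filtered maps and their associated graded maps *)
Section Filtered.
Context {R : realType} {n : nat}.
Local Notation g := 'rV[R]_n.
Variable gr : int -> {vspace g}.
Hypothesis grd : grading gr.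
Local Notation gp := (grpart gr).
Local Notation gm := (subvs_of (gneg gr)).
Local Notation tn := (toneg gr).
Local Notation neg2 := ([:: - 2; - 1] : seq int).
Implicit Types (x y z : gm) (X Y Z W : g) (i j k a s t : int).

(** Membership in the filtration, in terms of homogeneous components (see [mem_filtP]). *)
Definition in_filt s X : Prop := forall k, k < s -> gp k X = 0.

Lemma in_filtD s X Y : in_filt s X -> in_filt s Y -> in_filt s (X + Y).
Proof. by move=> FX FY k ks; rewrite grpartD FX // FY // addr0. Qed.

Lemma gr_in_filt i X : X \in gr i -> in_filt i X.
Proof.
move=> Xi k ki; rewrite (grpart_gr grd _ Xi).
by case: eqP => // ke; move: ki; rewrite ke; lia.
Qed.

Lemma in_filt_rest s X : in_filt s X -> in_filt (s + 1) (X - gp s X).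
Proof.
move=> FX k ks; rewrite grpartD grpartN grpart_grpart //.
case: eqP => [->|/eqP ne]; first by rewrite subrr.
by rewrite subr0 FX //; move: ks ne; lia.
Qed.

(** The map induced on the associated graded space, identified with [g] by the grading;
[grAd] is the case of [Ad]. *)
Definition graded_map (phi : g -> g) X : g := \sum_(i < 5) gp (i%:Z - 2) (phi (gp (i%:Z - 2) X)).

Section OneMap.
Variable phi : g -> g.
Hypothesis phi_lin : linear phi.

Let phi0 := linP0 phi_lin.

Lemma graded_map_linear : linear (graded_map phi).
Proof.
move=> c X Y; rewrite /graded_map scaler_sumr -big_split; apply: eq_bigr => i _ /=.
by rewrite grpart_linear phi_lin grpart_linear.
Qed.

Lemma graded_map_grpart i X : graded_map phi (gp i X) = gp i (phi (gp i X)).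
Proof.
rewrite /graded_map [RHS](grpart_sum grd); apply: eq_bigr => c _.
rewrite !grpart_grpart //; case: eqP => [->//|_].
by rewrite phi0 grpart0.
Qed.

Lemma graded_map_gr i X : X \in gr i -> graded_map phi X = gp i (phi X).
Proof.
by move=> Xi; have := graded_map_grpart i X; rewrite (grpart_gr grd _ Xi) eqxx.
Qed.

Lemma grpart_graded_map i X : gp i (graded_map phi X) = graded_map phi (gp i X).
Proof.
rewrite graded_map_grpart {1}/graded_map grpart_bigsum.
rewrite [in RHS](_ : gp i X = \sum_(c < 5) gp (c%:Z - 2) (gp i X)); last exact: grpart_sum.
rewrite (linP_sum phi_lin) grpart_bigsum; apply: eq_bigr => c _.
rewrite !grpart_grpart //; have [->//|ne] := eqVneq i (c%:Z - 2).
by rewrite phi0 grpart0.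
Qed.

Lemma negpart_graded_map X : negpart gr (graded_map phi X) = graded_map phi (negpart gr X).
Proof. by rewrite /negpart !grpart_graded_map (linPD graded_map_linear). Qed.

End OneMap.

Section Inverse.
Variables phi phi' : g -> g.
Hypothesis phi_lin : linear phi.
Hypothesis phi_lin' : linear phi'.
Hypothesis phiK : cancel phi' phi.
Hypothesis phi_fil : forall s X, in_filt s X -> in_filt s (phi X).
Hypothesis phi_fil' : forall s X, in_filt s X -> in_filt s (phi' X).

(** Passing to the associated graded map is functorial for filtered maps: the error
[phi' A - gp i (phi' A)] lies one step deeper in the filtration. *)
Lemma graded_mapK : cancel (graded_map phi') (graded_map phi).
Proof.
move=> X; rewrite [RHS](grpart_sum grd) [LHS](grpart_sum grd); apply: eq_bigr => c _.
rewrite !grpart_graded_map // graded_map_grpart // graded_map_grpart //.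
set i := c%:Z - 2; set A := gp i X.
have FA : in_filt i (phi' A) by apply: phi_fil'; apply: gr_in_filt; exact: mem_grpart.
have := phi_fil (in_filt_rest FA); rewrite (linPB phi_lin) phiK => /(_ i).
rewrite grpartD grpartN => H; have {}H : gp i A - gp i (phi (gp i (phi' A))) = 0 by apply: H; lia.
have AE : gp i A = A by rewrite /A grpart_id.
by apply/esym/eqP; rewrite -subr_eq0 -{1}AE H.
Qed.

Lemma graded_map_neg_linear : linear (fun x => tn (graded_map phi' (vsval x))).
Proof. by move=> c x y; rewrite linearP /= graded_map_linear // toneg_linear. Qed.

Lemma val_graded_map_neg x : vsval (tn (graded_map phi' (vsval x))) = graded_map phi' (vsval x).
Proof. by rewrite val_toneg negpart_graded_map // val_negpart. Qed.

Section Bracket.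
Variable br : g -> g -> g.
Hypothesis br_lin : forall A, linear (br A).
Hypothesis brC : forall A B, br A B = - br B A.
Hypothesis br_gr : forall i j X Y, X \in gr i -> Y \in gr j -> br X Y \in gr (i + j).
Hypothesis phi_br : forall X Y, phi (br X Y) = br (phi X) (phi Y).

Lemma br_in_filt s t X Y : in_filt s X -> in_filt t Y -> in_filt (s + t) (br X Y).
Proof.
move=> FX FY k kst; rewrite (grpart_sum grd X) (br_suml br_lin brC) grpart_bigsum.
rewrite big1 // => c _; have [cs|sc] := ltP (c%:Z - 2) s.
  by rewrite FX // (br0l br_lin brC) grpart0.
rewrite (grpart_br_part grd br_lin br_gr).
by rewrite FY ?(br0r br_lin) //; move: kst sc; lia.
Qed.

(** Replacing [phi A] and [phi B] by their leading parts changes their bracket by terms of higher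
filtration degree. *)
Lemma graded_map_br X Y : graded_map phi (br X Y) = br (graded_map phi X) (graded_map phi Y).
Proof.
have gra_sum := linP_sum (graded_map_linear phi_lin).
have H i j A B : A \in gr i -> B \in gr j -> graded_map phi (br A B) = br (graded_map phi A) (graded_map phi B).
  move=> Ai Bj; rewrite (graded_map_gr phi_lin (br_gr Ai Bj)) (graded_map_gr phi_lin Ai) (graded_map_gr phi_lin Bj) phi_br.
  have FA := phi_fil (gr_in_filt Ai); have FB := phi_fil (gr_in_filt Bj).
  set A' := gp i (phi A); set B' := gp j (phi B).
  have A'i : A' \in gr i by exact: mem_grpart.
  have -> : br (phi A) (phi B) = br A' B' + (br A' (phi B - B') + br (phi A - A') (phi B)).
    rewrite (brBr br_lin) (brBl br_lin brC).
    by apply/rowP => e; rewrite !mxE; ring.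
  have F1 : in_filt (i + j + 1) (br A' (phi B - B')).
    by rewrite -addrA; apply: br_in_filt; [exact: gr_in_filt|exact: in_filt_rest].
  have F2 : in_filt (i + j + 1) (br (phi A - A') (phi B)).
    by rewrite addrAC; apply: br_in_filt => //; exact: in_filt_rest.
  rewrite grpartD (in_filtD F1 F2) ?addr0; last by lia.
  have B'j : B' \in gr j by exact: mem_grpart.
  by rewrite (grpart_gr grd _ (br_gr A'i B'j)) eqxx.
have H2 i A : A \in gr i -> graded_map phi (br A Y) = br (graded_map phi A) (graded_map phi Y).
  move=> Ai; rewrite (grpart_sum grd Y) (br_sumr br_lin) !gra_sum (br_sumr br_lin).
  by apply: eq_bigr => e _; apply: (H _ _ _ _ Ai (mem_grpart _ _ _)).
move: (graded_map phi Y) H2 => Z H2.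
rewrite (grpart_sum grd X) (br_suml br_lin brC) !gra_sum (br_suml br_lin brC).
by apply: eq_bigr => c _; apply: (H2 _ _ (mem_grpart _ _ _)).
Qed.
End Bracket.

Variables (kap kap' : g -> g -> g) (L : int).
Hypothesis kap_lin : forall X, linear (kap X).
Hypothesis kapC : forall X Y, kap X Y = - kap Y X.
Hypothesis kap_hor : forall X Y, kap X Y = kap (negpart gr X) Y.
Hypothesis kap_lin' : forall X, linear (kap' X).
Hypothesis kapC' : forall X Y, kap' X Y = - kap' Y X.
Let psi x y := kap (vsval x) (vsval y).
Let psi' x y := kap' (vsval x) (vsval y).
Hypothesis low : forall k x y, k < L -> hcomp k psi x y = 0.
Hypothesis kap_phi : forall X Y, kap' (phi X) (phi Y) = phi (kap X Y).

(** Lowest homogeneity [L] says that [kap] is filtered of degree [L]. *)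
Lemma kap_in_filt s t X Y : in_filt s X -> in_filt t Y -> in_filt (s + t + L) (kap X Y).
Proof.
move=> FX FY k kst.
rewrite (kap_sum_l kap_lin kapC kap_hor) grpart_bigsum big1_seq // => i /andP[_ i2].
rewrite (kap_sum_r kap_lin kapC kap_hor) grpart_bigsum big1_seq // => j /andP[_ j2].
have [is_|si] := ltP i s; first by rewrite FX // (br0l kap_lin kapC) grpart0.
have [jt|tj] := ltP j t; first by rewrite FY // (br0r kap_lin) grpart0.
have lt : k - i - j < L by move: kst si tj; lia.
have := kap_low grd kap_lin kapC low X Y i2 j2 lt.
by rewrite (_ : i + j + (k - i - j) = k) //; lia.
Qed.

(** The leading part of the equivariance of [kap]. *)
Lemma hcomp_equivariant x y :
  hcomp L psi' x y =
  graded_map phi (hcomp L psi (tn (graded_map phi' (vsval x))) (tn (graded_map phi' (vsval y)))).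
Proof.
have bi : bilin psi by exact: restrict_bilin.
have bi' : bilin psi' by exact: restrict_bilin.
have hb := hcomp_bilin L bi; have hb' := hcomp_bilin L bi'.
pose rhs x y := graded_map phi (hcomp L psi (tn (graded_map phi' (vsval x))) (tn (graded_map phi' (vsval y)))).
have rb : bilin rhs.
  split=> [u c v w|v c u w]; rewrite /rhs graded_map_neg_linear.
    by rewrite (hb.1 _ c) graded_map_linear.
  by rewrite (hb.2 _ c) graded_map_linear.
have H i j u v : i \in neg2 -> j \in neg2 ->
    hcomp L psi' (neg_part i u) (neg_part j v) = rhs (neg_part i u) (neg_part j v).
  move=> i2 j2; rewrite /rhs (hcomp_homogeneous grd kap_lin' kapC') //.
  set U := vsval (neg_part i u); set V := vsval (neg_part j v).
  have Ui : U \in gr i by rewrite /U val_neg_part //; exact: mem_grpart.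
  have Vj : V \in gr j by rewrite /V val_neg_part //; exact: mem_grpart.
  rewrite (graded_map_gr phi_lin' Ui) (graded_map_gr phi_lin' Vj).
  rewrite -(neg_part_tn_part grd (phi' U) i2) -(neg_part_tn_part grd (phi' V) j2).
  rewrite (hcomp_homogeneous grd kap_lin kapC) // !(neg_part_tn_part grd) //.
  rewrite /psi !(val_tn_part grd) // graded_map_grpart //.
  set U' := gp i (phi' U); set V' := gp j (phi' V).
  have FU := phi_fil' (gr_in_filt Ui); have FV := phi_fil' (gr_in_filt Vj).
  have FU' : in_filt i U' by apply: gr_in_filt; exact: mem_grpart.
  have FV' : in_filt j V' by apply: gr_in_filt; exact: mem_grpart.
  rewrite /psi' -/U -/V -{1}(phiK U) -{1}(phiK V) kap_phi.
  set s := i + j + L.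
  have F1 : in_filt (s + 1) (kap U' (phi' V - V')).
    rewrite (_ : s + 1 = i + (j + 1) + L); last by rewrite /s; lia.
    by apply: kap_in_filt => //; exact: in_filt_rest.
  have F2 : in_filt (s + 1) (kap (phi' U - U') (phi' V)).
    rewrite (_ : s + 1 = (i + 1) + j + L); last by rewrite /s; lia.
    by apply: kap_in_filt => //; exact: in_filt_rest.
  have F3 : in_filt (s + 1) (kap U' V' - gp s (kap U' V')).
    by apply: in_filt_rest; exact: kap_in_filt.
  have E : kap (phi' U) (phi' V) = gp s (kap U' V') +
     (kap U' V' - gp s (kap U' V') + (kap U' (phi' V - V') + kap (phi' U - U') (phi' V))).
    rewrite (brBr kap_lin) (brBl kap_lin kapC).
    by apply/rowP => e; rewrite !mxE; ring.
  have F4 := phi_fil (in_filtD F3 (in_filtD F1 F2)).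
  by rewrite E (linPD phi_lin) grpartD F4 ?addr0 //; lia.
rewrite -/(rhs x y) (neg_part_sum grd x) (neg_part_sum grd y).
rewrite !big_cons !big_nil !addr0.
by rewrite !(bilinDl hb') !(bilinDr hb') !(bilinDl rb) !(bilinDr rb) !H.
Qed.

End Inverse.
End Filtered.

(** * Equivariance of the codifferential on three-cochains *)
Section CodiffThree.
Context {R : realType} {n : nat}.
Local Notation g := 'rV[R]_n.
Variable gr : int -> {vspace g}.
Hypothesis grd : grading gr.
Local Notation gp := (grpart gr).
Local Notation gm := (subvs_of (gneg gr)).
Local Notation tn := (toneg gr).
Variable br : g -> g -> g.
Hypothesis br_lin : forall A, linear (br A).
Hypothesis brC : forall A B, br A B = - br B A.
Variables (r : nat) (zl : r.-tuple gm) (zu : r.-tuple g).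
Hypothesis zl_basis : basis_of fullv zl.
Hypothesis zu_basis : basis_of (filt gr 1) zu.
Hypothesis z_dual : forall i j : 'I_r, killing_form br (vsval (tnth zl i)) (tnth zu j) = (i == j)%:R.
Local Notation z_ l := (tnth zl l).
Local Notation z' l := (tnth zu l).
Implicit Types (x y z : gm) (X Y W : g).

Definition codiff3_br (chi : gm -> gm -> gm -> g) x y : g :=
  - (\sum_l br (z' l) (chi (z_ l) x y))
  + 2^-1 *: \sum_l (chi (z_ l) (tn (br (z' l) (vsval x))) y
                    + chi (z_ l) x (tn (br (z' l) (vsval y)))).

Variables (th th' : g -> g).
Hypothesis th_lin : linear th.
Hypothesis th_lin' : linear th'.
Hypothesis thK : cancel th' th.
Hypothesis thK' : cancel th th'.
Hypothesis th_gp : forall k X, gp k (th X) = th (gp k X).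
Hypothesis th_gp' : forall k X, gp k (th' X) = th' (gp k X).
Hypothesis th_br : forall X Y, th (br X Y) = br (th X) (th Y).
Local Notation tx x := (tn (th' (vsval x))).

Definition act3 (chi : gm -> gm -> gm -> g) x y z : g := th (chi (tx x) (tx y) (tx z)).

Lemma negpart_th' X : negpart gr (th' X) = th' (negpart gr X).
Proof. by rewrite /negpart !th_gp' (linPD th_lin'). Qed.

Lemma val_tx x : vsval (tx x) = th' (vsval x).
Proof. by rewrite val_toneg negpart_th' val_negpart. Qed.

Lemma tx_toneg W : tx (tn W) = tn (th' W).
Proof. by rewrite val_toneg -negpart_th' toneg_negpart. Qed.

Lemma tx_linear : linear (fun x => tx x).
Proof. by move=> c x y; rewrite linearP /= th_lin' toneg_linear. Qed.

Lemma th_br' X Y : th' (br (th X) Y) = br X (th' Y).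
Proof. by rewrite -{1}(thK Y) -th_br thK'. Qed.

(** An automorphism preserves the Killing form, so its inverse is its adjoint. *)
Lemma th_transfer (b : g -> gm -> g) :
  (forall z, linear (b ^~ z)) -> (forall Y, linear (b Y)) ->
  \sum_l b (z' l) (tx (z_ l)) = \sum_l b (th (z' l)) (z_ l).
Proof.
move=> b1 b2.
apply: (dual_transfer br_lin brC zl_basis zu_basis z_dual (f := fun z => tx z) (f' := th) (b := b) _ _ b1 b2).
  move=> Y /(mem_filtP grd) H.
  apply/(mem_filtP grd) => k k1.
  by rewrite th_gp H // (linP0 th_lin).
move=> z Y _; rewrite val_tx -(killing_form_invariant br_lin (th' (vsval z)) Y th_lin th_lin' thK thK' th_br).
by rewrite thK.
Qed.

Definition trilin (chi : gm -> gm -> gm -> g) : Prop :=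
  [/\ forall x y, linear (chi x y), forall x z, linear (fun y => chi x y z) &
      forall y z, linear (fun x => chi x y z)].

Lemma codiff3_act3 chi x y : trilin chi ->
  codiff3_br (act3 chi) x y = th (codiff3_br chi (tx x) (tx y)).
Proof.
move=> [c3 c2 c1].
have T1 : \sum_l br (z' l) (act3 chi (z_ l) x y) =
    th (\sum_l br (z' l) (chi (z_ l) (tx x) (tx y))).
  rewrite (th_transfer (b := fun Y z => br Y (th (chi z (tx x) (tx y))))).
  - by rewrite (linP_sum th_lin); apply: eq_bigr => l _; rewrite th_br.
  - by move=> z c A B; rewrite (brDl br_lin brC) (brZl br_lin brC).
  - by move=> Y c A B; rewrite c1 th_lin br_lin.
have T2 : \sum_l act3 chi (z_ l) (tn (br (z' l) (vsval x))) y =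
    th (\sum_l chi (z_ l) (tn (br (z' l) (vsval (tx x)))) (tx y)).
  rewrite (th_transfer (b := fun Y z => th (chi z (tx (tn (br Y (vsval x)))) (tx y)))).
  - by rewrite (linP_sum th_lin); apply: eq_bigr => l _; rewrite tx_toneg th_br' val_tx.
  - move=> z c A B; rewrite (brDl br_lin brC) (brZl br_lin brC) toneg_linear tx_linear.
    by rewrite c2 th_lin.
  - by move=> Y c A B; rewrite c1 th_lin.
have T3 : \sum_l act3 chi (z_ l) x (tn (br (z' l) (vsval y))) =
    th (\sum_l chi (z_ l) (tx x) (tn (br (z' l) (vsval (tx y))))).
  rewrite (th_transfer (b := fun Y z => th (chi z (tx x) (tx (tn (br Y (vsval y))))))).
  - by rewrite (linP_sum th_lin); apply: eq_bigr => l _; rewrite tx_toneg th_br' val_tx.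
  - move=> z c A B; rewrite (brDl br_lin brC) (brZl br_lin brC) toneg_linear tx_linear.
    by rewrite c3 th_lin.
  - by move=> Y c A B; rewrite c1 th_lin.
by rewrite /codiff3_br !big_split /= T1 T2 T3 -(linPN th_lin) -(linPD th_lin) -(linPZ th_lin) -(linPD th_lin).
Qed.

Lemma act3_trilin chi : trilin chi -> trilin (act3 chi).
Proof.
move=> [c3 c2 c1]; split.
- by move=> x y c A B; rewrite /act3 tx_linear c3 th_lin.
- by move=> x z c A B; rewrite /act3 tx_linear c2 th_lin.
- by move=> y z c A B; rewrite /act3 tx_linear c1 th_lin.
Qed.

End CodiffThree.

(** * The lowest component of the curvature of a normal Cartan connection *)
Section Assembly.
#[local] Opaque derive lie full_curv field_bracket.
Context {R : realType}.

Lemma mem_bracket_span n (br : 'rV[R]_n -> 'rV[R]_n -> 'rV[R]_n) (U W : {vspace 'rV[R]_n}) x y :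
  (forall A, linear (br A)) -> (forall A B, br A B = - br B A) ->
  x \in U -> y \in W -> br x y \in <<[seq br a b | a <- vbasis U, b <- vbasis W]>>%VS.
Proof.
move=> br_lin brC xU yW.
rewrite (coord_vbasis xU) (br_suml br_lin brC); apply: memv_suml => i _.
rewrite (brZl br_lin brC) memvZ //.
rewrite (coord_vbasis yW) (br_sumr br_lin); apply: memv_suml => j _.
rewrite (brZr br_lin) memvZ // memv_span //; apply/allpairsP.
exists ((vbasis U)`_i, (vbasis W)`_j); split => //; apply: mem_nth; rewrite size_tuple; exact: ltn_ord.
Qed.

Lemma linear_rV_continuous n m (f : {linear 'rV[R]_n -> 'rV[R]_m}) : continuous f.
Proof.
move=> v.
have s : smooth_near (fun v : 'rV[R]_n => \sum_i scale_linear (f (delta_mx 0 i)) (v 0 i)) v.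
  apply: smooth_near_sum => i _; apply: smooth_near_linear.
    by move=> z; exact: cvgZr_tmp.
  by apply: smooth_near_entry; exact: smooth_near_id.
have E : f = (fun v : 'rV[R]_n => \sum_i scale_linear (f (delta_mx 0 i)) (v 0 i)) :> (_ -> _).
  apply/funext => w; rewrite {1}(row_sum_delta w) linear_sum; apply: eq_bigr => i _.
  exact: linearZ.
by rewrite E; exact: smooth_near_continuous s.
Qed.

Section Setting.
Context {n : nat}.
Variable G : lie_group R n.
Variable gr : int -> {vspace 'rV[R]_n}.
Hypothesis grG : two_grading G gr.
Variables (m : nat) (P : filtration_subgroup G gr m) (d k : nat) (M : manifold R d).
Variable Q : principal_bundle k P M.
Variable om : Q -> 'Hom('rV[R]_k, 'rV[R]_n).
Hypothesis ccom : cartan_connection om.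
Local Notation g := 'rV[R]_n.
Local Notation gm := (subvs_of (gneg gr)).
Local Notation gp := (grpart gr).
Local Notation tn := (toneg gr).
Local Notation neg2 := ([:: - 2; - 1] : seq int).
Local Notation incl := (fs_incl (f := P)).
Local Notation K := (full_curv G om).

Let grd := Grading (tg_range grG) (tg_full grG) (tg_direct grG).
Let oms := cc_smooth ccom.
Let omb := cc_iso ccom.
Let lin := lie_linear G.
Let lC := lieC G.

Lemma lie_graded i j X Y : X \in gr i -> Y \in gr j -> lie G X Y \in gr (i + j).
Proof.
move=> Xi Yj; apply: (subvP (tg_lie grG i j)).
exact: (mem_bracket_span lin lC Xi Yj).
Qed.

Let K_lin u := full_curv_linear G oms omb u.
Let KC u := full_curvC G om u.

(** Horizontality, with [g / p] identified with [g_-]. *)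
Lemma full_curv_negpart u X Y : K u X Y = K u (negpart gr X) Y.
Proof.
have Xp : X - negpart gr X \in filt gr 0.
  apply/(mem_filtP grd) => i i0.
  rewrite grpartD grpartN; have [i2|i2] := boolP ((i == - 2) || (i == - 1)).
    by rewrite (grpart_negpart grd X i2) subrr.
  by rewrite !grpart_out ?subr0 //; move: i0 i2; lia.
have E := brDl (K_lin u) (KC u) (X - negpart gr X) (negpart gr X) Y.
rewrite subrK in E.
exact: (etrans E (etrans (congr1 (fun w => w + _) (full_curv_horizontal ccom u Y Xp)) (add0r _))).
Qed.

(** [om] is constant on constant fields, so only the bracket survives in the exterior
derivative. *)
Lemma curvature_funE : curvature_fun om = (fun u (x y : gm) => K u (vsval x) (vsval y)).
Proof.
apply/funext => u; apply/funext => x; apply/funext => y.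
have E Z : (fun v => om v ((om v)^-1%VF Z)) = (fun=> Z).
  by apply/funext => v; exact: (om_const_field omb v Z).
have D0 Z v : dirder (fun _ : Q => Z : g) u v = 0 by exact: derive_cst.
have L1 : lie G (om u ((om u)^-1%VF (vsval x))) (om u ((om u)^-1%VF (vsval y))) = lie G (vsval x) (vsval y).
  by rewrite !(om_const_field omb).
have X1 : ext_der om (fun v => (om v)^-1%VF (vsval x)) (fun v => (om v)^-1%VF (vsval y)) u =
   - om u (field_bracket (const_field om (vsval x)) (const_field om (vsval y)) u).
  by rewrite /ext_der !E !D0 subr0 sub0r.
exact: (etrans (congr2 +%R X1 L1) (addrC _ _)).
Qed.

Let kappa u (x y : gm) : g := K u (vsval x) (vsval y).

Variable l : int.
Hypothesis low : forall i u x y, i < l -> hcomp i (curvature_fun om u) x y = 0.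

Let low' u i x y : i < l -> hcomp i (kappa u) x y = 0.
Proof. by move=> il; have := low u x y il; rewrite curvature_funE. Qed.

Definition grpart_lin i : {linear g -> g} := lin_of (grpart_linear gr i).

Lemma grpart_dirder i (f : Q -> g) u v : smooth_at f u ->
  gp i (dirder f u v) = dirder (fun w => gp i (f w)) u v.
Proof.
move=> sf.
have D1 : 'D_v (fun t => grpart_lin i (f (chart_inv u t))) (chart u u) = grpart_lin i (dirder f u v).
  by apply: derive_linear; [exact: linear_rV_continuous|exact: smooth_near_derivable].
exact: esym D1.
Qed.

Lemma lowest_closed u x y z : diff2 G (hcomp l (curvature_fun om u)) x y z = 0.
Proof.
rewrite curvature_funE.
pose D (X Y Z : g) := dirder (fun v => K v X Y) u (const_field om Z u).
have D_low i j a X Y Z : i \in neg2 -> j \in neg2 -> a < l ->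
    gp (i + j + a) (D (gp i X) (gp j Y) Z) = 0.
  move=> i2 j2 al; rewrite /D grpart_dirder; last exact: smooth_full_curv.
  have -> : (fun w => gp (i + j + a) (K w (gp i X) (gp j Y))) = (fun=> 0).
    apply/funext => w.
    exact: (kap_low grd (K_lin w) (KC w) (@low' w) X Y i2 j2 al).
  exact: derive_cst.
exact: (hcomp_closed grd lin lC lie_graded (K_lin u) (KC u)
  (full_curv_negpart u) (@low' u) D_low (bianchi G oms omb u) x y z).
Qed.

Lemma smooth_lowest x y u : smooth_at (fun v => hcomp l (curvature_fun om v) x y) u.
Proof.
rewrite curvature_funE /hcomp.
apply: (smooth_near_sum) => i _; apply: smooth_near_sum => j _.
apply: (smooth_near_linear (L := grpart_lin (i + j + l))); first exact: linear_rV_continuous.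
exact: (smooth_full_curv G oms omb _ _ u).
Qed.

Let kappa_bilin u : bilin (kappa u) := restrict_bilin gr (K_lin u) (KC u).

Lemma lowest_cochain u : cochain2 (hcomp l (curvature_fun om u)).
Proof.
rewrite curvature_funE; have [b1 b2] := hcomp_bilin l (kappa_bilin u).
split; [exact: b1|exact: b2|move=> x].
by apply: hcomp_alternating => y z; exact: KC.
Qed.

Section Equivariance.
Variable p : P.
Let q := incl (lg_inv p).

Lemma incl_filt (a : P) s X : in_filt gr s X -> in_filt gr s (Ad (incl a) X).
Proof.
move=> FX; apply/(mem_filtP grd).
have H := proj1 (fs_range P (incl a)) (ex_intro _ a erefl).
by apply: H; apply/(mem_filtP grd).
Qed.

Lemma invq : lg_inv q = incl p.
Proof. by rewrite -inclV lg_invK. Qed.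

Let phi_fil s X : in_filt gr s X -> in_filt gr s (Ad q X). Proof. exact: incl_filt. Qed.
Let phi_fil' s X : in_filt gr s X -> in_filt gr s (Ad (lg_inv q) X).
Proof. by rewrite invq; exact: incl_filt. Qed.
Let Al := Ad_linear q.
Let Al' := Ad_linear (lg_inv q).

Let th := grAd gr q.
Let th' := grAd gr (lg_inv q).

Let thK : cancel th' th.
Proof. exact: (graded_mapK grd Al Al' (AdK q) phi_fil phi_fil'). Qed.

Let thK' : cancel th th'.
Proof. exact: (graded_mapK grd Al' Al (AdVK q) phi_fil' phi_fil). Qed.

Let th_lin : linear th. Proof. exact: (graded_map_linear gr Al). Qed.
Let th_lin' : linear th'. Proof. exact: (graded_map_linear gr Al'). Qed.
Let th_gp i X : gp i (th X) = th (gp i X).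
Proof. exact: (grpart_graded_map grd Al). Qed.
Let th_gp' i X : gp i (th' X) = th' (gp i X).
Proof. exact: (grpart_graded_map grd Al'). Qed.
Let th_br X Y : th (lie G X Y) = lie G (th X) (th Y).
Proof. exact: (graded_map_br grd Al phi_fil lin lC lie_graded (Ad_lie q)). Qed.
Let th_br'  X Y : th' (lie G X Y) = lie G (th' X) (th' Y).
Proof. exact: (graded_map_br grd Al' phi_fil' lin lC lie_graded (Ad_lie (lg_inv q))). Qed.

Lemma lowest_equivariant u : hcomp l (curvature_fun om (pb_act u p)) =
  act2 q (hcomp l (curvature_fun om u)).
Proof.
rewrite curvature_funE; apply/funext => x; apply/funext => y.
exact: (hcomp_equivariant grd Al Al' (AdK q) phi_fil phi_fil'
  (K_lin u) (KC u) (full_curv_negpart u) (K_lin (pb_act u p)) (KC (pb_act u p)) (@low' u)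
  (full_curv_equivariant ccom u p)).
Qed.

Variables (r : nat) (zl : r.-tuple gm) (zu : r.-tuple g).
Hypothesis dz : dual_bases G zl zu.

Let zb := db_neg dz.
Let zub := db_pos dz.
Let zd := db_dual dz.

Lemma cochain_trilin (chi : gm -> gm -> gm -> g) : cochain3 chi -> trilin chi.
Proof. by case. Qed.

Lemma act_cochain3 (t t' : g -> g) (tl : linear t) (tl' : linear t') (chi : gm -> gm -> gm -> g) :
  cochain3 chi -> cochain3 (act3 (gr := gr) t t' chi).
Proof.
move=> c; have [c3 c2 c1] := act3_trilin tl tl' (cochain_trilin c).
have t0 := linP0 tl.
case: c => _ _ _ a1 a2; split; [exact: c3|exact: c2|exact: c1| |].
  by move=> x z; rewrite /act3 a1.
by move=> x y; rewrite /act3 a2.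
Qed.

(** The action of [p] maps the image of the codifferential onto itself; the inverse action gives
the preimages. *)
Lemma coh_class_equivariant u :
  coh_class G zl zu (hcomp l (curvature_fun om (pb_act u p))) =
  act2 q @` coh_class G zl zu (hcomp l (curvature_fun om u)).
Proof.
suff H ku ku' : ku' = act2 q ku -> coh_class G zl zu ku' = act2 q @` coh_class G zl zu ku.
  exact: H (lowest_equivariant u).
move=> ->.
have thD := linPD th_lin.
have tt x : tn (th (vsval (tn (th' (vsval x))))) = x.
  rewrite (val_graded_map_neg grd Al') -/th' thK.
  exact: toneg_val.
apply/seteqP; split => [f [chi c fE]|_ [f [chi c fE] <-]].
  pose chi' := act3 (gr := gr) th' th chi.
  have c' : cochain3 chi' by exact: act_cochain3.
  exists (fun x y => ku x y + codiff3 G zl zu chi' x y); first by exists chi'.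
  apply/funext => x; apply/funext => y; rewrite fE /act2 -/th thD; congr (_ + _).
  have E := codiff3_act3 grd lin lC zb zub zd th_lin' th_lin thK' thK th_gp' th_gp th_br'
    (tn (th' (vsval x))) (tn (th' (vsval y))) (cochain_trilin c).
  have E2 := etrans (congr1 th E) (etrans (thK _) (congr2 (codiff3_br (lie G) zl zu chi) (tt x) (tt y))).
  exact: E2.
exists (act3 (gr := gr) th th' chi); first exact: act_cochain3.
move=> x y; rewrite /act2 -/th fE thD; congr (_ + _).
have E := codiff3_act3 grd lin lC zb zub zd th_lin th_lin' thK thK' th_gp th_gp' th_br
  x y (cochain_trilin c).
exact: esym E.
Qed.

End Equivariance.

Section Normal.
Variables (r : nat) (zl : r.-tuple gm) (zu : r.-tuple g).
Hypothesis dz : dual_bases G zl zu.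
Hypothesis normal : forall u x, codiff2 G zl zu (curvature_fun om u) x = 0.

Lemma lowest_coclosed u x : codiff2 G zl zu (hcomp l (curvature_fun om u)) x = 0.
Proof.
have H := codiff2_hcomp grd lin lC lie_graded
  (db_neg dz) (db_pos dz) (db_dual dz) l (kappa_bilin u) x.
have N y : codiff2_br (lie G) zl zu (kappa u) y = 0.
  by have := normal u y; rewrite curvature_funE.
rewrite curvature_funE; refine (etrans H _).
by rewrite big1 // => i _; rewrite N grpart0.
Qed.

Lemma lowest_cocycle u : cocycle G zl zu (hcomp l (curvature_fun om u)).
Proof. by split; [exact: lowest_cochain|exact: lowest_coclosed]. Qed.

Lemma lowest_section :
  H2_section zl zu (fun u => coh_class G zl zu (hcomp l (curvature_fun om u))).
Proof.
split.
- by move=> u; exists (hcomp l (curvature_fun om u)); first exact: lowest_cocycle.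
- by move=> u p; exact: coh_class_equivariant.
- move=> u; exists (fun v => hcomp l (curvature_fun om v)); split.
    by near=> v; split; [exact: lowest_cocycle|].
  by move=> x y; exact: smooth_lowest.
Unshelve. all: by end_near. Qed.

Lemma lowest_harmonic u x y : laplacian G zl zu (hcomp l (curvature_fun om u)) x y = 0.
Proof.
have c0 : codiff2 G zl zu (hcomp l (curvature_fun om u)) = (fun=> 0).
  by apply/funext => z; exact: lowest_coclosed.
have d0 : diff2 G (hcomp l (curvature_fun om u)) = (fun _ _ _ => 0).
  by apply/funext => a; apply/funext => b; apply/funext => c; exact: lowest_closed.
have l0 A : lie G A 0 = 0 by exact: (br0r lin).
rewrite /laplacian c0 d0 /diff1 /codiff3 !l0 !subr0 add0r.
rewrite big1; last by move=> i _; exact: l0.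
by rewrite oppr0 add0r big1 ?scaler0 // => i _; rewrite addr0.
Qed.

End Normal.
End Setting.
End Assembly.

Theorem proposition5p1 (R : realType)
  (n : nat) (G : lie_group R n) (ssG : semisimple G)
  (gr : int -> {vspace 'rV[R]_n}) (grG : two_grading G gr)
  (m : nat) (P : filtration_subgroup G gr m)
  (d k : nat) (M : manifold R d) (Q : principal_bundle k P M)
  (dimM : d = \dim (gneg gr))
  (om : Q -> 'Hom('rV[R]_k, 'rV[R]_n)) (ccom : cartan_connection om)
  (r : nat) (zl : r.-tuple (subvs_of (gneg gr))) (zu : r.-tuple 'rV[R]_n)
  (dual_z : dual_bases G zl zu)
  (normal : forall u x, codiff2 G zl zu (curvature_fun om u) x = 0)
  (l : int) (lowest : lowest_homogeneity (curvature_fun om) l) :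
  let kappa_l := fun u => hcomp l (curvature_fun om u) in
  [/\ forall u x, codiff2 G zl zu (kappa_l u) x = 0,
      forall u x y z, diff2 G (kappa_l u) x y z = 0,
      H2_section zl zu (fun u => coh_class G zl zu (kappa_l u)) &
      forall u x y, laplacian G zl zu (kappa_l u) x y = 0].
Proof.
have [low _] := lowest; move=> kappa_l; split.
- by move=> u x; exact: (lowest_coclosed grG ccom l dual_z normal).
- by move=> u x y z; exact: (lowest_closed grG ccom low).
- exact: (lowest_section grG ccom low dual_z normal).
- by move=> u x y; exact: (lowest_harmonic grG ccom low dual_z normal).
Qed.
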